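(* For every $w\in W=S_r$, $$\mathcal{B}_\infty(w)=\{v\in\mathcal{B}_\infty\mid \omega^\dagger(v)\,w_0\le w\}=\{v\in\mathcal{B}_\infty\mid w_0\,\omega(v)\le w\},$$ and for every $v\in\mathcal{B}_\infty$, $$w_0\,\omega(v)\,w_0=\omega^\dagger(v)=\omega(v^\star)^{-1}.$$
   Context: Type $A_{r-1}$, $r\ge2$; $W=S_r$ with $s_i=(i,i+1)$, Bruhat order $\le$, longest element $w_0$. $\mathcal{B}_\infty$ is Kashiwara's crystal (crystal base of the negative part of the quantum group) with highest weight element $u_0$, Kashiwara operators $e_i,f_i$, and $v\mapsto v^\star$ is Kashiwara's $\star$-involution. Demazure crystals: $\mathcal{B}_\infty(1)=\{u_0\}$, and if $s_iw>w$ then $\mathcal{B}_\infty(s_iw)=\{v\mid e_i^kv\in\mathcal{B}_\infty(w)\text{ for some }k\ge0\}$. Realization: let $J$ be the reduced word for $w_0$ obtained by concatenating blocks $(r-m,\dots,r-1)$, $m=1,\dots,r-1$. With $\mathcal{B}_j=\{u_j(a):a\in\mathbb{Z}\}$ Kashiwara's elementary crystals, $\mathcal{B}_\infty$ is identified with the subcrystal of $\mathcal{B}_{J_1}\otimes\cdots\otimes\mathcal{B}_{J_M}$ (tensor convention of Bump–Schilling) generated from $u_{J_1}(0)\otimes\cdots\otimes u_{J_M}(0)$ by the $f_i$. Thus each $v$ is $v=D_1\otimes\cdots\otimes D_{r-1}$, $D_i=u_{r-i}(-d_{i,r-i})\otimes\cdots\otimes u_{r-1}(-d_{i,r-1})$,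 with $d_{i,r-i}\ge\cdots\ge d_{i,r-1}\ge0$. Set $d_{i,r}=0$ and $c_{i,j}=d_{i,j}-d_{i,j+1}$. Degenerate Hecke algebra $\mathcal{H}$: generators $S_1,\dots,S_{r-1}$ with braid relations and $S_i^2=S_i$; it has basis $S_w$ ($w\in W$, $S_w=S_{j_1}\cdots S_{j_\ell}$ for a reduced word), and $\{S_w\}=w$. Let $\Omega_i(D_i)=\prod_{j=1}^{i}X_j$ (product in increasing $j$) with $X_j=S_j$ if $c_{i,r-1+j-i}=0$ and $X_j=1$ otherwise, and $\omega^\dagger(v)=\{\Omega_{r-1}(D_{r-1})\cdots\Omega_1(D_1)\}$. $\omega:\mathcal{B}_\infty\to W$: for $v$ let $b_1$ be maximal with $e_{J_1}^{b_1}v\ne0$, $b_2$ maximal with $e_{J_2}^{b_2}e_{J_1}^{b_1}v\ne0$, etc. Put $\beta_{m,p}=b_{m(m-1)/2+p}$; $\beta_{m,p}$ is circled if $p=m$ and $\beta_{m,m}=0$, or $p<m$ and $\beta_{m,p}=\beta_{m,p+1}$. List, for $m=1,\dots,r-1$ and within each $m$ for $p=m,\dots,1$, the $s_p$ with $\beta_{m,p}$ circled, as $(s_{j_1},\dots,s_{j_k})$; $\omega(v)=\{S_{j_1}\cdots S_{j_k}\}$ (equivalently the nondescending product: $\Pi_{\mathrm{nd}}(s_{i_1},\dots,s_{i_k})=s_{i_1}\pi$ if $s_{i_1}\pi>\pi$, else $\pi$, with $\pi=\Pi_{\mathrm{nd}}(s_{i_2},\dots)$ and empty product $1$). *)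

(* Defs.v *)
From HB Require Import structures.
From mathcomp Require Import all_boot all_order all_algebra all_fingroup.
From mathcomp Require Import boolp classical_sets constructive_ereal.

Set Implicit Arguments.
Unset Strict Implicit.
Unset Printing Implicit Defensive.

Import Order.TTheory GRing.Theory Num.Theory.

(* Simple reflections, crystal operators and Hecke generators of type A_(r-1)
   are all indexed by the natural numbers 1, ..., r-1.  *)
Definition simple_index (r i : nat) : bool := (0 < i < r)%N.

Section WeylGroup.
Local Open Scope group_scope.
Variable r : nat.

(* s_i = (i, i+1); the points 1, ..., r are represented by 0, ..., r-1 in 'I_r,
   so that s_i exchanges i-1 and i.  The product of 'S_r composes from left to
   right, whereas permutations are often composed from right to left; the two
   groups are identified by w |-> w^-1, which fixes every s_i and preserves
   words in the s_i, length and Bruhat order. *)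
Definition s_ (i : nat) : 'S_r :=
  match insub i.-1, insub i with
  | Some a, Some b => tperm a b
  | _, _ => 1
  end.

(* Coxeter length of a permutation: its number of inversions. *)
Definition len (w : 'S_r) : nat :=
  #|[set p : 'I_r * 'I_r | (p.1 < p.2)%N && (w p.2 < w p.1)%N]|.

(* Bruhat order: reflexive-transitive closure of x < xt,
   t a transposition with len x < len (xt). *)
Definition bruhat_step : rel 'S_r := fun x y =>
  [exists a : 'I_r, exists b : 'I_r, (y == x * tperm a b) && (len x < len y)%N].

Definition bruhat_le : rel 'S_r := connect bruhat_step.

Definition bruhat_lt : rel 'S_r := fun x y => (x != y) && bruhat_le x y.

Definition w0 : 'S_r := [arg max_(w > 1) len w].

Definition word_prod (t : seq nat) : 'S_r := \prod_(i <- t) s_ i.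

Definition reduced_word (w : 'S_r) (t : seq nat) : bool :=
  [&& all (simple_index r) t, word_prod t == w & size t == len w].

End WeylGroup.

(* Equality S_(j_1) ... S_(j_k) = S_(j'_1) ... S_(j'_k') in the degenerate Hecke
   algebra of S_r.  Both sides of every defining relation are monomials, so the
   algebra is the monoid algebra of the monoid presented by these relations. *)
Inductive hecke_eq (r : nat) : seq nat -> seq nat -> Prop :=
| hecke_refl t : hecke_eq r t t
| hecke_sym t u : hecke_eq r t u -> hecke_eq r u t
| hecke_trans t u v : hecke_eq r t u -> hecke_eq r u v -> hecke_eq r t v
| hecke_cat t t' u u' :
    hecke_eq r t t' -> hecke_eq r u u' -> hecke_eq r (t ++ u) (t' ++ u')
| hecke_idem i : simple_index r i -> hecke_eq r [:: i; i] [:: i]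
| hecke_comm i j : simple_index r i -> simple_index r j -> (i.+1 < j)%N ->
    hecke_eq r [:: i; j] [:: j; i]
| hecke_braid i : simple_index r i -> simple_index r i.+1 ->
    hecke_eq r [:: i; i.+1; i] [:: i.+1; i; i.+1].

(* {S_(j_1) ... S_(j_k)}: the w such that S_(j_1) ... S_(j_k) = S_w. *)
Definition hecke_perm (r : nat) (t : seq nat) : 'S_r :=
  xget 1%g [set w : 'S_r | exists2 u, reduced_word w u & hecke_eq r t u]%classic.

Local Open Scope ring_scope.
Local Open Scope ereal_scope.

(* Cartan matrix <alpha_j, alpha_i^vee> of type A. *)
Definition cartan (i j : nat) : int :=
  if i == j then 2%:Z%R
  else if (i == j.+1) || (j == i.+1) then (-1)%R else 0%R.

(* The data of a Kashiwara crystal (the crystal axioms hold for all the crystals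
   below but are not needed to define them).  The weight is recorded through cwt x i = <wt x, alpha_i^vee>; the value None
   of e_i, f_i is the zero of crystal theory. *)
Record crystal := Crystal {
  car :> choiceType;
  cwt : car -> nat -> int;
  ceps : nat -> car -> \bar int;
  cphi : nat -> car -> \bar int;
  ce : nat -> car -> option car;
  cf : nat -> car -> option car
}.

(* The elementary crystal B_j; the integer a stands for u_j(a). *)
Definition elementary (j : nat) : crystal := {|
  car := int;
  cwt := fun a i => (a * cartan i j)%R;
  ceps := fun i a => if i == j then (- a)%R%:E else -oo;
  cphi := fun i a => if i == j then a%:E else -oo;
  ce := fun i a => if i == j then Some (a + 1)%R else None;
  cf := fun i a => if i == j then Some (a - 1)%R else None
|}.

(* The crystal T_0, the unit of the tensor product. *)
Definition unit_crystal : crystal := {|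
  car := unit;
  cwt := fun _ _ => 0%R;
  ceps := fun _ _ => -oo;
  cphi := fun _ _ => -oo;
  ce := fun _ _ => None;
  cf := fun _ _ => None
|}.

(* Bump-Schilling convention, opposite to Kashiwara's. *)
Definition tensor (B C : crystal) : crystal := {|
  car := (B * C)%type;
  cwt := fun z i => (cwt z.1 i + cwt z.2 i)%R;
  ceps := fun i z => maxe (ceps i z.2) (ceps i z.1 - (cwt z.2 i)%:E);
  cphi := fun i z => maxe (cphi i z.1) (cphi i z.2 + (cwt z.1 i)%:E);
  ce := fun i z =>
    if cphi i z.2 < ceps i z.1 then omap (fun x => (x, z.2)) (ce i z.1)
    else omap (fun y => (z.1, y)) (ce i z.2);
  cf := fun i z =>
    if cphi i z.2 <= ceps i z.1 then omap (fun x => (x, z.2)) (cf i z.1)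
    else omap (fun y => (z.1, y)) (cf i z.2)
|}.

(* On a subset P, the operators e_i, f_i are zero when they leave P. *)
Definition subcrystal (B : crystal) (P : pred B) : crystal := {|
  car := {x : B | P x};
  cwt := fun x => cwt (val x);
  ceps := fun i x => ceps i (val x);
  cphi := fun i x => cphi i (val x);
  ce := fun i x => obind insub (ce i (val x));
  cf := fun i x => obind insub (cf i (val x))
|}.

(* e_i^k x *)
Definition e_iter (B : crystal) (i k : nat) (x : B) : option B :=
  iter k (obind (ce i)) (Some x).

(* f_(i_1) ... f_(i_k) x *)
Definition f_word (B : crystal) (t : seq nat) (x : B) : option B :=
  foldr (fun i => obind (cf i)) (Some x) t.

(* The largest k with e_i^k x <> 0. *)
Definition e_max (B : crystal) (i : nat) (x : B) : nat :=
  xget 0%N [set k | e_iter i k x <> None /\ e_iter i k.+1 x = None]%classic.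

(* b_1, b_2, ... : b_k is the largest exponent of e_(J_k) not killing
   e_(J_(k-1))^(b_(k-1)) ... e_(J_1)^(b_1) x. *)
Fixpoint string_data (B : crystal) (J : seq nat) (x : B) : seq nat :=
  if J is j :: J' then
    let b := e_max j x in b :: string_data J' (odflt x (e_iter j b x))
  else [::].

Fixpoint tensor_seq (J : seq nat) : crystal :=
  if J is j :: J' then tensor (elementary j) (tensor_seq J') else unit_crystal.

Fixpoint tensor_zero (J : seq nat) : tensor_seq J :=
  match J return tensor_seq J with
  | [::] => tt
  | j :: J' => (0%R : int, tensor_zero J')
  end.

(* The integers a_1, ..., a_M of u_(J_1)(a_1) (x) ... (x) u_(J_M)(a_M). *)
Fixpoint coords (J : seq nat) : tensor_seq J -> seq int :=
  match J return tensor_seq J -> seq int with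
  | [::] => fun _ => [::]
  | j :: J' => fun x => x.1 :: coords x.2
  end.

(* The long word: concatenation of the blocks (r-m, ..., r-1), 1 <= m <= r-1. *)
Definition Jword (r : nat) : seq nat :=
  flatten [seq iota (r - m) m | m <- iota 1 r.-1].

Definition generated (B : crystal) (x : B) : pred B :=
  fun y => `[< exists t : seq nat, f_word t x = Some y >].

Definition Binf (r : nat) : crystal :=
  subcrystal (generated (tensor_zero (Jword r))).

Lemma generated_refl (B : crystal) (x : B) : generated x x.
Proof. by apply/asboolP; exists [::]. Qed.

Definition u_zero (r : nat) : Binf r :=
  exist _ (tensor_zero (Jword r)) (generated_refl (tensor_zero (Jword r))).

(* demazure w is B_infinity(w).  As an inductive predicate it is the union of the
   sets obtained from the recursion along all reduced words of w; that these sets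
   coincide is the well-definedness of B_infinity(w). *)
Inductive demazure (r : nat) : 'S_r -> Binf r -> Prop :=
| demazure_one : demazure 1%g (u_zero r)
| demazure_up (i : nat) (w : 'S_r) (v y : Binf r) (k : nat) :
    simple_index r i -> bruhat_lt w (s_ r i * w)%g ->
    e_iter i k v = Some y -> demazure w y ->
    demazure (s_ r i * w)%g v.

(* Psi_i : B_infinity -> B_i (x) B_infinity, the crystal embedding with
   Psi_i(u_0) = u_i(0) (x) u_0, as a relation: Psi_i commutes with the f_j, hence
   is given by Psi_i(f_(i_1) ... f_(i_k) u_0)
     = f_(i_1) ... f_(i_k) (u_i(0) (x) u_0). *)
Definition Psi (r i : nat) (v : Binf r) (z : tensor (elementary i) (Binf r)) :
    Prop :=
  exists2 t : seq nat, f_word t (u_zero r) = Some v &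
    @f_word (tensor (elementary i) (Binf r)) t (0%R : int, u_zero r) = Some z.

Arguments Psi {r} i v z.

(* v' = f_i^star v, where f_i^star = star o f_i o star is the operator that acts
   on the factor B_i only: if Psi_i(v) = u_i(a) (x) x then
   Psi_i(f_i^star v) = u_i(a-1) (x) x (Kashiwara's embedding theorem). *)
Definition f_star (r i : nat) (v v' : Binf r) : Prop :=
  exists (a : int) (x : Binf r), Psi i v (a, x) /\ Psi i v' ((a - 1)%R, x).

(* star is determined by star(u_0) = u_0 and star(f_i v) = f_i^star star(v). *)
Inductive star_graph (r : nat) : Binf r -> Binf r -> Prop :=
| star_u_zero : star_graph (u_zero r) (u_zero r)
| star_f (i : nat) (v y v' y' : Binf r) :
    star_graph v v' -> cf i v = Some y -> f_star i v' y' -> star_graph y y'.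

Definition star (r : nat) (v : Binf r) : Binf r :=
  xget v [set v' | star_graph v v']%classic.

Section Omega.
Local Open Scope nat_scope.
Variable r : nat.

(* Block m of the long word occupies the positions m(m-1)/2, m(m-1)/2+1, ... *)
Definition dcoord (v : Binf r) (i j : nat) : int :=
  if j == r then 0%R
  else (- nth 0%R (coords (val v)) ((i * i.-1)./2 + (j - (r - i))))%R.

Definition ccoord (v : Binf r) (i j : nat) : int :=
  (dcoord v i j - dcoord v i j.+1)%R.

Definition Omega_word (v : Binf r) (i : nat) : seq nat :=
  [seq j <- iota 1 i | ccoord v i (r - 1 + j - i) == 0%R].

Definition omega_dag (v : Binf r) : 'S_r :=
  hecke_perm r (flatten [seq Omega_word v i | i <- rev (iota 1 r.-1)]).

Definition beta (v : Binf r) (m p : nat) : nat :=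
  nth 0 (string_data (Jword r) v) ((m * m.-1)./2 + p.-1).

Definition circled (v : Binf r) (m p : nat) : bool :=
  if p == m then beta v m m == 0 else beta v m p == beta v m p.+1.

Definition omega_word (v : Binf r) : seq nat :=
  flatten [seq [seq p <- rev (iota 1 m) | circled v m p] | m <- iota 1 r.-1].

Definition omega (v : Binf r) : 'S_r := hecke_perm r (omega_word v).

End Omega.

(* Main.v *)
(* Write kappa(v) = omega_dag(v) w_0.  By the signature rule on the segment
   multiplicities c, the word of zero entries of c that defines omega_dag(v)
   satisfies S_i omega_dag(v) = S_i omega_dag(e_i v) in the degenerate Hecke algebra,
   and S_i omega_dag(v) = omega_dag(v) when epsilon_i(v) = 0: the letter S_i can be
   pushed through the word by braid moves.  Hence kappa takes at most two values
   kappa(v_0), s_i kappa(v_0) > kappa(v_0) on an i-string with head v_0, and the lifting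
   property of the Bruhat order identifies {v | kappa(v) <= w} with B_infinity(w).
   Next, u_i (x) u_j (x) u_i and u_j (x) u_i (x) u_j span isomorphic crystals, by an explicit
   piecewise linear map, and i J is braid equivalent to J (r-i); since epsilon >= 0 on
   B_infinity this yields Psi_i as v |-> v (x) u_(r-i)(0).  The operators f_i and f_k^star
   commute up to the usual exceptions for i = k.  Hence star is a well-defined
   involution, the coordinates of v are the string of star(v), which makes
   omega_dag(v) and omega(star(v)) inverse to each other, and star exchanges B_infinity(w) with
   B_infinity(w^-1), so that kappa(star(v)) = kappa(v)^-1. *)

Require Import Defs.
From mathcomp Require Import all_boot all_order all_algebra all_fingroup.
From mathcomp Require Import boolp classical_sets constructive_ereal.
From mathcomp Require Import zify.

Set Implicit Arguments.
Unset Strict Implicit.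
Unset Printing Implicit Defensive.

Import Order.TTheory GRing.Theory Num.Theory.

(** * Words of elementary crystals *)

(** The operators are studied on words with arbitrary integer exponents. There [e_k] and [f_k]
    become mutually inverse bijections, so the isomorphisms between words need no case for the zero
    of crystal theory. B_infinity is then the cone of weakly decreasing nonnegative rows, and [e_k]
    leaves this cone exactly when epsilon_k = 0. The obstacle is star: [Psi] and [star_graph] are
    relations that depend on a choice of a word in the f_j. Isomorphisms of words make [Psi] single
    valued; that its image is stable under lowering the exponent of B_i, as Kashiwara's theorem
    asserts, is proved by induction along f-words; star is single valued because two last steps f_i
    and f_j^star leading to the same element either agree or close up to a square. The Hecke monoid
    enters through its action on permutations by sorting two adjacent entries, together with normal
    words, which show that every class contains a reduced word. *)

Section WordCrystal.
Local Open Scope ring_scope.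

(* [None] stands for -oo. *)
Definition opt_max (x y : option int) : option int :=
  match x, y with
  | None, _ => y
  | _, None => x
  | Some a, Some b => Some (Num.max a b)
  end.

Definition opt_le (x y : option int) : bool :=
  match x, y with
  | None, _ => true
  | Some _, None => false
  | Some a, Some b => a <= b
  end.

Definition opt_add (x : option int) (n : int) : option int := omap (fun a => a + n) x.

Definition word_term := seq (nat * int).
Implicit Types z : word_term.

Fixpoint term_wt (k : nat) z : int :=
  if z is (j, a) :: z' then a * cartan k j + term_wt k z' else 0.

Fixpoint term_eps (k : nat) z : option int :=
  if z is (j, a) :: z'
  then opt_max (term_eps k z') (if k == j then Some (- a - term_wt k z') else None)
  else None.

(** On a word without the letter k the operators are the identity, where crystal theory has zero;
    this makes [term_f k] a bijection with inverse [term_e k]. Ties send [term_f] to the left and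
    [term_e] to the right. *)
Fixpoint term_f (k : nat) z : word_term :=
  if z is (j, a) :: z' then
    if (k == j) && opt_le (term_eps k z') (Some (- a - term_wt k z'))
    then (j, a - 1) :: z' else (j, a) :: term_f k z'
  else [::].

Fixpoint term_e (k : nat) z : word_term :=
  if z is (j, a) :: z' then
    if (k == j) && ~~ opt_le (Some (- a - term_wt k z')) (term_eps k z')
    then (j, a + 1) :: z' else (j, a) :: term_e k z'
  else [::].

Lemma cartan_diag k : cartan k k = 2.
Proof. by rewrite /cartan eqxx. Qed.

Lemma term_wt_cat k z1 z2 : term_wt k (z1 ++ z2) = term_wt k z1 + term_wt k z2.
Proof. by elim: z1 => [|[j a] z1 IH] /=; rewrite ?add0r // IH addrA. Qed.

Lemma term_eps_cat k z1 z2 :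
  term_eps k (z1 ++ z2) = opt_max (term_eps k z2) (opt_add (term_eps k z1) (- term_wt k z2)).
Proof.
elim: z1 => [|[j a] z1 IH] /=; first by case: (term_eps k z2).
rewrite IH term_wt_cat; case: (term_eps k z2) (term_eps k z1) => [x|] [y|] //=; case: eqP => //= _;
  congr Some; lia.
Qed.

Lemma term_f_absent k z : term_eps k z = None -> term_f k z = z.
Proof.
elim: z => [|[j a] z IH] //=; case: eqP => [->|_] /=; case E: (term_eps _ z) => //= _.
by rewrite IH.
Qed.

(** Associativity of the tensor product: a word may be cut at any place and treated as a product of
    two factors. *)
Lemma term_f_cat k z1 z2 :
  term_f k (z1 ++ z2) =
  if opt_le (term_eps k z2) (opt_add (term_eps k z1) (- term_wt k z2)) then term_f k z1 ++ z2
  else z1 ++ term_f k z2.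
Proof.
elim: z1 => [|[j a] z1 IH] /=.
  by case E: (term_eps k z2) => [x|] //=; rewrite term_f_absent.
rewrite IH term_eps_cat term_wt_cat; case: eqP => [->|_] /=; last first.
  by case: (term_eps k z2) (term_eps k z1) => [x|] [y|] //=; case: ifP.
by case: (term_eps j z2) (term_eps j z1) => [x|] [y|] //=; repeat case: ifP => //=; lia.
Qed.

Lemma term_e_cat k z1 z2 :
  term_e k (z1 ++ z2) =
  if opt_le (opt_add (term_eps k z1) (- term_wt k z2)) (term_eps k z2) then z1 ++ term_e k z2
  else term_e k z1 ++ z2.
Proof.
elim: z1 => [|[j a] z1 IH] //=.
rewrite IH term_eps_cat term_wt_cat; case: eqP => [->|_] /=; last first.
  by case: (term_eps k z2) (term_eps k z1) => [x|] [y|] //=; case: ifP.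
by case: (term_eps j z2) (term_eps j z1) => [x|] [y|] //=; repeat case: ifP => //=; lia.
Qed.


Lemma term_wt_term_f k j z :
  term_wt k (term_f j z) = term_wt k z - (if term_eps j z is Some _ then cartan k j else 0).
Proof.
elim: z => [|[l a] z IH] //=; case: eqP => [<-|_] /=; last first.
  by rewrite IH; case: (term_eps j z) => [x|] /=; lia.
by case E: (term_eps j z) IH => [x|] /= IH; last (by lia); case: ifP => _ /=; lia.
Qed.

Lemma term_wt_term_e k j z :
  term_wt k (term_e j z) = term_wt k z + (if term_eps j z is Some _ then cartan k j else 0).
Proof.
elim: z => [|[l a] z IH] //=; case: eqP => [<-|_] /=; last first.
  by rewrite IH; case: (term_eps j z) => [x|] /=; lia.
by case E: (term_eps j z) IH => [x|] /= IH; last (by lia); case: ifP => _ /=; lia.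
Qed.

Lemma term_eps_term_f k z : term_eps k (term_f k z) = opt_add (term_eps k z) 1.
Proof.
elim: z => [|[l a] z IH] //=; case: eqP => [<-|/eqP/negPf ne] /=; last first.
  by rewrite ne IH; case: (term_eps k z).
move: IH; case E: (term_eps k z) => [x|] /= IH; last first.
  by rewrite eqxx E /=; congr Some; lia.
case: ifP => /= c; rewrite eqxx; first by rewrite E /=; congr Some; lia.
by rewrite IH term_wt_term_f E cartan_diag /=; congr Some; lia.
Qed.

Lemma term_eps_term_e k z : term_eps k (term_e k z) = opt_add (term_eps k z) (-1).
Proof.
elim: z => [|[l a] z IH] //=; case: eqP => [<-|/eqP/negPf ne] /=; last first.
  by rewrite ne IH; case: (term_eps k z).
move: IH; case E: (term_eps k z) => [x|] /= IH; last first.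
  by rewrite eqxx E /=; congr Some; lia.
case: ifP => /= c; rewrite eqxx; first by rewrite E /=; congr Some; lia.
by rewrite IH term_wt_term_e E cartan_diag /=; congr Some; lia.
Qed.

Lemma term_fK k z : term_e k (term_f k z) = z.
Proof.
elim: z => [|[l a] z IH] //=; case: eqP => [<-|/eqP/negPf ne] /=; last first.
  by rewrite ne IH.
case: ifP => /= c; rewrite eqxx.
  by case: (term_eps k z) c => [x|] /= c; [case: ifP => c'|]; rewrite ?addrNK //; lia.
rewrite term_eps_term_f term_wt_term_f cartan_diag.
by case E: (term_eps k z) c IH => [x|] //= c ->; case: ifP => //; lia.
Qed.

Lemma term_eK k z : term_f k (term_e k z) = z.
Proof.
elim: z => [|[l a] z IH] //=; case: eqP => [<-|/eqP/negPf ne] /=; last first.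
  by rewrite ne IH.
case: ifP => /= c; rewrite eqxx.
  by case: (term_eps k z) c => [x|] /= c; [case: ifP => c'|]; rewrite ?addrK //; lia.
rewrite term_eps_term_e term_wt_term_e cartan_diag.
by case E: (term_eps k z) c IH => [x|] //= c ->; case: ifP => //; lia.
Qed.

Lemma term_f_inj k : injective (term_f k).
Proof. exact: can_inj (term_fK k). Qed.

Lemma letters_term_f k z : unzip1 (term_f k z) = unzip1 z.
Proof. by elim: z => [|[l a] z IH] //=; case: ifP => //= _; rewrite IH. Qed.

Lemma letters_term_e k z : unzip1 (term_e k z) = unzip1 z.
Proof. by elim: z => [|[l a] z IH] //=; case: ifP => //= _; rewrite IH. Qed.

Lemma term_eps_some k z : isSome (term_eps k z) = (k \in unzip1 z).
Proof.
by elim: z => [|[l a] z IH] //=; rewrite inE -IH; case: eqP; case: (term_eps k z).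
Qed.

Definition zero_term (J : seq nat) : word_term := [seq (j, 0) | j <- J].

Lemma letters_zero_term J : unzip1 (zero_term J) = J.
Proof. by rewrite /unzip1 /zero_term -map_comp map_id. Qed.

Lemma term_wt_zero_term k J : term_wt k (zero_term J) = 0.
Proof. by elim: J => //= j J ->; lia. Qed.

Lemma term_eps_zero_term k J : term_eps k (zero_term J) = if k \in J then Some 0 else None.
Proof.
elim: J => //= j J ->; rewrite inE term_wt_zero_term.
by case: eqP => //= _; case: (k \in J).
Qed.

(** Commutation with [term_e] is implied, since it inverts [term_f]. Injectivity takes the place of
    an inverse map, and [iso_zero] fixes the image of the highest weight element. *)
Record word_iso (J J' : seq nat) (t : word_term -> word_term) : Prop := WordIso {
  iso_letters : forall z, unzip1 z = J -> unzip1 (t z) = J';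
  iso_wt : forall k z, unzip1 z = J -> term_wt k (t z) = term_wt k z;
  iso_eps : forall k z, unzip1 z = J -> term_eps k (t z) = term_eps k z;
  iso_f : forall k z, unzip1 z = J -> t (term_f k z) = term_f k (t z);
  iso_inj : forall z z', unzip1 z = J -> unzip1 z' = J -> t z = t z' -> z = z';
  iso_zero : t (zero_term J) = zero_term J'
}.

Definition word_equiv J J' := exists t, word_iso J J' t.

Lemma word_equiv_refl J : word_equiv J J.
Proof. by exists id. Qed.

Lemma word_equiv_trans J2 J1 J3 :
  word_equiv J1 J2 -> word_equiv J2 J3 -> word_equiv J1 J3.
Proof.
move=> [t [l w e f i o]] [t' [l' w' e' f' i' o']]; exists (t' \o t).
split=> [z /l/l'|k z h|k z h|k z h|z z' h h'|] //=.
- by rewrite w' ?w //; exact: l.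
- by rewrite e' ?e //; exact: l.
- by rewrite f // f' //; exact: l.
- by move/(i' _ _ (l _ h) (l _ h')); exact: i.
- by rewrite o.
Qed.

(** The tensor product rule sees each factor only through epsilon and the weight, which both maps
    preserve. *)
Lemma word_equiv_cat J1 J1' J2 J2' :
  word_equiv J1 J1' -> word_equiv J2 J2' -> word_equiv (J1 ++ J2) (J1' ++ J2').
Proof.
move=> [t1 i1] [t2 i2].
pose t (z : word_term) := t1 (take (size J1) z) ++ t2 (drop (size J1) z).
have sp z : unzip1 z = J1 ++ J2 -> exists z1 z2,
    [/\ z = z1 ++ z2, unzip1 z1 = J1 & unzip1 z2 = J2].
  move=> h; exists (take (size J1) z), (drop (size J1) z).
  by rewrite cat_take_drop /unzip1 map_take map_drop -/(unzip1 z) h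
    take_size_cat // drop_size_cat.
have tE z1 z2 : unzip1 z1 = J1 -> t (z1 ++ z2) = t1 z1 ++ t2 z2.
  by move=> h; rewrite /t -h size_map take_size_cat // drop_size_cat.
exists t; split.
- by move=> _ /sp[z1 [z2 [-> h1 h2]]]; rewrite tE // /unzip1 map_cat -!/(unzip1 _)
    (iso_letters i1 h1) (iso_letters i2 h2).
- by move=> k _ /sp[z1 [z2 [-> h1 h2]]]; rewrite tE // !term_wt_cat (iso_wt i1) // (iso_wt i2).
- by move=> k _ /sp[z1 [z2 [-> h1 h2]]];
    rewrite tE // !term_eps_cat (iso_eps i1) // (iso_eps i2) // (iso_wt i2).
- move=> k _ /sp[z1 [z2 [-> h1 h2]]].
  rewrite tE // !term_f_cat (iso_eps i1) // (iso_eps i2) // (iso_wt i2) //.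
  by case: ifP => _; rewrite tE ?letters_term_f ?(iso_f i1) ?(iso_f i2).
- move=> _ _ /sp[z1 [z2 [-> h1 h2]]] /sp[y1 [y2 [-> g1 g2]]]; rewrite !tE // => /eqP.
  rewrite eqseq_cat; last first.
    by rewrite -(size_map fst) -/(unzip1 _) (iso_letters i1) // -(iso_letters i1 g1) size_map.
  by case/andP => /eqP /(iso_inj i1 h1 g1) -> /eqP /(iso_inj i2 h2 g2) ->.
- rewrite /zero_term !map_cat -!/(zero_term _) tE ?letters_zero_term //.
  by rewrite (iso_zero i1) (iso_zero i2).
Qed.

Lemma word_equiv_comm i j : (i.+1 < j)%N || (j.+1 < i)%N -> word_equiv [:: i; j] [:: j; i].
Proof.
move=> far.
have cij : cartan i j = 0 /\ cartan j i = 0 by rewrite /cartan; split; do ![case: ifP => ?]; lia.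
case: cij => cij cji.
exists (fun z => if z is [:: x; y] then [:: y; x] else z).
have sp z : unzip1 z = [:: i; j] -> exists a b, z = [:: (i, a); (j, b)].
  by case: z => [|[? a] [|[? b] [|]]] //= [-> ->]; exists a, b.
have ij : i == j = false by lia.
have ji : j == i = false by lia.
split=> //.
- by move=> _ /sp[a [b ->]].
- by move=> k _ /sp[a [b ->]] /=; lia.
- move=> k _ /sp[a [b ->]] /=.
  by do 2?[case: eqP => ?; subst]; rewrite ?eqxx ?ij ?ji ?cij ?cji /= ?mulr0 ?addr0 //; lia.
- move=> k _ /sp[a [b ->]] /=.
  by do 2?[case: eqP => ?; subst]; rewrite ?eqxx ?ij ?ji ?cij ?cji /= ?mulr0 ?addr0 //; lia.
- by move=> _ _ /sp[a [b ->]] /sp[a' [b' ->]] [-> ->].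
Qed.

Lemma word_equiv_braid i j : (j == i.+1) || (i == j.+1) ->
  word_equiv [:: i; j; i] [:: j; i; j].
Proof.
move=> adj.
have [cij cji] : cartan i j = -1 /\ cartan j i = -1 by rewrite /cartan; split;
  do ![case: ifP => ?]; lia.
(* The transition map of the string parametrizations for the two reduced words
   of the long element of S_3, which makes sense on the whole of Z^3. *)
exists (fun z => if z is [:: (_, a); (_, b); (_, c)] then
  [:: (j, Num.min c (b - a)); (i, a + c); (j, Num.max a (b - c))] else z).
have sp z : unzip1 z = [:: i; j; i] -> exists a b c, z = [:: (i, a); (j, b); (i, c)].
  by case: z => [|[? a] [|[? b] [|[? c] [|]]]] //= [-> -> ->]; exists a, b, c.
have ij : i == j = false by lia.
have ji : j == i = false by lia.
split=> //.
- by move=> _ /sp[a [b [c ->]]].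
- move=> k _ /sp[a [b [c ->]]] /=.
  have -> : Num.min c (b - a) = b - Num.max a (b - c) by lia.
  lia.
- move=> k _ /sp[a [b [c ->]]] /=.
  do 2?[case: eqP => ?; subst]; rewrite ?eqxx ?ij ?ji ?cij ?cji ?cartan_diag /= ?mulr0 ?addr0 //;
    try congr Some; lia.
- move=> k _ /sp[a [b [c ->]]] /=.
  do 2?[case: eqP => ?; subst];
    rewrite ?eqxx ?ij ?ji ?cij ?cji ?cartan_diag /= ?mulr0 ?addr0 //;
    try lia; repeat match goal with |- context [if ?b then _ else _] => case: (boolP b) => ? /=
      end; try lia; congr [:: (_, _); (_, _); (_, _)]; lia.
- move=> _ _ /sp[a [b [c ->]]] /sp[a' [b' [c' ->]]] [] h1 h2 h3.
  congr [:: (_, _); (_, _); (_, _)]; lia.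
Qed.

End WordCrystal.

(** * Braid moves and the long word *)

Inductive braid_eq (r : nat) : seq nat -> seq nat -> Prop :=
| braid_refl t : braid_eq r t t
| braid_sym t u : braid_eq r t u -> braid_eq r u t
| braid_trans t u v : braid_eq r t u -> braid_eq r u v -> braid_eq r t v
| braid_cat t t' u u' :
    braid_eq r t t' -> braid_eq r u u' -> braid_eq r (t ++ u) (t' ++ u')
| braid_comm i j : simple_index r i -> simple_index r j -> (i.+1 < j)%N ->
    braid_eq r [:: i; j] [:: j; i]
| braid_braid i : simple_index r i -> simple_index r i.+1 ->
    braid_eq r [:: i; i.+1; i] [:: i.+1; i; i.+1].

Lemma braid_hecke r t u : braid_eq r t u -> hecke_eq r t u.
Proof.
elim=> {t u} [t|t u _|t u v _ + _|t t' u u' _ + _|i j|i].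
- exact: hecke_refl.
- exact: hecke_sym.
- exact: hecke_trans.
- exact: hecke_cat.
- exact: hecke_comm.
- exact: hecke_braid.
Qed.

Lemma braid_word_equiv r t u : braid_eq r t u -> word_equiv t u.
Proof.
(* A [word_iso] carries no inverse, so the induction keeps both directions. *)
move=> h; suff [] : word_equiv t u /\ word_equiv u t by [].
elim: h => {t u} [t|t u _ []|t u v _ [h1 h2] _ [h3 h4]|t t' u u' _ [h1 h2] _ [h3 h4]|
                  i j _ _ ij|i _ _]; split; rewrite //.
- exact: word_equiv_refl.
- exact: word_equiv_refl.
- exact: word_equiv_trans h3.
- exact: word_equiv_trans h2.
- exact: word_equiv_cat.
- exact: word_equiv_cat.
- by apply: word_equiv_comm; rewrite ij.
- by apply: word_equiv_comm; rewrite ij orbT.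
- by apply: word_equiv_braid; rewrite eqxx.
- by apply: word_equiv_braid; rewrite eqxx orbT.
Qed.

Section Shift.
Variable r : nat.
Local Notation "t ~~ u" := (braid_eq r t u) (at level 70).

Lemma braid_catl t u u' : u ~~ u' -> t ++ u ~~ t ++ u'.
Proof. by apply: braid_cat; apply: braid_refl. Qed.

Lemma braid_catr t t' u : t ~~ t' -> t ++ u ~~ t' ++ u.
Proof. by move=> h; apply: braid_cat => //; apply: braid_refl. Qed.

Definition far (k j : nat) : bool := (k.+1 < j)%N || (j.+1 < k)%N.

Lemma braid_far k s : simple_index r k -> all (simple_index r) s -> all (far k) s ->
  k :: s ~~ s ++ [:: k].
Proof.
move=> hk; elim: s => [|j s IH] /=; first by move=> *; apply: braid_refl.
move=> /andP[hj hs] /andP[fj fs].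
apply: (@braid_trans _ _ (j :: k :: s)).
  apply: (@braid_catr [:: k; j] [:: j; k]).
  by case/orP: fj => ?; [|apply: braid_sym]; apply: braid_comm.
by apply: (@braid_catl [:: j]); apply: IH.
Qed.

Lemma all_simple_iota a n : (0 < a)%N -> (a + n <= r)%N -> all (simple_index r) (iota a n).
Proof. by move=> *; apply/allP => j; rewrite mem_iota /simple_index; lia. Qed.

Lemma iota_split a k : (a <= k)%N -> (k.+1 < r)%N ->
  iota a (r - a) = iota a (k - a) ++ [:: k; k.+1] ++ iota k.+2 (r - k.+2).
Proof.
move=> ak kr; have -> : (r - a = (k - a) + (2 + (r - k.+2)))%N by lia.
by rewrite iotaD; congr cat; rewrite subnKC.
Qed.

(** A letter that crosses an increasing block drops by one: k+1 commutes past the letters below k,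
    the triple (k+1, k, k+1) becomes (k, k+1, k), and k commutes past the letters above k+1. *)
Lemma braid_through_block a k : (0 < a <= k)%N -> (k.+1 < r)%N ->
  k.+1 :: iota a (r - a) ~~ iota a (r - a) ++ [:: k].
Proof.
move=> /andP[a0 ak] kr; rewrite (iota_split ak kr).
set A := iota a _; set B := iota k.+2 _.
have hA : k.+1 :: A ~~ A ++ [:: k.+1].
  apply: braid_far; first by rewrite /simple_index; lia.
    by apply: all_simple_iota; lia.
  by apply/allP => j; rewrite mem_iota /far; lia.
have hB : k :: B ~~ B ++ [:: k].
  apply: braid_far; first by rewrite /simple_index; lia.
    by apply: all_simple_iota; lia.
  by apply/allP => j; rewrite mem_iota /far; lia.
apply: braid_trans (braid_catr _ hA) _; rewrite -!catA; apply: braid_catl.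
apply: (@braid_trans _ _ ([:: k; k.+1; k] ++ B)).
  apply: (@braid_catr [:: k.+1; k; k.+1]).
  by apply: braid_sym; apply: braid_braid; rewrite /simple_index; lia.
exact: (@braid_catl [:: k; k.+1]).
Qed.

Lemma braid_shift_block i m : (0 < i)%N -> (i + m < r)%N ->
  iota i.+1 m ++ iota i (r - i) ~~ iota i (r - i) ++ iota i m.
Proof.
move=> i0; elim: m => [|m IH] im; first by rewrite cats0; apply: braid_refl.
rewrite -[m.+1]addn1 !iotaD -catA /=.
apply: (@braid_trans _ _ (iota i.+1 m ++ iota i (r - i) ++ [:: (i + m)%N])).
  by apply: braid_catl; rewrite addSn; apply: braid_through_block; lia.
by rewrite !catA; apply: braid_catr; apply: IH; lia.
Qed.

(** Both sides equal the square of the block i, ..., r-1. On the left the letter i completes the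
    shorter block; on the right the shorter block is shifted across to i, ..., r-2, and r-1
    completes it. *)
Lemma braid_two_blocks i : (0 < i < r)%N ->
  i :: (iota i.+1 (r - i.+1) ++ iota i (r - i)) ~~
  iota i.+1 (r - i.+1) ++ iota i (r - i) ++ [:: r.-1].
Proof.
move=> /andP[i0 ir]; apply: braid_sym; rewrite catA.
apply: braid_trans (braid_catr _ (@braid_shift_block i (r - i.+1) i0 _)) _; first by lia.
have -> : i :: iota i.+1 (r - i.+1) ++ iota i (r - i) = iota i (r - i) ++ iota i (r - i).
  by rewrite {2}(_ : (r - i = (r - i.+1).+1)%N) //; lia.
rewrite -catA; apply: braid_catl; rewrite (_ : (r - i = (r - i.+1) + 1)%N); last by lia.
by rewrite iotaD /= (_ : (i + (r - i.+1) = r.-1)%N); [apply: braid_refl|lia].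
Qed.

(** Blocks are indexed here by their first letter, so that [blocks n] is the final segment of the
    long word on which inductions run. *)
Fixpoint blocks (n : nat) : seq nat :=
  if n is n'.+1 then iota n (r - n) ++ blocks n' else [::].

Lemma braid_descend n k : (n < k < r)%N -> k :: blocks n ~~ blocks n ++ [:: (k - n)%N].
Proof.
elim: n k => [|n IH] k /andP[nk kr] /=; first by rewrite subn0; apply: braid_refl.
case: k nk kr => // k nk kr; rewrite subSS.
apply: braid_trans (braid_catr _ (@braid_through_block n.+1 k _ _)) _ => //; try by lia.
by rewrite -!catA; apply: braid_catl; apply: IH; lia.
Qed.

(** The letter i commutes past the rows starting above i+1, leaves the rows i+1 and i as r-1, and
    drops by one in each of the remaining i-1 rows. The result r-i reflects w_0 s_i w_0 =
    s_(r-i). *)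
Lemma braid_blocks i n : (0 < i < n)%N -> (n <= r)%N ->
  i :: blocks n ~~ blocks n ++ [:: (r - i)%N].
Proof.
move=> /andP[i0]; elim: n => // n IH; rewrite ltnS leq_eqVlt => /orP[/eqP <-|lt] nr.
  case: i i0 {IH} nr => // i _ nr.
  rewrite [blocks i.+2]/= catA -cat_cons.
  apply: braid_trans (braid_catr _ (@braid_two_blocks i.+1 _)) _; first by lia.
  rewrite -!catA; do 2!apply: braid_catl.
  rewrite (_ : (r - i.+1 = r.-1 - i)%N); last by lia.
  by apply: (@braid_descend i r.-1); lia.
rewrite /= -catA -cat_cons; apply: braid_trans (braid_catr _ (braid_far _ _ _)) _.
- by rewrite /simple_index; lia.
- by apply: all_simple_iota; lia.
- by apply/allP => j; rewrite mem_iota /far; lia.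
by rewrite -!catA; apply: braid_catl; apply: IH; lia.
Qed.

Lemma Jword_blocks : Jword r = blocks r.-1.
Proof.
have suf n : (n <= r.-1)%N ->
    flatten [seq iota (r - m) m | m <- iota (r - n) n] = blocks n.
  elim: n => //= n IH nr; rewrite (_ : (r - (r - n.+1) = n.+1)%N) /=; last by lia.
  by rewrite (_ : (r - n.+1).+1 = (r - n)%N) ?IH //; lia.
rewrite /Jword -suf //; case: r => // r'.
by rewrite /= (_ : r'.+1 - r' = 1)%N //; lia.
Qed.

Lemma braid_Jword i : simple_index r i -> i :: Jword r ~~ Jword r ++ [:: (r - i)%N].
Proof.
(* Row r is empty, so [blocks r] is still the long word, and the bound i < r includes i = r-1. *)
move=> hi; have := @braid_blocks i r hi (leqnn r).
have -> // : blocks r = Jword r.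
have E n : (0 < n)%N -> blocks n = iota n (r - n) ++ blocks n.-1 by case: n.
by rewrite Jword_blocks E ?subnn //; case/andP: hi; lia.
Qed.

End Shift.

(** * Row coordinates and the string cone *)

Section Rows.
Local Open Scope ring_scope.
Variable r : nat.
Implicit Types (d : nat -> nat -> int) (g : nat -> int).

Definition row_term g a n : word_term := [seq (b, - g b) | b <- iota a n].

Fixpoint rows d n : word_term :=
  if n is n'.+1 then row_term (d n) n (r - n) ++ rows d n' else [::].

Lemma letters_rows d n : unzip1 (rows d n) = blocks r n.
Proof.
elim: n => //= n IH; rewrite /unzip1 map_cat -!/(unzip1 _) IH; congr cat.
by rewrite /unzip1 -map_comp map_id.
Qed.

Lemma row_term_ext g g' a n : (forall b, (a <= b < a + n)%N -> g b = g' b) ->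
  row_term g a n = row_term g' a n.
Proof. by move=> h; apply/eq_in_map => b; rewrite mem_iota => /h ->. Qed.

Lemma rows_ext d d' n :
  (forall a b, (0 < a <= n)%N -> (a <= b < r)%N -> d a b = d' a b) ->
  rows d n = rows d' n.
Proof.
elim: n => //= n IH h; congr cat; last by apply: IH => a b ? ?; apply: h; lia.
by apply: row_term_ext => b hb; apply: h; lia.
Qed.

Lemma rows_inj d d' n : rows d n = rows d' n ->
  forall a b, (0 < a <= n)%N -> (a <= b < r)%N -> d a b = d' a b.
Proof.
elim: n => [|n IH] /= h a b; first by lia.
move/eqP: h; rewrite eqseq_cat ?size_map // => /andP[/eqP h1 /eqP /IH h2] ha hb.
have [an|ne] := eqVneq a n.+1; last by apply: h2; lia.
move/eq_in_map: h1 => /(_ b); rewrite mem_iota -an => h.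
suff [] : (b, - d a b) = (b, - d' a b) by lia.
by apply: h; lia.
Qed.

(** The row extended by zero, so that one weight formula covers the two ends of the row as well. *)
Definition window g a n b : int := if (a <= b < a + n)%N then g b else 0.

Lemma term_wt_row k g a n : (0 < a)%N -> (0 < k)%N ->
  term_wt k (row_term g a n) =
  window g a n k.-1 + window g a n k.+1 - 2 * window g a n k.
Proof.
move=> a0 k0; elim: n a a0 => [|n IH] a a0 /=.
  by rewrite /window !addn0; do ![case: ifP => ?]; lia.
rewrite IH // /window /cartan addSnnS.
have [<-|ka] := eqVneq k a.
  by do ![case: ifP => ?]; try lia.
have [e|ka1] := eqVneq k a.+1.
  by rewrite e /= in IH *; do ![case: ifP => ?]; try lia.
have [e|ka2] := eqVneq a k.+1.
  by rewrite e /=; do ![case: ifP => ?]; lia.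
rewrite /=; do ![case: ifP => ?]; lia.
Qed.

Lemma term_eps_row k g a n : (0 < a)%N -> (0 < k)%N ->
  term_eps k (row_term g a n) =
  if (a <= k < a + n)%N then Some (g k - window g a n k.+1) else None.
Proof.
move=> a0 k0; elim: n a a0 => [|n IH] a a0 /=.
  by case: ifP => //; lia.
rewrite IH // term_wt_row // /window addSnnS.
have [<-|ka] := eqVneq k a; last first.
  rewrite (_ : (a <= k < _)%N = (a < k < a + n.+1)%N); last by lia.
  by case: ifP => ? //=; congr Some; do ![case: ifP => ?]; lia.
do ![case: ifP => ?] => //=; try lia; congr Some; lia.
Qed.

Definition upd1 g k t : nat -> int := fun b => if b == k then g b + t else g b.

Lemma term_f_row k g a n : term_f k (row_term g a n) = row_term (upd1 g k 1) a n.
Proof.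
elim: n a => //= n IH a; rewrite /upd1.
have absent : (k < a.+1)%N -> term_eps k (row_term g a.+1 n) = None.
  move=> ka; have := term_eps_some k (row_term g a.+1 n).
  rewrite /unzip1 -map_comp map_id mem_iota.
  by case: (term_eps k _) => //= x; lia.
have [ka|ne] := eqVneq k a; first (move: absent; rewrite -ka => absent).
  rewrite absent //= /row_term /= eqxx (_ : - (g k + 1) = - g k - 1); last by lia.
  congr cons; apply: row_term_ext => b hb; rewrite ifF //; lia.
by rewrite [RHS]/row_term /= -/(row_term g a.+1 n) IH [a == k]eq_sym (negPf ne).
Qed.

Lemma term_e_row k g a n : term_e k (row_term g a n) = row_term (upd1 g k (-1)) a n.
Proof.
apply: (@term_f_inj k); rewrite term_f_row term_eK; apply: row_term_ext => b _.
by rewrite /upd1; case: (b == k); lia.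
Qed.

Definition upd d a k t : nat -> nat -> int :=
  fun a' => if a' == a then upd1 (d a) k t else d a'.

Lemma upd_eq d a k t : upd d a k t a = upd1 (d a) k t.
Proof. by rewrite /upd eqxx. Qed.

Lemma upd_ne d a k t b : b != a -> upd d a k t b = d b.
Proof. by rewrite /upd => /negPf ->. Qed.

Lemma rows_upd_gt d a k t n : (n < a)%N -> rows (upd d a k t) n = rows d n.
Proof.
by move=> na; apply: rows_ext => a' b ? _; rewrite /upd ifF //; lia.
Qed.

(* [d a b] is the number of segments [a..b'] with [b' >= b]. *)
Definition cone d : Prop := forall a b, (0 < a <= b)%N -> (b < r)%N -> d a b.+1 <= d a b.

Definition closed_at d : Prop := forall a, d a r = 0.

(* The contribution of row a to epsilon_k. *)
Definition row_eps d k a : int := d a k - d a k.+1 - term_wt k (rows d a.-1).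

Lemma cone_rows d d' : closed_at d -> closed_at d' -> cone d ->
  rows d r.-1 = rows d' r.-1 -> cone d'.
Proof.
move=> d0 d0' cd /rows_inj h.
have e a b : (0 < a <= b)%N -> (b <= r)%N -> (a < r)%N -> d' a b = d a b.
  move=> ha; rewrite leq_eqVlt => /orP[/eqP ->|hb] ar; first by rewrite d0 d0'.
  by apply/esym/h; lia.
by move=> a b ha hb; rewrite !e ?cd //; lia.
Qed.

Section Fixed.
Variables (d : nat -> nat -> int) (k : nat).
Hypothesis (d0 : closed_at d) (hk0 : (0 < k < r)%N).

Lemma window_next a : (0 < a <= k)%N -> window (d a) a (r - a) k.+1 = d a k.+1.
Proof.
move=> ha; rewrite /window; case: ifP => // h.
by rewrite (_ : k.+1 = r) ?d0 //; lia.
Qed.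

Lemma term_eps_rowk a : (0 < a <= k)%N ->
  term_eps k (row_term (d a) a (r - a)) = Some (d a k - d a k.+1).
Proof. by move=> ha; rewrite term_eps_row ?window_next ?ifT //; lia. Qed.

Lemma term_eps_rowk_gt a : (k < a)%N -> term_eps k (row_term (d a) a (r - a)) = None.
Proof. by move=> ha; rewrite term_eps_row ?ifF //; lia. Qed.

Lemma term_wt_rowk a : (0 < a < k)%N ->
  term_wt k (row_term (d a) a (r - a)) = d a k.-1 + d a k.+1 - 2 * d a k.
Proof.
move=> ha; rewrite term_wt_row ?window_next; try lia.
by rewrite /window !ifT //; lia.
Qed.

(** The signature rule in terms of segments: passing from row a to row a+1 adds the number of
    segments [a+1..k] and subtracts the number of segments [a..k-1]. *)
Lemma row_epsS a : (0 < a < k)%N ->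
  row_eps d k a.+1 = row_eps d k a + (d a.+1 k - d a.+1 k.+1) - (d a k.-1 - d a k).
Proof.
case: a => // a ha; rewrite /row_eps [rows d a.+2.-1]/= term_wt_cat term_wt_rowk //=; lia.
Qed.

Lemma term_eps_rows_gt n : (k <= n)%N -> term_eps k (rows d n) = term_eps k (rows d k).
Proof.
move=> kn; elim: n kn => [|n IH]; first by case: k => // m; rewrite ltn0.
rewrite leq_eqVlt => /orP[/eqP <-|kn] //=.
by rewrite term_eps_cat term_eps_rowk_gt // IH //; case: (term_eps _ _).
Qed.

Lemma term_e_rows_gt n a t : (k <= n)%N -> (a <= k)%N -> term_e k (rows d k) = rows (upd d a k t)
  k ->
  term_e k (rows d n) = rows (upd d a k t) n.
Proof.
move=> kn ak h; elim: n kn => [|n IH]; first by case: k h => // m; rewrite ltn0.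
rewrite leq_eqVlt => /orP[/eqP <-|kn] //=.
rewrite term_e_cat term_eps_rowk_gt //= IH // upd_ne //; lia.
Qed.

Lemma term_f_rows_gt n a t : (k <= n)%N -> (a <= k)%N -> term_f k (rows d k) = rows (upd d a k t)
  k ->
  term_f k (rows d n) = rows (upd d a k t) n.
Proof.
move=> kn ak h; elim: n kn => [|n IH]; first by case: k h => // m; rewrite ltn0.
rewrite leq_eqVlt => /orP[/eqP <-|kn] //=.
rewrite term_f_cat term_eps_rowk_gt //= term_eps_rows_gt; last by lia.
have := term_eps_some k (rows d k); rewrite letters_rows.
have -> : k \in blocks r k.
  by case: k hk0 => // m ?; rewrite mem_cat mem_iota; lia.
case: (term_eps k (rows d k)) => //= _ _.
by rewrite IH // upd_ne //; lia.
Qed.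

Lemma term_e_rows_le n : (0 < n <= k)%N -> exists a,
  [/\ (0 < a <= n)%N, term_eps k (rows d n) = Some (row_eps d k a),
      term_e k (rows d n) = rows (upd d a k (-1)) n,
      (forall b, (0 < b < a)%N -> row_eps d k b < row_eps d k a) &
      (forall b, (a < b <= n)%N -> row_eps d k b <= row_eps d k a)].
Proof.
elim: n => // n IH hn; rewrite /= term_eps_cat term_e_cat term_eps_rowk //=.
case: n => [|n] in IH hn *.
  exists 1%N; split=> //=; try by [move=> b; lia|rewrite /row_eps /=; congr Some; lia].
  by rewrite term_e_row upd_eq.
have [|a [ha -> ew lt gt]] := IH; first by lia.
have E : d n.+2 k - d n.+2 k.+1 - term_wt k (rows d n.+1) = row_eps d k n.+2 by [].
rewrite /= in E ew *; rewrite E; case: ifP => c.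
  exists a; split=> //; try lia.
  - by congr Some; lia.
  - by rewrite ew (@upd_ne d a k _ n.+2) //; lia.
  - by move=> b hb; have [->|ne] := eqVneq b n.+2; [|apply: gt]; lia.
exists n.+2; split=> //; try lia.
- by congr Some; lia.
- by rewrite term_e_row upd_eq -[RHS]/(_ ++ rows (upd _ _ _ _) n.+1) rows_upd_gt.
- move=> b hb; suff : row_eps d k b <= row_eps d k a by lia.
  have [ba|ba|->] // := ltngtP b a; first by apply/ltW/lt; lia.
  by apply: gt; lia.
Qed.

Lemma term_f_rows_le n : (0 < n <= k)%N -> exists a,
  [/\ (0 < a <= n)%N, term_eps k (rows d n) = Some (row_eps d k a),
      term_f k (rows d n) = rows (upd d a k 1) n,
      (forall b, (0 < b < a)%N -> row_eps d k b <= row_eps d k a) &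
      (forall b, (a < b <= n)%N -> row_eps d k b < row_eps d k a)].
Proof.
elim: n => // n IH hn; rewrite /= term_eps_cat term_f_cat term_eps_rowk //=.
case: n => [|n] in IH hn *.
  exists 1%N; split=> //=; try by [move=> b; lia|rewrite /row_eps /=; congr Some; lia].
  by rewrite term_f_row upd_eq.
have [|a [ha -> ew lt gt]] := IH; first by lia.
have E : d n.+2 k - d n.+2 k.+1 - term_wt k (rows d n.+1) = row_eps d k n.+2 by [].
rewrite /= in E ew *; rewrite E; case: ifP => c; last first.
  exists a; split=> //; try lia.
  - by congr Some; lia.
  - by rewrite ew (@upd_ne d a k _ n.+2) //; lia.
  - by move=> b hb; have [->|ne] := eqVneq b n.+2; [|apply: gt]; lia.
exists n.+2; split=> //; try lia.
- by congr Some; lia.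
- by rewrite term_f_row upd_eq -[RHS]/(_ ++ rows (upd _ _ _ _) n.+1) rows_upd_gt.
- move=> b hb; suff : row_eps d k b <= row_eps d k a by lia.
  have [ba|ba|->] // := ltngtP b a; first by apply/lt; lia.
  by apply/ltW/gt; lia.
Qed.

Lemma term_e_rows : exists a,
  [/\ (0 < a <= k)%N, term_eps k (rows d r.-1) = Some (row_eps d k a),
      term_e k (rows d r.-1) = rows (upd d a k (-1)) r.-1,
      (forall b, (0 < b < a)%N -> row_eps d k b < row_eps d k a) &
      (forall b, (a < b <= k)%N -> row_eps d k b <= row_eps d k a)].
Proof.
have [|a [ha e w lt gt]] := @term_e_rows_le k; first by lia.
exists a; split=> //; first by rewrite term_eps_rows_gt //; lia.
by apply: term_e_rows_gt w; lia.
Qed.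

Lemma term_f_rows : exists a,
  [/\ (0 < a <= k)%N, term_eps k (rows d r.-1) = Some (row_eps d k a),
      term_f k (rows d r.-1) = rows (upd d a k 1) r.-1,
      (forall b, (0 < b < a)%N -> row_eps d k b <= row_eps d k a) &
      (forall b, (a < b <= k)%N -> row_eps d k b < row_eps d k a)].
Proof.
have [|a [ha e w lt gt]] := @term_f_rows_le k; first by lia.
exists a; split=> //; first by rewrite term_eps_rows_gt //; lia.
by apply: term_f_rows_gt w; lia.
Qed.

Lemma row_eps1 : row_eps d k 1 = d 1%N k - d 1%N k.+1.
Proof. by rewrite /row_eps subr0. Qed.

(** With the cone condition, epsilon_k is nonnegative because row 1 stands last: its contribution is
    a difference of adjacent coordinates, and epsilon_k is the maximum over the rows. *)
Hypothesis cd : cone d.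

Lemma term_eps_ge0 : exists2 e, term_eps k (rows d r.-1) = Some e & 0 <= e.
Proof.
have [a [ha -> _ lt gt]] := term_e_rows; exists (row_eps d k a) => //.
have h1 := row_eps1; have := cd (a := 1%N) (b := k).
have [a1|ne] := eqVneq a 1%N; first by rewrite a1 h1; lia.
by have := lt 1%N; lia.
Qed.

Lemma closed_upd a t : closed_at (upd d a k t).
Proof. by move=> b; rewrite /upd /upd1; case: eqP => // _; rewrite ifF //; lia. Qed.

(** The only inequality at risk is [d a k <= d a k.-1]. If it were an equality, row a+1 would
    contribute at least as much as row a, although a is the last maximum. *)
Lemma cone_term_f : exists2 d', closed_at d' /\ cone d' &
  term_f k (rows d r.-1) = rows d' r.-1.
Proof.
have [a [ha _ -> lt gt]] := term_f_rows; exists (upd d a k 1) => //; split; first exact: closed_upd.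
move=> b c hb hc; have := cd hb hc; rewrite /upd; case: eqP => // ba;
  rewrite /upd1 {}ba {b} in hb *.
have [ck|ck] := eqVneq c k; first by rewrite -ck ifF //; lia.
case: eqP => // ck1 _; have /row_epsS e : (0 < a < k)%N by lia.
have := gt a.+1; have := cd (a := a.+1) (b := k).
by move: e; rewrite -ck1 /=; lia.
Qed.

(** The only inequality at risk is [d a k.+1 <= d a k]. It is strict because row a contributes
    strictly more than row a-1 or, when a = 1, because its contribution is e > 0. *)
Lemma cone_term_e e : term_eps k (rows d r.-1) = Some e -> 0 < e -> exists a,
  [/\ (0 < a <= k)%N, term_e k (rows d r.-1) = rows (upd d a k (-1)) r.-1,
      cone (upd d a k (-1)) /\ d a k.+1 < d a k,
      (forall b, (0 < b < a)%N -> row_eps d k b < row_eps d k a) &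
      (forall b, (a < b <= k)%N -> row_eps d k b <= row_eps d k a)].
Proof.
have [a [ha -> w lt gt]] := term_e_rows => - [<-] e0; exists a.
have ya : d a k.+1 < d a k.
  have [a1|ne] := eqVneq a 1%N; first by move: e0; rewrite a1 row_eps1; lia.
  have /row_epsS : (0 < a.-1 < k)%N by lia.
  rewrite (_ : a.-1.+1 = a); last by lia.
  by have := lt a.-1; have := cd (a := a.-1) (b := k.-1); rewrite (_ : k.-1.+1 = k); lia.
split=> //; split=> // b c hb hc; have := cd hb hc; rewrite /upd; case: eqP => // ba;
  rewrite /upd1 {}ba {b} in hb *.
have [ck|ck] := eqVneq c k; first by rewrite ck ifF //; lia.
by case: eqP => // _; lia.
Qed.

(** Row 1 contributes a nonnegative amount, so if the maximum is 0 it is the first row to attain it;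
    then [d 1 k = d 1 k.+1], and lowering [d 1 k] breaks the cone. *)
Lemma cone_we0 : term_eps k (rows d r.-1) = Some 0 ->
  exists2 d', closed_at d' /\ ~ cone d' & term_e k (rows d r.-1) = rows d' r.-1.
Proof.
have [a [ha -> w lt gt]] := term_e_rows => - [e0]; exists (upd d a k (-1)) => //.
split; [exact: closed_upd|move=> c'].
have h1 := row_eps1; have y1 := cd (a := 1%N) (b := k).
have a1 : a = 1%N.
  have [//|ne] := eqVneq a 1%N.
  by have := lt 1%N; lia.
have := c' 1%N k; rewrite a1 upd_eq /upd1 eqxx ifF; last by lia.
by rewrite a1 h1 in e0; lia.
Qed.

End Fixed.

Lemma cone_ge0 d a b : closed_at d -> cone d -> (0 < a <= b)%N -> (b <= r)%N -> 0 <= d a b.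
Proof.
move=> d0 cd ha hb; move: (subnKC hb); move: (r - b)%N => n.
elim: n => [|n IH] in b ha hb *; first by rewrite addn0 => ->; rewrite d0.
move=> e; have := cd a b ha; have := IH b.+1; lia.
Qed.

(** Induction on a: once the rows below a vanish, row a contributes exactly [d a k - d a k.+1] to
    epsilon_k, so it is constant, with last value [d a r = 0]. *)
Lemma cone_eps0 d : closed_at d -> cone d ->
  (forall k, (0 < k < r)%N -> term_eps k (rows d r.-1) = Some 0) ->
  forall a b, (0 < a)%N -> (a <= b <= r)%N -> d a b = 0.
Proof.
move=> d0 cd e0 a; have [n] := ubnP a; elim: n a => // n IH a an b a0 hb.
have zr : rows d a.-1 = zero_term (blocks r a.-1).
  rewrite -(letters_rows d) /zero_term /unzip1 -map_comp; apply/esym.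
  have : forall m, (m < a)%N -> all (fun p => p.2 == 0) (rows d m).
    elim=> //= m IHm hm; rewrite all_cat IHm ?andbT; last by lia.
    by apply/allP => p /mapP[c]; rewrite mem_iota => hc -> /=; rewrite IH //; lia.
  move=> /(_ a.-1); case: a a0 {an IH hb} => //= a _ /(_ (ltnSn a)) /allP h.
  rewrite -[RHS]map_id; apply/eq_in_map => -[j x] /h /= /eqP ->.
  by [].
have step k : (a <= k < r)%N -> d a k = d a k.+1.
  move=> hak; have hk' : (0 < k < r)%N by lia.
  have := e0 k hk'; have [a' [ha' -> _ lt gt]] := term_e_rows d0 hk' => - [e'].
  have : row_eps d k a <= 0.
    have [h|h|->] := ltngtP a a'; [|by apply: (le_trans (gt a _)); lia|by rewrite e'].
    by have := lt a; lia.
  by rewrite /row_eps zr term_wt_zero_term; have := cd a k; lia.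
move/andP: hb => [ab br]; move: (subnKC br); move: (r - b)%N => m.
elim: m => [|m IHm] in b ab br *; first by rewrite addn0 => ->; rewrite d0.
by move=> e; rewrite step ?IHm //; lia.
Qed.

End Rows.

(** * B_infinity inside the tensor product *)

Section TensorWords.
Local Open Scope ring_scope.
Local Open Scope ereal_scope.

Fixpoint tensor_term (J : seq nat) : tensor_seq J -> word_term :=
  match J return tensor_seq J -> word_term with
  | [::] => fun _ => [::]
  | j :: J' => fun x => (j, x.1) :: tensor_term x.2
  end.

Definition ereal_of_opt (x : option int) : \bar int := if x is Some a then a%:E else -oo.

Lemma ereal_of_opt_le x y : (ereal_of_opt x <= ereal_of_opt y) = opt_le x y.
Proof. by case: x y => [a|] [b|] //=; rewrite ?lee_fin ?leNye. Qed.

Lemma tensor_term_zip J (z : tensor_seq J) : tensor_term z = zip J (coords z).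
Proof. by elim: J z => //= j J IH z; rewrite IH. Qed.

Lemma size_coords J (z : tensor_seq J) : size (coords z) = size J.
Proof. by elim: J z => //= j J IH z; rewrite IH. Qed.

Lemma letters_tensor_term J (z : tensor_seq J) : unzip1 (tensor_term z) = J.
Proof. by elim: J z => //= j J IH z; rewrite IH. Qed.

Lemma tensor_term_inj J : injective (@tensor_term J).
Proof.
elim: J => [|j J IH]; first by case=> -[].
by move=> [a x] [b y] /= [-> /IH ->].
Qed.

Lemma tensor_term_zero J : tensor_term (tensor_zero J) = zero_term J.
Proof. by elim: J => //= j J ->. Qed.

Lemma cphi_tensor_term J (z : tensor_seq J) k :
  cphi k z = ereal_of_opt (opt_add (term_eps k (tensor_term z)) (term_wt k (tensor_term z))).
Proof.
elim: J z => //= j J IH [a z] /=; rewrite IH.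
have [<-|_] := eqVneq k j; last first.
  by rewrite maxNye; case: (term_eps k _) => //= x; rewrite -EFinD; congr EFin; lia.
case: (term_eps k _) => /= [x|].
  by rewrite -EFinD -EFin_max cartan_diag; congr EFin; lia.
by rewrite maxeNy cartan_diag; congr EFin; lia.
Qed.

Lemma tensor_left k j (a : elementary j) (x : word_term) :
  (ereal_of_opt (opt_add (term_eps k x) (term_wt k x)) <= ceps k a) =
  opt_le (term_eps k x) (if k == j then Some (- a - term_wt k x)%R else None).
Proof.
rewrite /=; case: eqP => _.
  by rewrite -[X in _ <= X]/(ereal_of_opt (Some _)) ereal_of_opt_le;
    case: (term_eps k x) => //= y; lia.
by rewrite -[X in _ <= X]/(ereal_of_opt None) ereal_of_opt_le; case: (term_eps k x).
Qed.

Lemma cf_tensor_term J (z : tensor_seq J) k :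
  omap (@tensor_term J) (cf k z) = if k \in J then Some (term_f k (tensor_term z)) else None.
Proof.
elim: J z => //= j J IH [a z] /=; rewrite cphi_tensor_term.
rewrite (@tensor_left k j a) inE.
have [<-|ne] /= := eqVneq k j; last first.
  have := term_eps_some k (tensor_term z); rewrite letters_tensor_term => <-.
  move: (IH z); have := term_eps_some k (tensor_term z); rewrite letters_tensor_term => <-.
  case: (term_eps k _) => //= x; case: (cf k z) => //= y [<-] //.
case: ifP => c //=.
move: (IH z); have := term_eps_some k (tensor_term z); rewrite letters_tensor_term => <-.
by case: (term_eps k _) c => //= x _; case: (cf k z) => //= y [<-].
Qed.

Lemma ce_tensor_term J (z : tensor_seq J) k :
  omap (@tensor_term J) (ce k z) = if k \in J then Some (term_e k (tensor_term z)) else None.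
Proof.
elim: J z => //= j J IH [a z] /=; rewrite ltNge cphi_tensor_term.
have -> : (ceps k (a : elementary j) <= ereal_of_opt (opt_add (term_eps k (tensor_term z))
  (term_wt k (tensor_term z)))) =
    opt_le (if k == j then Some (- a - term_wt k (tensor_term z))%R else None) (term_eps k
      (tensor_term z)).
  rewrite /=; case: eqP => _; last by rewrite leNye.
  rewrite -[X in X <= _]/(ereal_of_opt (Some _)) ereal_of_opt_le.
  by case: (term_eps k _) => //= y; lia.
rewrite inE; have [<-|ne] /= := eqVneq k j; last first.
  by move: (IH z); case: (k \in J); case: (ce k z) => //= y [<-].
case: ifP => c //=.
move: (IH z); have := term_eps_some k (tensor_term z); rewrite letters_tensor_term => <-.
by case: (term_eps k _) c => //= x _; case: (ce k z) => //= y [<-].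
Qed.

End TensorWords.

(** * B_infinity as the cone of decreasing rows *)

Section BinfTerms.
Local Open Scope ring_scope.
Variable r : nat.
Implicit Type v : Binf r.

Definition binf_term v : word_term := tensor_term (val v).

Lemma binf_term_inj : injective binf_term.
Proof. by move=> v v' /tensor_term_inj /val_inj. Qed.

Lemma letters_binf_term v : unzip1 (binf_term v) = Jword r.
Proof. exact: letters_tensor_term. Qed.

Lemma binf_term_zero : binf_term (u_zero r) = zero_term (Jword r).
Proof. exact: tensor_term_zero. Qed.

(* Row a, starting with the letter a, is block r - a of the long word. *)
Definition dcoords v (a b : nat) : int := dcoord v (r - a) b.

Lemma dcoords_closed v : closed_at r (dcoords v).
Proof. by move=> a; rewrite /dcoords /dcoord eqxx. Qed.

Definition tri (m : nat) : nat := ((m * m.-1)./2)%N.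

Lemma triS m : tri m.+1 = (tri m + m)%N.
Proof. by rewrite /tri; case: m => // m /=; lia. Qed.

Lemma rows_coords (l : seq int) n : (n < r)%N -> size l = (tri (r - n) + size (blocks r n))%N ->
  zip (blocks r n) (drop (tri (r - n)) l) =
  rows r (fun a b => - nth 0 l (tri (r - a) + (b - a))) n.
Proof.
elim: n l => [|n IH] l nr; first by case: (drop _ _).
have e : tri (r - n) = (tri (r - n.+1) + (r - n.+1))%N.
  by rewrite -triS; congr tri; lia.
rewrite [blocks r n.+1]/= size_cat size_iota => sl.
rewrite -(cat_take_drop (r - n.+1) (drop _ l)) zip_cat; last first.
  by rewrite size_iota size_takel // size_drop sl addKn leq_addr.
rewrite drop_drop [(_ - _ + _)%N]addnC -e /= IH; [|lia|by rewrite sl e; lia].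
congr cat; rewrite /row_term.
have -> : take (r - n.+1) (drop (tri (r - n.+1)) l) =
    [seq nth 0 l (tri (r - n.+1) + (b - n.+1)) | b <- iota n.+1 (r - n.+1)].
  apply: (@eq_from_nth _ 0) => [|i].
by rewrite size_map size_iota size_takel // size_drop sl addKn leq_addr.
  rewrite size_takel; last by rewrite size_drop sl addKn leq_addr.
  move=> hi; rewrite nth_take // nth_drop (nth_map 0%N) ?size_iota // nth_iota //.
  by congr (nth _ _ (_ + _)); lia.
rewrite -{1}[iota _ _]map_id zip_map; apply/eq_map => b /=.
by rewrite opprK.
Qed.

(** On the cone this is minus the height: all exponents are nonpositive and each [f_k] with k simple
    lowers the sum by 1. Its absolute value is the induction measure. *)
Fixpoint term_sum (z : word_term) : int := if z is (j, a) :: z' then a + term_sum z' else 0.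

Lemma term_sum_term_f k z : term_sum (term_f k z) = term_sum z - (k \in unzip1 z)%:Z.
Proof.
elim: z => //= -[j a] z IH /=; rewrite inE; have [_|ne] /= := eqVneq k j; last by rewrite IH; lia.
case: ifP => /= h; first by lia.
rewrite IH; have := term_eps_some k z.
by case: (term_eps k z) h => //= x _ <-; lia.
Qed.

Lemma term_sum_term_e k z : term_sum (term_e k z) = term_sum z + (k \in unzip1 z)%:Z.
Proof. by rewrite -{2}(term_eK k z) term_sum_term_f letters_term_e; lia. Qed.

Lemma term_sum_rows_le0 d n : closed_at r d -> cone r d -> (n < r)%N -> term_sum (rows r d n) <= 0.
Proof.
move=> d0 cd; elim: n => //= n IH nr.
have cat z z' : term_sum (z ++ z') = term_sum z + term_sum z'.
  by elim: z => [|[? ?] z IHz] /=; lia.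
rewrite cat; suff : term_sum (row_term (d n.+1) n.+1 (r - n.+1)) <= 0 by have := IH; lia.
have : forall b, b \in iota n.+1 (r - n.+1) -> 0 <= d n.+1 b.
  by move=> b; rewrite mem_iota => hb; apply: (cone_ge0 d0 cd); lia.
rewrite /row_term; elim: (iota _ _) => //= b s IHs h.
have := h b; rewrite inE eqxx => /(_ isT).
have := IHs; set x := term_sum _ => IHs' h1; suff : x <= 0 by lia.
by apply: IHs' => c hc; apply: h; rewrite inE hc orbT.
Qed.

Hypothesis r0 : (0 < r)%N.

Lemma binf_term_rows v : binf_term v = rows r (dcoords v) r.-1.
Proof.
have E l : size l = size (Jword r) -> zip (Jword r) l =
    rows r (fun a b => - nth 0 l (tri (r - a) + (b - a))) r.-1.
  move=> sl; have t1 : tri (r - r.-1) = 0%N by rewrite (_ : (r - r.-1 = 1)%N) //; lia.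
  by rewrite Jword_blocks -[l in LHS]drop0 -t1 rows_coords ?t1 ?add0n ?sl -?Jword_blocks //; lia.
rewrite /binf_term tensor_term_zip E ?size_coords //.
apply: rows_ext => a b ha hb; rewrite /dcoords /dcoord ifF; last by lia.
by congr (- nth _ _ (_ + _)); lia.
Qed.

Lemma simple_Jword k : simple_index r k = (k \in Jword r).
Proof.
rewrite Jword_blocks /simple_index; case: r r0 => // r' _ /=.
have mem n : (n <= r')%N -> (k \in blocks r'.+1 n) = (0 < k)%N && (0 < n)%N && (k < r'.+1)%N.
  elim: n => [|n IH] nr; first by rewrite andbF.
  by rewrite /= mem_cat mem_iota; have [n0|n0] := posnP n; [rewrite n0 /= orbF|rewrite IH]; lia.
by rewrite mem //; apply/idP/idP; lia.
Qed.

Lemma zero_term_rows d : closed_at r d ->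
  (forall a b, (0 < a)%N -> (a <= b <= r)%N -> d a b = 0) ->
  rows r d r.-1 = zero_term (Jword r).
Proof.
move=> d0 h; rewrite Jword_blocks; elim: r.-1 => //= n ->.
rewrite /zero_term map_cat; congr cat; apply/eq_in_map => b; rewrite mem_iota => hb.
by rewrite h ?oppr0 //; lia.
Qed.

(** A nonzero point of the cone has some positive epsilon_k by [cone_eps0], and that [e_k] stays in
    the cone and lowers the height. With [generated_cone] this identifies B_infinity with the
    cone. *)
Lemma cone_generated d (z : tensor_seq (Jword r)) : closed_at r d -> cone r d ->
  tensor_term z = rows r d r.-1 -> Defs.generated (tensor_zero (Jword r)) z.
Proof.
move=> d0 cd hz; have [n] := ubnP `|term_sum (tensor_term z)|%N.
elim: n => // n IH in d d0 cd z hz * => hn.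
have [/existsP[k /andP[k0 ek]]|none] :=
    boolP [exists k : 'I_r, (0 < k)%N && (term_eps k (tensor_term z) != Some 0)]; last first.
  apply/asboolP; exists [::] => /=; congr Some; apply: tensor_term_inj.
  rewrite tensor_term_zero hz zero_term_rows //; apply: (cone_eps0 d0 cd) => k /andP[k0 kr].
  move: none; rewrite negb_exists => /forallP /(_ (Ordinal kr)) /=.
  by rewrite k0 -hz negbK => /eqP.
have hk : (0 < k < r)%N by rewrite k0 ltn_ord.
have [e he e0] := term_eps_ge0 d0 hk cd; rewrite -hz in he.
have {}e0 : 0 < e by move: ek; rewrite he; case: e e0 {he} => // -[].
have hk' : (nat_of_ord k) \in Jword r by rewrite -simple_Jword.
have := ce_tensor_term z k; rewrite hk'; case: (ce k z) => //= y [hy].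
have [a [_ w [c' _] _ _]] := cone_term_e d0 hk cd (etrans (congr1 (term_eps k) (esym hz)) he) e0.
have /asboolP[t ht] : Defs.generated (tensor_zero (Jword r)) y.
  apply: (IH _ (closed_upd d0 hk a (-1)) c'); first by rewrite hy hz.
  have := term_sum_rows_le0 (closed_upd d0 hk a (-1)) c' (n := r.-1).
  rewrite -w -hz; move: hn; rewrite hy term_sum_term_e letters_tensor_term hk'; lia.
apply/asboolP; exists (nat_of_ord k :: t); rewrite /= -/(f_word t _) ht /=.
have := cf_tensor_term y k; rewrite hk' hy term_eK; case: (cf _ y) => //= y' [].
by move/tensor_term_inj => ->.
Qed.

Lemma generated_cone (z : tensor_seq (Jword r)) : Defs.generated (tensor_zero (Jword r)) z ->
  exists2 d, closed_at r d /\ cone r d & tensor_term z = rows r d r.-1.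
Proof.
move=> /asboolP[t]; elim: t z => [|k t IH] z /=.
  move=> [<-]; exists (fun _ _ => 0) => //.
  by rewrite tensor_term_zero zero_term_rows.
rewrite -/(f_word t _); case: (f_word t _) IH => //= y /(_ y erefl)[d [d0 cd] hd] hz.
have := cf_tensor_term y k; rewrite hz /= -simple_Jword; case: ifP => // hk [->].
by rewrite hd; apply: cone_term_f.
Qed.

Lemma cone_dcoords v : cone r (dcoords v).
Proof.
have [d [d0 cd] hd] := generated_cone (valP v); rewrite -/(binf_term v) binf_term_rows in hd.
exact: cone_rows d0 (@dcoords_closed v) cd (esym hd).
Qed.

Definition binf_eps v k : int := if term_eps k (binf_term v) is Some e then e else 0.
(** Total versions of the operators; the default v stands for zero. *)
Definition binf_f k v : Binf r := odflt v (cf k v).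
Definition binf_e k v : Binf r := odflt v (ce k v).
Definition binf_wt v k : int := term_wt k (binf_term v).

Lemma term_eps_binf_term v k : simple_index r k -> term_eps k (binf_term v) = Some (binf_eps v k).
Proof.
move=> hk; rewrite /binf_eps; have := term_eps_some k (binf_term v).
by rewrite letters_binf_term -simple_Jword hk; case: (term_eps k _).
Qed.

Lemma binf_eps_ge0 v k : 0 <= binf_eps v k.
Proof.
have [hk|nk] := boolP (simple_index r k); last first.
  rewrite /binf_eps; have := term_eps_some k (binf_term v).
  by rewrite letters_binf_term -simple_Jword (negPf nk); case: (term_eps k _).
by rewrite /binf_eps binf_term_rows; have [e -> //] := term_eps_ge0 (@dcoords_closed v) hk
  (@cone_dcoords v).
Qed.

Lemma cf_binf_term v k : simple_index r k ->
  cf k v = Some (binf_f k v) /\ binf_term (binf_f k v) = term_f k (binf_term v).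
Proof.
move=> hk; rewrite /binf_f /=; have := cf_tensor_term (val v) k; rewrite -simple_Jword hk.
case e: (cf k (val v)) => [y|] //= [hy].
have gy : Defs.generated (tensor_zero (Jword r)) y.
  have [d' [d0 cd] hd'] := cone_term_f (@dcoords_closed v) hk (@cone_dcoords v).
  by apply: (cone_generated d0 cd); rewrite hy -hd' -binf_term_rows.
by rewrite insubT /= -hy.
Qed.

Lemma cf_nonsimple v k : ~~ simple_index r k -> cf k v = None.
Proof.
move=> hk /=; have := cf_tensor_term (val v) k; rewrite -simple_Jword (negPf hk).
by case: (cf k (val v)).
Qed.

Lemma ce_binf_term v k : simple_index r k -> 0 < binf_eps v k ->
  ce k v = Some (binf_e k v) /\ binf_term (binf_e k v) = term_e k (binf_term v).
Proof.
move=> hk e0; rewrite /binf_e /=; have := ce_tensor_term (val v) k; rewrite -simple_Jword hk.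
case e: (ce k (val v)) => [y|] //= [hy].
have gy : Defs.generated (tensor_zero (Jword r)) y.
  have := term_eps_binf_term v hk; rewrite binf_term_rows => he.
  have [a [_ w [c' _] _ _]] := cone_term_e (@dcoords_closed v) hk (@cone_dcoords v) he e0.
  by apply: (cone_generated (closed_upd (@dcoords_closed v) hk a (-1)) c');
    rewrite hy -w -binf_term_rows.
by rewrite insubT /= -hy.
Qed.

Lemma ce_eps0 v k : simple_index r k -> binf_eps v k = 0 -> ce k v = None.
Proof.
move=> hk e0 /=; have := ce_tensor_term (val v) k; rewrite -simple_Jword hk.
case e: (ce k (val v)) => [y|] //= [hy]; rewrite insubF //; apply/negP => gy.
have [d [d0 cd] hd] := generated_cone gy.
have := term_eps_binf_term v hk; rewrite e0 binf_term_rows => he.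
have [d' [d0' nc] w] := cone_we0 (@dcoords_closed v) hk (@cone_dcoords v) he.
by apply: nc; apply: cone_rows d0 d0' cd _; rewrite -hd hy -/(binf_term v) binf_term_rows w.
Qed.

End BinfTerms.

(** * The crystal structure of B_infinity and the embeddings Psi_i *)

Section BinfCrystal.
Local Open Scope ring_scope.
Variable r : nat.
Hypothesis r0 : (0 < r)%N.
Implicit Type v : Binf r.
Local Notation u0 := (u_zero r).

Lemma binf_eps_binf_f v k : simple_index r k -> binf_eps (binf_f k v) k = binf_eps v k + 1.
Proof.
move=> hk; have [_ h] := cf_binf_term r0 v hk; have := term_eps_binf_term r0 (binf_f k v) hk.
by rewrite h term_eps_term_f term_eps_binf_term //= => -[<-].
Qed.

Lemma binf_wt_binf_f v j k : simple_index r j -> binf_wt (binf_f j v) k = binf_wt v k - cartan k j.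
Proof.
by move=> hj; have [_ h] := cf_binf_term r0 v hj; rewrite /binf_wt h term_wt_term_f
  term_eps_binf_term.
Qed.

Lemma binf_e_binf_f v k : simple_index r k -> ce k (binf_f k v) = Some v.
Proof.
move=> hk; have e0 : 0 < binf_eps (binf_f k v) k by rewrite binf_eps_binf_f //;
  have := binf_eps_ge0 r0 v k; lia.
have [-> h] := ce_binf_term r0 hk e0; congr Some; apply: binf_term_inj.
by rewrite h (cf_binf_term r0 v hk).2 term_fK.
Qed.

Lemma binf_f_inj k v v' : simple_index r k -> binf_f k v = binf_f k v' -> v = v'.
Proof. by move=> hk e; have := binf_e_binf_f v hk; rewrite e binf_e_binf_f // => -[]. Qed.

Lemma binf_f_binf_e v k : simple_index r k -> 0 < binf_eps v k -> binf_f k (binf_e k v) = v.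
Proof.
move=> hk e0; apply: binf_term_inj.
by rewrite (cf_binf_term r0 _ hk).2 (ce_binf_term r0 hk e0).2 term_eK.
Qed.

Lemma binf_eps_u0 k : binf_eps u0 k = 0.
Proof. by rewrite /binf_eps binf_term_zero term_eps_zero_term; case: ifP. Qed.

Lemma binf_wt_u0 k : binf_wt u0 k = 0.
Proof. by rewrite /binf_wt binf_term_zero term_wt_zero_term. Qed.

Lemma binf_eps_eq0 v : (forall k, simple_index r k -> binf_eps v k = 0) -> v = u0.
Proof.
move=> h; apply: binf_term_inj; rewrite binf_term_zero binf_term_rows // zero_term_rows //.
  exact: dcoords_closed.
apply: cone_eps0; [exact: dcoords_closed|exact: cone_dcoords|].
by move=> k hk; rewrite -binf_term_rows // term_eps_binf_term // h.
Qed.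

Definition binf_height v : nat := `|term_sum (binf_term v)|%N.

Lemma binf_height_binf_f v k : simple_index r k -> binf_height (binf_f k v) = (binf_height v).+1.
Proof.
move=> hk; rewrite /binf_height (cf_binf_term r0 v hk).2 term_sum_term_f letters_binf_term
  -simple_Jword // hk.
have : term_sum (binf_term v) <= 0.
  rewrite binf_term_rows //; apply: term_sum_rows_le0; [exact: dcoords_closed|exact:
    cone_dcoords|lia].
by lia.
Qed.

Lemma Binf_case v : v = u0 \/ exists k, [/\ simple_index r k,
  0 < binf_eps v k & v = binf_f k (binf_e k v)].
Proof.
have [/existsP[k /andP[hk ek]]|] := boolP [exists k : 'I_r,
  simple_index r k && (binf_eps v k != 0)].
  right; exists (nat_of_ord k).
  have e0 : 0 < binf_eps v k by rewrite lt_neqAle eq_sym ek binf_eps_ge0.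
  by split=> //; rewrite binf_f_binf_e.
rewrite negb_exists => /forallP h; left; apply: binf_eps_eq0 => k hk.
have kr : (k < r)%N by case/andP: hk.
by have := h (Ordinal kr); rewrite /= hk negbK => /eqP.
Qed.

Lemma Binf_ind (P : Binf r -> Prop) : P u0 ->
  (forall k v, simple_index r k -> P v -> P (binf_f k v)) -> forall v, P v.
Proof.
move=> P0 PF v; have [n] := ubnP (binf_height v); elim: n v => // n IH v hn.
have [-> //|[k [hk _ e]]] := Binf_case v.
by rewrite e; apply: PF => //; apply: IH; move: hn; rewrite {1}e binf_height_binf_f.
Qed.

Lemma f_word_cons (B : crystal) k t (x : B) : f_word (k :: t) x = obind (cf k) (f_word t x).
Proof. by []. Qed.

Lemma f_word_ex v : exists t, f_word t u0 = Some v.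
Proof.
elim/Binf_ind: v => [|k v hk [t ht]]; first by exists [::].
by exists (k :: t); rewrite f_word_cons ht; exact: (cf_binf_term r0 v hk).1.
Qed.

Definition pair_term i (z : int * Binf r) : word_term := (i, z.1) :: binf_term z.2.

Lemma pair_term_inj i : injective (pair_term i).
Proof. by move=> [a x] [b y] [/= -> /binf_term_inj ->]. Qed.

Definition pair_f i k (z : int * Binf r) : int * Binf r :=
  if (k == i) && (binf_eps z.2 k + binf_wt z.2 k <= - z.1) then (z.1 - 1, z.2)
  else (z.1, binf_f k z.2).

Lemma pair_f_pair_term i k z : simple_index r k -> pair_term i (pair_f i k z) = term_f k
  (pair_term i z).
Proof.
move=> hk; rewrite /pair_f /pair_term /= term_eps_binf_term //=.
have -> : (binf_eps z.2 k + binf_wt z.2 k <= - z.1) = (binf_eps z.2 k <= - z.1 - term_wt k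
  (binf_term z.2)).
  by rewrite /binf_wt; apply/idP/idP; lia.
by case: ifP => //= _; rewrite (cf_binf_term r0 _ hk).2.
Qed.

Lemma cf_tensor i k z : simple_index r k ->
  @cf (tensor (elementary i) (Binf r)) k z = Some (pair_f i k z).
Proof.
move=> hk; case: z => a x; have := (cf_binf_term r0 x hk).1; rewrite /pair_f /=.
have -> : (cphi k (val x) <= (if k == i then (- a)%:E else -oo))%E =
    (k == i) && (binf_eps x k + binf_wt x k <= - a).
  rewrite cphi_tensor_term -/(binf_term x) term_eps_binf_term //=.
  by case: ifP => _ /=; rewrite ?lee_fin // leeNy_eq.
by move=> h; case: (k == i) => /=; [case: ifP => //= _|]; rewrite h.
Qed.

(** * The embedding Psi_i for a fixed i *)

Section OnePsi.
Variable i : nat.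
Hypothesis hi : simple_index r i.

Lemma exists_shift : exists t, word_iso (Jword r ++ [:: (r - i)%N]) (i :: Jword r) t.
Proof. by apply: braid_word_equiv; apply: braid_sym; apply: braid_Jword. Qed.

Definition shift_term v : word_term := binf_term v ++ [:: ((r - i)%N, 0)].

Lemma letters_shift v : unzip1 (shift_term v) = Jword r ++ [:: (r - i)%N].
Proof. by rewrite /unzip1 map_cat -!/(unzip1 _) letters_binf_term. Qed.

(* epsilon_k is nonnegative on B_infinity, so that f_k never acts on the last factor. *)
Lemma shift_binf_f k v : simple_index r k -> shift_term (binf_f k v) = term_f k (shift_term v).
Proof.
move=> hk; rewrite /shift_term term_f_cat (cf_binf_term r0 v hk).2 term_eps_binf_term //=.
by case: ifP => //=; case: ifP => //=; have := binf_eps_ge0 r0 v k; lia.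
Qed.

(** Both sides follow the same word of f's from the highest weight element, and t commutes with
    them. The left side does not mention that word, so [Psi] is single valued. *)
Lemma Psi_shift t v z : word_iso (Jword r ++ [:: (r - i)%N]) (i :: Jword r) t ->
  Psi i v z -> t (shift_term v) = pair_term i z.
Proof.
move=> T [w]; elim: w v z => [|k w IH] v z.
  move=> [<-] [<-]; rewrite /pair_term /shift_term binf_term_zero.
  by rewrite -[RHS](iso_zero T) /zero_term map_cat.
rewrite !f_word_cons; case: (f_word w u0) IH => // v' IH.
case: (f_word w _) IH => // z' IH; rewrite -[obind _ (Some v')]/(cf k v') -[obind _ (Some
  z')]/(cf k z').
have [hk|hk] := boolP (simple_index r k); last by rewrite cf_nonsimple.
rewrite (cf_binf_term r0 v' hk).1 cf_tensor // => -[<-] [<-].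
by rewrite shift_binf_f // (iso_f T) ?letters_shift // (IH _ z') // pair_f_pair_term.
Qed.

Lemma Psi_ex v : exists z, Psi i v z.
Proof.
have [w hw] := f_word_ex v.
suff [z hz] : exists z, @f_word (tensor (elementary i) (Binf r)) w (0 : int, u0) = Some z.
  by exists z; exists w.
elim: w v hw => [|k w IH] v; first by exists (0, u0).
rewrite !f_word_cons; case e: (f_word w u0) => [v'|] // h.
have [z' ->] := IH _ e; exists (pair_f i k z'); apply: cf_tensor.
by apply: contraT => hk; rewrite -[LHS]/(cf k v') cf_nonsimple in h.
Qed.

Definition Psi_fun v : int * Binf r := xget (0, v) [set z | Psi i v z]%classic.

Lemma Psi_Psi_fun v : Psi i v (Psi_fun v).
Proof. by rewrite /Psi_fun; case: xgetP => // h; have [z /h] := Psi_ex v. Qed.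

Lemma Psi_eq v z : Psi i v z -> z = Psi_fun v.
Proof.
have [t T] := exists_shift => h; apply: (@pair_term_inj i).
by rewrite -(Psi_shift T h) -(Psi_shift T (Psi_Psi_fun v)).
Qed.

Lemma Psi_fun_inj : injective Psi_fun.
Proof.
move=> v v' e; have [t T] := exists_shift.
have := Psi_shift T (Psi_Psi_fun v); rewrite e -(Psi_shift T (Psi_Psi_fun v')).
move/(iso_inj T (letters_shift _) (letters_shift _))/eqP.
by rewrite eqseq_cat ?eqxx ?andbT => [/eqP/binf_term_inj|];
  rewrite // -!(size_map fst) -!/(unzip1 _) !letters_binf_term.
Qed.

Lemma Psi_fun_u0 : Psi_fun u0 = (0, u0).
Proof. by apply/esym/Psi_eq; exists [::]. Qed.

Lemma Psi_fun_binf_f k v : simple_index r k -> Psi_fun (binf_f k v) = pair_f i k (Psi_fun v).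
Proof.
move=> hk; apply/esym/Psi_eq; have [w h1 h2] := Psi_Psi_fun v; exists (k :: w).
  by rewrite f_word_cons h1; exact: (cf_binf_term r0 v hk).1.
by rewrite f_word_cons h2; exact: cf_tensor.
Qed.

Lemma wt_Psi_fun v k : binf_wt v k = (Psi_fun v).1 * cartan k i + binf_wt (Psi_fun v).2 k.
Proof.
have [t T] := exists_shift.
have := iso_wt T k (letters_shift v).
by rewrite (Psi_shift T (Psi_Psi_fun v)) /shift_term term_wt_cat /= mul0r !addr0 /binf_wt => <-.
Qed.

Lemma term_eps_Psi_fun v k : simple_index r k -> term_eps k (pair_term i (Psi_fun v)) = Some
  (binf_eps v k).
Proof.
move=> hk; have [t T] := exists_shift.
have := iso_eps T k (letters_shift v).
rewrite (Psi_shift T (Psi_Psi_fun v)) => ->.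
rewrite /shift_term term_eps_cat term_eps_binf_term //=.
by case: ifP => //= _; congr Some; have := binf_eps_ge0 r0 v k; lia.
Qed.

End OnePsi.

End BinfCrystal.

(** * The star involution *)

Section Star.
Local Open Scope ring_scope.
Variable r : nat.
Hypothesis r0 : (0 < r)%N.
Implicit Types v w : Binf r.
Local Notation u0 := (u_zero r).
Local Notation simple := (simple_index r).

(** Psi_i(v) = u_i(-[eps_star i v]) (x) [e_star_max i v]. The second component is what remains of v
    when f_i^star is undone as often as possible. *)
Definition eps_star i v : int := - (Psi_fun i v).1.
Definition e_star_max i v : Binf r := (Psi_fun i v).2.
Definition binf_phi v i : int := binf_eps v i + binf_wt v i.
(* f_i and f_i^star agree exactly where this is 0. *)
Definition jump i v : int := binf_eps v i + eps_star i v + binf_wt v i.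

Lemma eps_star_e_star_max_inj i v w : simple i -> eps_star i v = eps_star i w -> e_star_max i v =
  e_star_max i w -> v = w.
Proof.
move=> hi e x; apply: (Psi_fun_inj r0 hi); move: e x; rewrite /eps_star /e_star_max.
by case: (Psi_fun i v) (Psi_fun i w) => a x [b y] /= /oppr_inj -> ->.
Qed.

Lemma eps_star_ne i k v : simple i -> simple k -> k != i -> eps_star i (binf_f k v) = eps_star i v.
Proof. by move=> hi hk /negPf ne; rewrite /eps_star Psi_fun_binf_f // /pair_f ne. Qed.

Lemma e_star_max_ne i k v : simple i -> simple k -> k != i -> e_star_max i (binf_f k v) = binf_f
  k (e_star_max i v).
Proof. by move=> hi hk /negPf ne; rewrite /e_star_max Psi_fun_binf_f // /pair_f ne. Qed.

Lemma eps_star_binf_f i v : simple i ->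
  eps_star i (binf_f i v) = if binf_phi (e_star_max i v) i <= eps_star i v then eps_star i v + 1
    else eps_star i v.
Proof.
move=> hi; rewrite /eps_star /e_star_max /binf_phi Psi_fun_binf_f // /pair_f eqxx /=;
  case: ifP => //= _; lia.
Qed.

Lemma e_star_max_binf_f i v : simple i ->
  e_star_max i (binf_f i v) = if binf_phi (e_star_max i v) i <= eps_star i v then e_star_max i v
    else binf_f i (e_star_max i v).
Proof. by move=> hi; rewrite /eps_star /e_star_max /binf_phi Psi_fun_binf_f // /pair_f eqxx /=;
  case: ifP. Qed.

Lemma eps_star_u0 i : simple i -> eps_star i u0 = 0.
Proof. by move=> hi; rewrite /eps_star Psi_fun_u0. Qed.

Lemma e_star_max_u0 i : simple i -> e_star_max i u0 = u0.
Proof. by move=> hi; rewrite /e_star_max Psi_fun_u0. Qed.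

Lemma binf_phi_binf_f i v : simple i -> binf_phi (binf_f i v) i = binf_phi v i - 1.
Proof. by move=> hi; rewrite /binf_phi binf_eps_binf_f // binf_wt_binf_f // cartan_diag; lia. Qed.

Lemma binf_phi_u0 i : binf_phi u0 i = 0.
Proof. by rewrite /binf_phi binf_eps_u0 binf_wt_u0. Qed.

Lemma binf_eps_ne i k v : simple i -> simple k -> k != i -> binf_eps v k = binf_eps (e_star_max i
  v) k.
Proof.
move=> hi hk /negPf ne; have := term_eps_Psi_fun r0 hi v hk.
by rewrite /= ne /= term_eps_binf_term //= => -[].
Qed.

Lemma binf_eps_eq i v : simple i ->
  binf_eps v i = Num.max (binf_eps (e_star_max i v) i) (eps_star i v - binf_wt (e_star_max i v) i).
Proof.
move=> hi; have := term_eps_Psi_fun r0 hi v hi.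
by rewrite /= eqxx /= term_eps_binf_term //= => -[].
Qed.

Lemma binf_wt_e_star_max i k v : simple i -> binf_wt v k = binf_wt (e_star_max i v) k - eps_star
  i v * cartan k i.
Proof. by move=> hi; rewrite (wt_Psi_fun r0 hi) /eps_star /e_star_max; lia. Qed.

(** In this form the jump is visibly nonnegative, and it vanishes exactly when f_i acts on the
    factor B_i of Psi_i(v). *)
Lemma jumpE i v : simple i -> jump i v = Num.max (binf_phi (e_star_max i v) i - eps_star i v) 0.
Proof.
by move=> hi; rewrite /jump binf_eps_eq // (@binf_wt_e_star_max i i v hi) cartan_diag /binf_phi;
  lia.
Qed.

Lemma eps_star_ge0 i v : simple i -> 0 <= eps_star i v.
Proof.
move=> hi; elim/Binf_ind: v => [||k v hk IH] //; first by rewrite eps_star_u0.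
have [->|ne] := eqVneq k i; last by rewrite eps_star_ne.
by rewrite eps_star_binf_f //; case: ifP; lia.
Qed.

Lemma e_star_max_es0 i v : simple i -> eps_star i v = 0 -> e_star_max i v = v.
Proof.
move=> hi; elim/Binf_ind: v => [||k v hk IH] //; first by rewrite e_star_max_u0.
have [->|ne] := eqVneq k i; last by rewrite eps_star_ne ?e_star_max_ne // => /IH ->.
rewrite eps_star_binf_f ?e_star_max_binf_f //; have := eps_star_ge0 v hi.
by case: ifP => _ h e; [lia|rewrite IH].
Qed.

(** Induction along f-words. If v' serves v, then f_k v' serves f_k v whenever f_k acts on the same
    factor of Psi_i(v) and Psi_i(v'); only one value of phi_i prevents this. *)
Lemma fstar_ex i v : simple i -> exists v',
  [/\ eps_star i v' = eps_star i v + 1, e_star_max i v' = e_star_max i v & binf_height v' =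
    (binf_height v).+1].
Proof.
move=> hi; elim/Binf_ind: v => [||k v hk [v' [ev xv hv]]] //.
  exists (binf_f i u0); rewrite eps_star_binf_f // e_star_max_binf_f // e_star_max_u0 //
    eps_star_u0 // binf_phi_u0 lexx.
  by rewrite binf_height_binf_f.
have [->|ne] := eqVneq k i; last first.
  by exists (binf_f k v'); rewrite !eps_star_ne ?e_star_max_ne // !binf_height_binf_f //
    ev xv hv; split.
have [le|gt] := boolP (binf_phi (e_star_max i v) i <= eps_star i v).
  have le' : binf_phi (e_star_max i v) i <= eps_star i v + 1 by lia.
  by exists (binf_f i v'); rewrite !eps_star_binf_f ?e_star_max_binf_f //
    xv ev le le' !binf_height_binf_f ?hv.
have [le1|gt1] := boolP (binf_phi (e_star_max i v) i <= eps_star i v + 1); last first.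
  exists (binf_f i v'); rewrite !eps_star_binf_f ?e_star_max_binf_f // xv ev (negPf gt) (negPf gt1).
  by rewrite !binf_height_binf_f ?hv.
(* The borderline case phi_i(x) = [eps_star i v] + 1 with x = [e_star_max i v]: the first f_i acts
   on x and makes phi_i equal to [eps_star i v], so the second acts on B_i. *)
exists (binf_f i (binf_f i v)).
have ex : eps_star i (binf_f i v) = eps_star i v by rewrite eps_star_binf_f // (negPf gt).
have xx : e_star_max i (binf_f i v) = binf_f i (e_star_max i v) by rewrite e_star_max_binf_f //
  (negPf gt).
have le' : binf_phi (e_star_max i v) i - 1 <= eps_star i v by lia.
rewrite (@eps_star_binf_f i (binf_f i v)) // (@e_star_max_binf_f i (binf_f i v)) //
  ex xx binf_phi_binf_f // le'.
by rewrite !binf_height_binf_f.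
Qed.

Definition fstar i v : Binf r :=
  xget v [set v' | [/\ eps_star i v' = eps_star i v + 1, e_star_max i v' = e_star_max i v &
    binf_height v' = (binf_height v).+1]]%classic.

Lemma fstarP i v : simple i ->
  [/\ eps_star i (fstar i v) = eps_star i v + 1, e_star_max i (fstar i v) = e_star_max i v &
    binf_height (fstar i v) = (binf_height v).+1].
Proof. by move=> hi; rewrite /fstar; case: xgetP => // h; have [z /h] := fstar_ex v hi. Qed.

Lemma eps_star_fstar i v : simple i -> eps_star i (fstar i v) = eps_star i v + 1.
Proof. by case/(fstarP v). Qed.

Lemma e_star_max_fstar i v : simple i -> e_star_max i (fstar i v) = e_star_max i v.
Proof. by case/(fstarP v). Qed.

Lemma binf_height_fstar i v : simple i -> binf_height (fstar i v) = (binf_height v).+1.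
Proof. by case/(fstarP v). Qed.

(** Induction along f-words: a last f_i that acted on B_i is itself the step to undo; any other last
    step applies equally to the predecessor found before it. *)
Lemma fstar_pred i v : simple i -> 0 < eps_star i v -> exists w, v = fstar i w.
Proof.
move=> hi e0.
suff [w ew xw] : exists2 w, eps_star i w = eps_star i v - 1 & e_star_max i w = e_star_max i v.
  exists w; apply: (eps_star_e_star_max_inj hi); rewrite ?eps_star_fstar ?e_star_max_fstar // ew;
    lia.
elim/Binf_ind: v e0 => [||k v hk IH] //; first by rewrite eps_star_u0.
have [->|ne] := eqVneq k i; last first.
  rewrite eps_star_ne ?e_star_max_ne // => /IH[w ew xw].
  by exists (binf_f k w); rewrite ?eps_star_ne ?e_star_max_ne // xw.
rewrite eps_star_binf_f // e_star_max_binf_f //; case: ifP => h e0; first by exists v => //; lia.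
have [w ew xw] := IH e0.
by exists (binf_f i w); rewrite ?eps_star_binf_f ?e_star_max_binf_f // xw ew ifF //; lia.
Qed.

Lemma exists_eps_star v : v <> u0 -> exists2 i, simple i & 0 < eps_star i v.
Proof.
elim/Binf_ind: v => [||k v hk IH] // _.
have [v0|/eqP /IH[i hi e0]] := eqVneq v u0.
  by exists k => //; rewrite v0 eps_star_binf_f // e_star_max_u0 // eps_star_u0 // binf_phi_u0.
exists i => //; have [->|ne] := eqVneq k i; last by rewrite eps_star_ne.
by rewrite eps_star_binf_f //; case: ifP; lia.
Qed.

Lemma binf_f_fstar i k v : simple i -> simple k -> k != i -> binf_f k (fstar i v) = fstar i
  (binf_f k v).
Proof.
move=> hi hk ne; apply: (eps_star_e_star_max_inj hi).
  by rewrite eps_star_fstar // !eps_star_ne // eps_star_fstar.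
by rewrite e_star_max_fstar // !e_star_max_ne // e_star_max_fstar.
Qed.

Lemma jump0 i v : simple i -> jump i v = 0 -> binf_f i v = fstar i v.
Proof.
move=> hi; rewrite jumpE // => j0; apply: (eps_star_e_star_max_inj hi).
  by rewrite eps_star_binf_f // eps_star_fstar // ifT //; lia.
by rewrite e_star_max_binf_f // e_star_max_fstar // ifT //; lia.
Qed.

(** A positive jump drops by one under f_i^star. From 2 on, f_i therefore acts on the right factor
    before and after; at most 1 leaves jump 0, where f_i equals f_i^star. *)
Lemma jump2 i v : simple i -> 1 < jump i v -> binf_f i (fstar i v) = fstar i (binf_f i v).
Proof.
move=> hi; rewrite jumpE // => j0; apply: (eps_star_e_star_max_inj hi).
  by rewrite eps_star_fstar // !eps_star_binf_f // eps_star_fstar // e_star_max_fstar // !ifF //;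
    lia.
by rewrite e_star_max_fstar // !e_star_max_binf_f // eps_star_fstar // e_star_max_fstar //
  !ifF //; lia.
Qed.

Lemma binf_f_fstar_cases i v : simple i ->
  binf_f i (fstar i v) = fstar i (fstar i v) \/ binf_f i (fstar i v) = fstar i (binf_f i v).
Proof.
move=> hi; have [j2|j1] := boolP (1 < jump i v); first by right; rewrite jump2.
left; apply: jump0 => //; rewrite jumpE // eps_star_fstar // e_star_max_fstar //.
by move: j1; rewrite jumpE //; lia.
Qed.

Lemma binf_eps_fstar_ne i k v : simple i -> simple k -> k != i -> binf_eps (fstar i v) k =
  binf_eps v k.
Proof. by move=> hi hk ne; rewrite (binf_eps_ne _ hi) // e_star_max_fstar //
  -(binf_eps_ne _ hi). Qed.

(** Together with [eps_star_binf_f_jump] this is symmetric under exchanging f_i with f_i^star and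
    epsilon_i with its star version, which lets star interchange them. *)
Lemma binf_eps_fstar i v : simple i -> binf_eps (fstar i v) i = binf_eps v i + (jump i v == 0)%:Z.
Proof.
move=> hi; rewrite jumpE // (@binf_eps_eq i v) // (@binf_eps_eq i (fstar i v)) //
  eps_star_fstar // e_star_max_fstar // /binf_phi.
by case: eqP => /=; lia.
Qed.

Lemma eps_star_binf_f_jump i v : simple i -> eps_star i (binf_f i v) = eps_star i v + (jump i v
  == 0)%:Z.
Proof. by move=> hi; rewrite jumpE // eps_star_binf_f //; case: ifP; case: eqP => /=; lia. Qed.

Lemma binf_wt_fstar i k v : simple i -> binf_wt (fstar i v) k = binf_wt v k - cartan k i.
Proof. by move=> hi; rewrite (@binf_wt_e_star_max i k v) //
  (@binf_wt_e_star_max i k (fstar i v)) // eps_star_fstar // e_star_max_fstar //; lia. Qed.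

Lemma f_starP i v v' : simple i -> f_star i v v' <-> v' = fstar i v.
Proof.
move=> hi; split=> [[a [x [h1 h2]]]|->].
  have := Psi_eq r0 hi h1; have := Psi_eq r0 hi h2 => e2 e1.
  apply: (eps_star_e_star_max_inj hi); rewrite ?eps_star_fstar ?e_star_max_fstar //
    /eps_star /e_star_max -e1 -e2 //=; lia.
exists (- eps_star i v), (e_star_max i v); split.
  by have := Psi_Psi_fun r0 i v; rewrite /eps_star /e_star_max opprK; case: (Psi_fun i v).
have E (z : int * Binf r) b y : z.1 = b -> z.2 = y -> z = (b, y).
  by case: z => ? ? /= -> ->.
rewrite -(E (Psi_fun i (fstar i v)) _ _ _ (e_star_max_fstar v hi)); first exact: Psi_Psi_fun.
by have := eps_star_fstar v hi; rewrite /eps_star; lia.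
Qed.

Lemma star_graph_inv v v' : star_graph v v' ->
  (v = u0 /\ v' = u0) \/
  exists i w w', [/\ simple i, star_graph w w', v = binf_f i w & v' = fstar i w'].
Proof.
case=> [|i w y w' y' g c f]; [by left|right; exists i, w, w'].
have [hi|hi] := boolP (simple i); last by rewrite cf_nonsimple in c.
move: c; rewrite (cf_binf_term r0 w hi).1 => -[<-].
by split=> //; apply/f_starP.
Qed.

Lemma star_graph_binf_f i v v' : simple i -> star_graph v v' -> star_graph (binf_f i v) (fstar i
  v').
Proof.
move=> hi g; apply: (@star_f _ i v _ v') => //; first exact: (cf_binf_term r0 v hi).1.
exact/f_starP.
Qed.

Lemma star_unique v v' : star_graph v v' -> (forall u, star_graph v u -> u = v') -> star v = v'.
Proof.
by move=> g h; rewrite /star; case: xgetP => [u _ /h //|/(_ v')].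
Qed.

(** The clauses are proved together by induction on the height: uniqueness at v compares two ways of
    descending from v, and the comparison uses the other clauses lower down. *)
Definition star_good v : Prop :=
  [/\ star_graph v (star v) /\ (forall u, star_graph v u -> u = star v),
      forall i, simple i -> binf_eps (star v) i = eps_star i v /\ eps_star i (star v) = binf_eps
        v i,
      forall i, binf_wt (star v) i = binf_wt v i,
      forall i w, simple i -> v = binf_f i w -> star v = fstar i (star w) &
      forall i w, simple i -> v = fstar i w -> star v = binf_f i (star w)].

Lemma binf_height_u0 : binf_height u0 = 0%N.
Proof.
rewrite /binf_height binf_term_zero; suff -> : term_sum (zero_term (Jword r)) = 0 by [].
by elim: (Jword r) => //= j J ->; rewrite addr0.
Qed.

Lemma star_good_u0 : star_good u0.
Proof.
have uniq u : star_graph u0 u -> u = u0.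
  case/star_graph_inv => [[_ //]|[i [w [w' [hi _ e _]]]]].
  by have := binf_height_binf_f r0 w hi; rewrite -e binf_height_u0.
have e : star u0 = u0 by apply: star_unique => //; exact: star_u_zero.
split=> [|i hi|i|i w hi h|i w hi h].
- by rewrite e; split=> //; exact: star_u_zero.
- by rewrite e eps_star_u0 // binf_eps_u0.
- by rewrite e.
- by have := binf_height_binf_f r0 w hi; rewrite -h binf_height_u0.
- by have := binf_height_fstar w hi; rewrite -h binf_height_u0.
Qed.

Lemma star_goodP v : star_good v.
Proof.
have [n] := ubnP (binf_height v); elim: n v => // n IH v hn.
have [->|/eqP v0] := eqVneq v u0; first exact: star_good_u0.
have gF i w : simple i -> v = binf_f i w -> star_good w.
  by move=> hi e; apply: IH; move: hn; rewrite e binf_height_binf_f.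
have gS i w : simple i -> v = fstar i w -> star_good w.
  by move=> hi e; apply: IH; move: hn; rewrite e binf_height_fstar.
have jump_star i w : simple i -> star_good w -> jump i (star w) = jump i w.
  by move=> hi [_ b wt _ _]; rewrite /jump wt; have [-> ->] := b i hi; lia.
(* The square: unless i = j and w = x, there is u with w = f_j^star u and x = f_i u, and both sides
   are computed from [star u]. In the exceptional case the jump is 0 and f_i agrees with
   f_i^star. *)
have key i w j x : simple i -> simple j -> v = binf_f i w -> v = fstar j x ->
    fstar i (star w) = binf_f j (star x).
  move=> hi hj e1 e2; have gw := gF _ _ hi e1; have gx := gS _ _ hj e2.
  have [ij|ij] := eqVneq i j.
    subst j; have [wx|wx] := eqVneq w x.
      subst x; have j0 : jump i w = 0.
        have := eps_star_fstar w hi; rewrite -e2 e1 eps_star_binf_f_jump //; case: eqP => //=; lia.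
      by rewrite jump0 // jump_star.
    have le : (binf_phi (e_star_max i w) i <= eps_star i w) = false.
      apply/negP => le; case/eqP: wx; apply: (eps_star_e_star_max_inj hi).
        by have := eps_star_fstar x hi; rewrite -e2 e1 eps_star_binf_f // le; lia.
      by have := e_star_max_fstar x hi; rewrite -e2 e1 e_star_max_binf_f // le.
    have ex : eps_star i w = eps_star i x + 1.
      by have := eps_star_fstar x hi; rewrite -e2 e1 eps_star_binf_f // le.
    have xx : binf_f i (e_star_max i w) = e_star_max i x.
      by have := e_star_max_fstar x hi; rewrite -e2 e1 e_star_max_binf_f // le.
    have e0 : 0 < binf_eps x i.
      by rewrite binf_eps_eq // -xx binf_eps_binf_f //; have := binf_eps_ge0 r0 (e_star_max i w)
        i; lia.
    have ux := binf_f_binf_e r0 hi e0; set u := binf_e i x in ux.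
    have jx : (binf_phi (e_star_max i u) i <= eps_star i u) = false.
      apply/negP => le'.
      have := eps_star_binf_f u hi; have := e_star_max_binf_f u hi; rewrite ux le' -xx => h1 h2.
      by move: le'; rewrite -h1 binf_phi_binf_f //; lia.
    have xu : e_star_max i u = e_star_max i w.
      by apply: (binf_f_inj r0 hi); rewrite xx -ux e_star_max_binf_f // jx.
    have eu : eps_star i u = eps_star i x by rewrite -[in RHS]ux eps_star_binf_f // jx.
    have wu : w = fstar i u by apply: (eps_star_e_star_max_inj hi);
      rewrite ?eps_star_fstar ?e_star_max_fstar // ex eu.
    have hu : (binf_height u < n)%N.
      by move: hn; rewrite e2 binf_height_fstar // -ux binf_height_binf_f //; lia.
    have [_ _ _ _ /(_ i u hi wu) ->] := gw.
    have [_ _ _ /(_ i u hi (esym ux)) -> _] := gx.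
    rewrite -jump2 // jump_star //; last by apply: IH; lia.
    by rewrite jumpE // xu eu; lia.
  have exw : eps_star j w = eps_star j x + 1 by have := eps_star_fstar x hj;
    rewrite -e2 e1 eps_star_ne.
  have xxw : binf_f i (e_star_max j w) = e_star_max j x by have := e_star_max_fstar x hj;
    rewrite -e2 e1 e_star_max_ne.
  have e0 : 0 < binf_eps x i.
    by rewrite (binf_eps_ne _ hj) // -xxw binf_eps_binf_f //;
      have := binf_eps_ge0 r0 (e_star_max j w) i; lia.
  have ux := binf_f_binf_e r0 hi e0; set u := binf_e i x in ux.
  have xu : e_star_max j u = e_star_max j w by apply: (binf_f_inj r0 hi);
    rewrite xxw -ux e_star_max_ne.
  have eu : eps_star j u = eps_star j x by rewrite -[in RHS]ux eps_star_ne.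
  have wu : w = fstar j u by apply: (eps_star_e_star_max_inj hj);
    rewrite ?eps_star_fstar ?e_star_max_fstar // exw eu.
  have [_ _ _ _ /(_ j u hj wu) ->] := gw.
  have [_ _ _ /(_ i u hi (esym ux)) -> _] := gx.
  by rewrite binf_f_fstar // eq_sym.
have [//|[i [hi ei ev]]] := Binf_case r0 v.
(* One fixed predecessor x under f_j^star is the reference with which all predecessors of v under
   the f_k are compared. *)
have [j hj ej] := exists_eps_star v0; have [x ex] := fstar_pred hj ej.
have gw := gF _ _ hi ev; have gx := gS _ _ hj ex.
set w := binf_e i v in ev gw.
have sg : star_graph v (fstar i (star w)).
  by rewrite ev; apply: star_graph_binf_f => //; have [[]] := gw.
have su u : star_graph v u -> u = fstar i (star w).
  case/star_graph_inv => [[//]|[k [y [y' [hk gy ey ->]]]]].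
  have [[_ /(_ _ gy) ->] _ _ _ _] := gF _ _ hk ey.
  by rewrite (key _ _ _ _ hk hj ey ex) (key _ _ _ _ hi hj ev ex).
have sv : star v = fstar i (star w) by apply: star_unique.
have sv' : star v = binf_f j (star x) by rewrite sv (key _ _ _ _ hi hj ev ex).
have [_ bw ww _ _] := gw; have [_ bx wx _ _] := gx.
split=> [|k hk|k|k y hk ey|k y hk ey].
- by rewrite sv.
- split.
    rewrite sv ev; have [<-|ne] := eqVneq i k; last first.
      by rewrite binf_eps_fstar_ne 1?eq_sym // eps_star_ne // (bw k hk).1.
    by rewrite binf_eps_fstar // eps_star_binf_f_jump // jump_star // (bw i hi).1.
  rewrite sv' ex; have [<-|ne] := eqVneq j k; last first.
    by rewrite eps_star_ne // binf_eps_fstar_ne 1?eq_sym // (bx k hk).2.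
  by rewrite eps_star_binf_f_jump // binf_eps_fstar // jump_star // (bx j hj).2.
- by rewrite sv binf_wt_fstar // ww -binf_wt_binf_f // -ev.
- by rewrite sv' (key _ _ _ _ hk hj ey ex).
- by rewrite sv (key _ _ _ _ hi hk ev ey).
Qed.

Lemma star_binf_f i v : simple i -> star (binf_f i v) = fstar i (star v).
Proof. by move=> hi; have [_ _ _ h _] := star_goodP (binf_f i v); apply: h. Qed.

Lemma star_fstar i v : simple i -> star (fstar i v) = binf_f i (star v).
Proof. by move=> hi; have [_ _ _ _ h] := star_goodP (fstar i v); apply: h. Qed.

Lemma star_u0 : star u0 = u0.
Proof.
have [[_ h] _ _ _ _] := star_goodP u0; apply/esym/h; exact: star_u_zero.
Qed.

Lemma starK v : star (star v) = v.
Proof.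
elim/Binf_ind: v => [||k v hk IH] //; first by rewrite !star_u0.
by rewrite star_binf_f // star_fstar // IH.
Qed.

Lemma binf_eps_star v i : simple i -> binf_eps (star v) i = eps_star i v.
Proof. by move=> hi; have [_ /(_ i hi)[]] := star_goodP v. Qed.

(** * String data of star(v) and the coordinates of v *)

Lemma e_iter_binf_f i n v : simple i -> e_iter i n.+1 (binf_f i v) = e_iter i n v.
Proof. by move=> hi; rewrite /e_iter iterSr -[obind _ _]/(ce i (binf_f i v)) binf_e_binf_f. Qed.

Lemma e_iter_None (B : crystal) i n m (x : B) : (n <= m)%N ->
  e_iter i n x = None -> e_iter i m x = None.
Proof. by move=> /subnKC <- h; elim: (m - n)%N => [|k IH]; rewrite ?addn0 // addnS /= IH. Qed.

Lemma e_maxE (B : crystal) i n (x : B) : e_iter i n x <> None -> e_iter i n.+1 x = None ->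
  e_max i x = n.
Proof.
move=> h1 h2; rewrite /e_max; case: xgetP => [k _ [k1 k2]|/(_ n)[]] //.
apply/eqP; rewrite eqn_leq; apply/andP; split; rewrite leqNgt; apply/negP => lt.
  by apply: k1; apply: e_iter_None lt h2.
by apply: h1; apply: e_iter_None lt k2.
Qed.

Lemma e_iter_star i v : simple i ->
  e_iter i `|eps_star i v| (star v) = Some (star (e_star_max i v)) /\
  e_iter i `|eps_star i v|.+1 (star v) = None.
Proof.
move=> hi; have [n] := ubnP `|eps_star i v|%N; elim: n v => // n IH v hn.
have := eps_star_ge0 v hi; rewrite le_eqVlt => /orP[/eqP e0|e0].
  rewrite -e0 /= e_star_max_es0 //; split=> //.
  by apply: (ce_eps0 r0 hi); rewrite binf_eps_star.
have [w vw] := fstar_pred hi e0; move: hn; rewrite vw eps_star_fstar // e_star_max_fstar //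
  star_fstar //.
have w0 := eps_star_ge0 w hi; have -> : `|(eps_star i w + 1)%R|%N = `|eps_star i w|.+1 by lia.
by rewrite !e_iter_binf_f //; apply: IH.
Qed.

Fixpoint star_string (J : seq nat) v : seq nat :=
  if J is j :: J' then `|eps_star j v|%N :: star_string J' (e_star_max j v) else [::].

Lemma string_data_star J v : all simple J -> string_data J (star v) = star_string J v.
Proof.
elim: J v => //= j J IH v /andP[hj hJ]; have [h1 h2] := e_iter_star v hj.
by rewrite (e_maxE _ h2) h1 //= IH.
Qed.

(** Kashiwara's iterated embedding of B_infinity into B_(J_1) (x) ... (x) B_(J_M) (x) B_infinity. *)
Fixpoint psi_term (J : seq nat) v : word_term :=
  if J is j :: J' then (j, - eps_star j v) :: psi_term J' (e_star_max j v) else binf_term v.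

Lemma psi_term_stats J v k : all simple J -> simple k ->
  [/\ term_eps k (psi_term J v) = Some (binf_eps v k), term_wt k (psi_term J v) = binf_wt v k &
      term_f k (psi_term J v) = psi_term J (binf_f k v)].
Proof.
move=> + hk; elim: J v => [|j J IH] v /=.
  by move=> _; rewrite term_eps_binf_term // (cf_binf_term r0 v hk).2.
move=> /andP[hj hJ]; have [h1 h2 h3] := IH (e_star_max j v) hJ.
rewrite h1 h2 h3; split.
- have := term_eps_Psi_fun r0 hj v hk; rewrite /= term_eps_binf_term // => <-.
  by rewrite /eps_star opprK.
- by rewrite (@binf_wt_e_star_max j k v); lia.
have := pair_f_pair_term r0 j (Psi_fun j v) hk; rewrite -Psi_fun_binf_f //
  /pair_term /= term_eps_binf_term //=.
rewrite /eps_star /e_star_max opprK; case: ifP => c [-> h] /=.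
  by move/binf_term_inj: h => ->; rewrite !opprK.
by congr cons; move: h; rewrite -(cf_binf_term r0 _ hk).2 => /binf_term_inj ->.
Qed.

Lemma all_simple_Jword : all simple (Jword r).
Proof. by apply/allP => j; rewrite -simple_Jword. Qed.

Lemma psi_term_u0 J : all simple J -> psi_term J u0 = zero_term J ++ zero_term (Jword r).
Proof.
elim: J => [|j J IH] /=; first by rewrite binf_term_zero.
by case/andP=> hj hJ; rewrite eps_star_u0 // e_star_max_u0 // oppr0 IH.
Qed.

(* Iterating Psi along J and shifting v to v (x) 0 are both the unique crystal
   morphism sending u_0 to 0, so that the coordinates of v are its *-string. *)
Lemma psi_term_Jword v : psi_term (Jword r) v = binf_term v ++ zero_term (Jword r).
Proof.
elim/Binf_ind: v => [||k v hk IH] //.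
  by rewrite psi_term_u0 ?all_simple_Jword // binf_term_zero.
have [_ _ <-] := psi_term_stats v all_simple_Jword hk.
rewrite IH term_f_cat term_eps_binf_term // term_eps_zero_term term_wt_zero_term -simple_Jword //
  hk /= subr0.
by rewrite binf_eps_ge0 // (cf_binf_term r0 _ hk).2.
Qed.

Lemma coords_star_string v : coords (val v) = [seq - b%:Z | b <- star_string (Jword r) v].
Proof.
have size_ss J w : size (star_string J w) = size J by elim: J w => //= j J IH w; rewrite IH.
have sndE J w : all simple J ->
    [seq p.2 | p <- psi_term J w] =
    [seq - b%:Z | b <- star_string J w] ++ [seq p.2 | p <- drop (size J) (psi_term J w)].
  elim: J w => [|j J IH] w /=; first by rewrite drop0.
  by move=> /andP[hj hJ]; rewrite {1}IH // gez0_abs ?eps_star_ge0.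
have := sndE _ v all_simple_Jword; rewrite {1}psi_term_Jword map_cat => /eqP.
have unz2 : [seq p.2 | p <- binf_term v] = coords (val v).
  by rewrite /binf_term tensor_term_zip -/(unzip2 _) unzip2_zip ?size_coords.
rewrite unz2 eqseq_cat; first by case/andP=> /eqP.
by rewrite size_coords size_map size_ss.
Qed.

End Star.

(** * Length and the degenerate Hecke monoid *)

Section Coxeter.
Local Open Scope group_scope.
Variable r : nat.
Implicit Types (w x y : 'S_r) (i j n p q : nat).
Local Notation simple := (simple_index r).
Local Notation s := (s_ r).

(** The permutation extended to all natural numbers by the identity, so that positions such as
    [i.-1] are plain numbers. *)
Definition nat_perm w n : nat := if insub n is Some p then val (w p) else n.

Definition nat_swap i n : nat := if n == i.-1 then i else if n == i then i.-1 else n.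

Lemma nat_perm_ord w (p : 'I_r) : nat_perm w p = w p.
Proof. by rewrite /nat_perm valK. Qed.

Lemma nat_perm_out w n : (r <= n)%N -> nat_perm w n = n.
Proof. by move=> h; rewrite /nat_perm insubF // ltnNge h. Qed.

Lemma nat_perm_lt w n : (n < r)%N -> (nat_perm w n < r)%N.
Proof. by move=> h; rewrite /nat_perm insubT; apply: ltn_ord. Qed.

Lemma nat_perm_inj w : injective (nat_perm w).
Proof.
move=> n m; have [hn|hn] := ltnP n r; have [hm|hm] := ltnP m r.
- rewrite /nat_perm !insubT /= => /ord_inj /perm_inj e.
  by have := congr1 val e.
- by have := nat_perm_lt w hn; rewrite (nat_perm_out w hm); lia.
- by have := nat_perm_lt w hm; rewrite (nat_perm_out w hn); lia.
- by rewrite !nat_perm_out.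
Qed.

Lemma nat_perm_ext x y : (forall n, (n < r)%N -> nat_perm x n = nat_perm y n) -> x = y.
Proof.
move=> h; apply/permP => p; apply: val_inj.
by have := h p (ltn_ord p); rewrite !nat_perm_ord.
Qed.

Lemma nat_perm1 n : nat_perm 1 n = n.
Proof. by rewrite /nat_perm; case: insubP => //= u _ <-; rewrite perm1. Qed.

Lemma nat_permM x y n : nat_perm (x * y) n = nat_perm y (nat_perm x n).
Proof.
have [h|h] := ltnP n r; last by rewrite !nat_perm_out.
by rewrite -[n]/(val (Ordinal h)) !nat_perm_ord permM.
Qed.

Lemma nat_permK w n : nat_perm w^-1 (nat_perm w n) = n.
Proof. by rewrite -nat_permM mulgV nat_perm1. Qed.

Lemma nat_permVK w n : nat_perm w (nat_perm w^-1 n) = n.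
Proof. by rewrite -nat_permM mulVg nat_perm1. Qed.

Lemma nat_perm_s i n : simple i -> nat_perm (s i) n = nat_swap i n.
Proof.
move=> /andP[i0 ir]; have ir' : (i.-1 < r)%N by lia.
rewrite /s_ !insubT /nat_swap.
have [h|h] := ltnP n r; last by rewrite nat_perm_out // !ifF //; lia.
rewrite -[n]/(val (Ordinal h)) nat_perm_ord.
case: tpermP => [/(congr1 val)/= ->|/(congr1 val)/= ->|n1 n2] /=.
- by rewrite eqxx.
- by rewrite eqxx ifF //; lia.
- by rewrite !ifF //; apply/eqP => e; [apply: n2|apply: n1]; apply: val_inj.
Qed.

Lemma nat_swapK i n : (0 < i)%N -> nat_swap i (nat_swap i n) = n.
Proof.
move=> i0; rewrite /nat_swap; have [->|h1] := eqVneq n i.-1.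
  by rewrite eqxx ifF //; lia.
by have [->|h2] := eqVneq n i; rewrite ?eqxx // (negPf h1) (negPf h2).
Qed.

Lemma nat_swap_ltn i a b : (0 < i)%N -> ~~ ((a == i.-1) && (b == i)) ->
  ~~ ((a == i) && (b == i.-1)) -> (nat_swap i a < nat_swap i b)%N = (a < b)%N.
Proof.
by rewrite /nat_swap => i0; do ![case: eqP => ?] => //= _ _; apply/idP/idP; lia.
Qed.

(** Exchanging adjacent positions keeps the order of every pair of positions except (i-1, i), which
    accounts for the one new inversion. *)
Lemma nat_swap_inv i (f : nat -> nat) a b : (0 < i)%N -> (f i.-1 < f i)%N ->
  (a < b)%N && (f (nat_swap i b) < f (nat_swap i a))%N =
  (a == i.-1) && (b == i) || (nat_swap i a < nat_swap i b)%N && (f (nat_swap i b) < f (nat_swap i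
    a))%N.
Proof.
move=> i0 u; have e1 : nat_swap i i.-1 = i by rewrite /nat_swap eqxx.
have e2 : nat_swap i i = i.-1 by rewrite /nat_swap eqxx ifF //; lia.
have [/andP[/eqP -> /eqP ->]|h1] := boolP ((a == i.-1) && (b == i)).
  by rewrite e1 e2 u /=; lia.
have [/andP[/eqP -> /eqP ->]|h2] := boolP ((a == i) && (b == i.-1)).
  by rewrite e1 e2 /= (ltnNge (f i)) (ltnW u) !andbF.
by rewrite nat_swap_ltn.
Qed.

Lemma s2 i : simple i -> s i * s i = 1.
Proof.
move=> hi; apply: nat_perm_ext => n _; rewrite nat_permM nat_perm1 !nat_perm_s // nat_swapK //.
by case/andP: hi.
Qed.

Lemma sV i : simple i -> (s i)^-1 = s i.
Proof. by move=> hi; apply: (mulgI (s i)); rewrite mulgV s2. Qed.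

Lemma sK i w : simple i -> s i * (s i * w) = w.
Proof. by move=> hi; rewrite mulgA s2 // mul1g. Qed.

(** Products compose from left to right, so s_i w is w with the entries at positions i-1 and i
    exchanged; the test means s_i w > w. *)
Definition ascent i w : bool := (nat_perm w i.-1 < nat_perm w i)%N.

Lemma ascent_s i w : simple i -> ascent i (s i * w) = ~~ ascent i w.
Proof.
move=> hi; have i0 : (0 < i)%N by case/andP: hi.
rewrite /ascent !nat_permM !nat_perm_s // /nat_swap eqxx ifF ?eqxx; last by lia.
have : nat_perm w i.-1 <> nat_perm w i by move/nat_perm_inj; lia.
by lia.
Qed.

Definition inv_set w := [set p : 'I_r * 'I_r | (p.1 < p.2)%N && (w p.2 < w p.1)%N].

Lemma lenV w : len w^-1 = len w.
Proof.
pose f (p : 'I_r * 'I_r) := (w p.2, w p.1).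
have fi : injective f by move=> [a b] [c d] [/perm_inj -> /perm_inj ->].
rewrite /len -[in RHS](card_imset _ fi); apply: eq_card => -[p q].
apply/idP/imsetP => [|[[a b]]]; rewrite !inE /=.
  move=> /andP[pq h]; exists (w^-1 q, w^-1 p); rewrite ?inE /= ?permKV ?h //.
  by rewrite /f /= !permKV.
by move=> /andP[ab h] [-> ->]; rewrite !permK ab h.
Qed.

Lemma len_ascent i w : simple i -> ascent i w -> len (s i * w) = (len w).+1.
Proof.
move=> hi u; have /andP[i0 ir] := hi; have ir' : (i.-1 < r)%N by lia.
pose f (p : 'I_r * 'I_r) := (s i p.1, s i p.2).
have fK : involutive f.
  by move=> [a b]; rewrite /f /= -!permM s2 // !perm1.
have fi : injective f := inv_inj fK.
pose ab : 'I_r * 'I_r := (Ordinal ir', Ordinal ir).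
have memE (z : 'I_r * 'I_r) : (z \in inv_set (s i * w)) = (z \in ab |: f @: inv_set w).
  have imE (z' : 'I_r * 'I_r) : (z' \in f @: inv_set w) = (f z' \in inv_set w).
    by rewrite -{1}(fK z') (mem_imset _ _ fi).
  rewrite in_setU1 imE !inE !permM.
  case: z => a b /=; rewrite -!nat_perm_ord !nat_perm_s // /ab xpair_eqE -!val_eqE /=.
  exact: nat_swap_inv.
rewrite /len -!/(inv_set _) (eq_card memE) cardsU1 card_imset //.
rewrite -(fK ab) (mem_imset _ _ fi) inE /f /= -!nat_perm_ord !nat_perm_s //
  /nat_swap /= eqxx ifF ?eqxx; last by lia.
by rewrite ltnNge leq_pred.
Qed.

Lemma len_down i w : simple i -> ~~ ascent i w -> len w = (len (s i * w)).+1.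
Proof. by move=> hi; rewrite -ascent_s // => u; rewrite -(len_ascent hi u) sK. Qed.

Lemma len_s_le i w : simple i -> (len (s i * w) <= (len w).+1)%N.
Proof.
move=> hi; have [u|d] := boolP (ascent i w); first by rewrite len_ascent.
by rewrite (len_down hi d); lia.
Qed.

(* Left multiplication by S_i in the degenerate Hecke algebra, on the basis S_w. *)
Definition act_up i w : 'S_r := if ascent i w then s i * w else w.
Definition act_down i w : 'S_r := if ascent i w then w else s i * w.

(** [act_up] puts two adjacent entries in decreasing order, which turns the Hecke relations into
    identities between maxima and minima. *)
Lemma nat_perm_act_up i w n : simple i -> nat_perm (act_up i w) n =
  if n == i.-1 then maxn (nat_perm w i.-1) (nat_perm w i)
  else if n == i then minn (nat_perm w i.-1) (nat_perm w i) else nat_perm w n.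
Proof.
move=> hi; have /andP[i0 _] := hi; rewrite /act_up /ascent; case: ltnP => h.
  rewrite nat_permM nat_perm_s // /nat_swap; do ![case: eqP => ?]; lia.
by do ![case: eqP => [->|?]]; lia.
Qed.

Lemma act_up_idem i w : simple i -> act_up i (act_up i w) = act_up i w.
Proof.
move=> hi; apply: nat_perm_ext => n _; rewrite !nat_perm_act_up // !eqxx; case/andP: hi => i0 _.
by do ![case: eqP => ?]; lia.
Qed.

Lemma act_up_comm i j w : simple i -> simple j -> (i.+1 < j)%N ->
  act_up i (act_up j w) = act_up j (act_up i w).
Proof.
move=> hi hj ij; apply: nat_perm_ext => n _; rewrite !nat_perm_act_up //.
have /andP[i0 _] := hi; have /andP[j0 _] := hj.
have [-> -> -> ->] : [/\ (i.-1 == j.-1) = false, (i.-1 == j) = false, (i == j.-1) = false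
   & (i == j) = false] by split; lia.
have [-> -> -> ->] : [/\ (j.-1 == i.-1) = false, (j.-1 == i) = false, (j == i.-1) = false
   & (j == i) = false] by split; lia.
by do ![case: eqP => ?]; lia.
Qed.

Lemma act_up_braid i w : simple i -> simple i.+1 ->
  act_up i (act_up i.+1 (act_up i w)) = act_up i.+1 (act_up i (act_up i.+1 w)).
Proof.
move=> hi hj; apply: nat_perm_ext => n _; have /andP[i0 _] := hi.
have E1 : (i.-1 == i) = false by lia.
have E2 : (i == i.-1) = false by lia.
have E3 : (i.-1 == i.+1) = false by lia.
have E4 : (i.+1 == i.-1) = false by lia.
have E5 : (i.+1 == i) = false by lia.
have E6 : (i == i.+1) = false by lia.
rewrite !nat_perm_act_up //= !eqxx !(E1, E2, E3, E4, E5, E6).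
by do ![case: eqP => [?|?]]; lia.
Qed.

Definition demazure_prod (t : seq nat) : 'S_r := foldr act_up 1 t.

Lemma hecke_act_up t u w : hecke_eq r t u -> foldr act_up w t = foldr act_up w u.
Proof.
move=> h; elim: h w => {t u} [t|t u _ IH|t u v _ IH1 _ IH2|t t' u u' _ IH1 _ IH2|i|i j|i] //=.
- by move=> w; rewrite IH1.
- by move=> w; rewrite !foldr_cat IH2.
- by move=> *; apply: act_up_idem.
- by move=> *; apply: act_up_comm.
- by move=> *; apply: act_up_braid.
Qed.

Lemma word_prod_cons i t : word_prod r (i :: t) = s i * word_prod r t.
Proof. by rewrite /word_prod big_cons. Qed.

Lemma word_prod_cat t u : word_prod r (t ++ u) = word_prod r t * word_prod r u.
Proof. by rewrite /word_prod big_cat. Qed.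

Lemma len_demazure_prod t : all simple t -> (len (demazure_prod t) <= size t)%N.
Proof.
elim: t => [|i t IH] /=.
  move=> _; rewrite /len leqn0 cards_eq0; apply/eqP/setP => p; rewrite !inE !perm1.
  by lia.
case/andP=> hi /IH {}IH; rewrite -/(demazure_prod t) /act_up; case: ifP => _; last by lia.
by have := len_s_le (demazure_prod t) hi; lia.
Qed.

Lemma len_word_prod t : all simple t -> (len (word_prod r t) <= size t)%N.
Proof.
elim: t => [|i t IH] /=; first by move=> _; rewrite /word_prod big_nil;
  exact: (@len_demazure_prod [::]).
case/andP=> hi /IH {}IH; rewrite word_prod_cons.
by have := len_s_le (word_prod r t) hi; lia.
Qed.

Lemma reduced_demazure_prod w t : reduced_word w t -> demazure_prod t = w.
Proof.
move=> /and3P[ht /eqP <- /eqP]; elim: t ht => [|i t IH] /=.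
  by rewrite /word_prod big_nil.
move=> /andP[hi ht]; rewrite word_prod_cons => sz.
have le1 := len_word_prod ht.
have u : ascent i (word_prod r t).
  by apply/negPn/negP => d; have := len_down hi d; lia.
rewrite len_ascent // in sz; rewrite -/(demazure_prod t) IH //; last by case: sz.
by rewrite /act_up u.
Qed.

Lemma reduced_cons i w t : simple i -> ascent i w -> reduced_word w t ->
  reduced_word (s i * w) (i :: t).
Proof.
move=> hi u /and3P[ht /eqP p /eqP sz]; apply/and3P; split => /=; first by rewrite hi.
  by rewrite word_prod_cons p.
by rewrite len_ascent // sz.
Qed.

(* The coset representatives s_n s_(n-1) ... s_(n+1-m) of S_n in S_(n+1). *)
Inductive normal_word : nat -> seq nat -> Prop :=
| normal_word_one : normal_word 1 [::]
| normal_word_succ n u m : normal_word n u -> (m <= n)%N -> normal_word n.+1 (u ++ rev (iota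
  (n.+1 - m) m)).

Lemma normal_word_gt0 n u : normal_word n u -> (0 < n)%N.
Proof. by case. Qed.

Lemma normal_word_nil n : (0 < n)%N -> normal_word n [::].
Proof.
elim: n => // -[|n] IH _; first exact: normal_word_one.
by rewrite -[[::]]/([::] ++ rev (iota (n.+2 - 0) 0)); apply: normal_word_succ => //; apply: IH.
Qed.

End Coxeter.

Lemma braid_rev r t u : braid_eq r t u -> braid_eq r (rev t) (rev u).
Proof.
elim=> {t u} [t|t u _|t u v _ + _|t t' u u' _ + _|i j|i].
- by move=> *; apply: braid_refl.
- exact: braid_sym.
- exact: braid_trans.
- by move=> h1 h2; rewrite !rev_cat; apply: braid_cat.
- by move=> *; apply: braid_sym; apply: braid_comm.
- exact: braid_braid.
Qed.

Lemma hecke_rev r t u : hecke_eq r t u -> hecke_eq r (rev t) (rev u).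
Proof.
elim=> {t u} [t|t u _|t u v _ + _|t t' u u' _ + _|i|i j|i].
- by move=> *; apply: hecke_refl.
- exact: hecke_sym.
- exact: hecke_trans.
- by move=> h1 h2; rewrite !rev_cat; apply: hecke_cat.
- exact: hecke_idem.
- by move=> *; apply: hecke_sym; apply: hecke_comm.
- exact: hecke_braid.
Qed.

Lemma braid_widen n r t u : (n <= r)%N -> braid_eq n t u -> braid_eq r t u.
Proof.
move=> nr; have w i : simple_index n i -> simple_index r i by rewrite /simple_index; lia.
elim=> {t u} [t|t u _|t u v _ + _|t t' u u' _ + _|i j /w hi /w hj|i /w hi /w hj].
- exact: braid_refl.
- exact: braid_sym.
- exact: braid_trans.
- exact: braid_cat.
- exact: braid_comm.
- exact: braid_braid.
Qed.

(** * Normal forms and reduced words in the Hecke monoid *)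

Section Hecke.
Local Open Scope group_scope.
Variable r : nat.
Local Notation simple := (simple_index r).
Local Notation s := (s_ r).
Local Notation "t ~~ u" := (hecke_eq r t u) (at level 70).

Lemma hecke_catl t u u' : u ~~ u' -> t ++ u ~~ t ++ u'.
Proof. by apply: hecke_cat; apply: hecke_refl. Qed.

Lemma hecke_catr t t' u : t ~~ t' -> t ++ u ~~ t' ++ u.
Proof. by move=> h; apply: hecke_cat => //; apply: hecke_refl. Qed.

(** A letter meeting the last descending run n, ..., n+1-m commutes with it if i < n-m, extends it
    if i = n-m, is absorbed if i = n+1-m, and otherwise crosses it as i-1. What crosses is below n
    and falls to the induction. *)
Lemma normal_word_rcons n u i : (n <= r)%N -> normal_word n u -> (0 < i < n)%N ->
  exists2 u', normal_word n u' & u ++ [:: i] ~~ u'.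
Proof.
move=> nr h; elim: h i nr => {n u} [|n u m h IH mn] i nr; first by lia.
have n0 := normal_word_gt0 h; set c := rev _; rewrite -catA => hi.
have pass j : (0 < j < n)%N -> c ++ [:: i] ~~ [:: j] ++ c ->
    exists2 u', normal_word n.+1 u' & u ++ c ++ [:: i] ~~ u'.
  move=> hj hc; have [|u' h' e'] := IH j _ hj; first by lia.
  exists (u' ++ c); first exact: normal_word_succ.
  apply: hecke_trans (hecke_catl u hc) _.
  by rewrite catA; apply: hecke_catr.
have [lt|ge] := ltnP i (n - m).
  apply: (pass i); first by lia.
  apply: hecke_sym; apply: braid_hecke; apply: braid_far.
  - by rewrite /simple_index; lia.
  - by rewrite all_rev; apply: all_simple_iota; lia.
  - by rewrite all_rev; apply/allP => j; rewrite mem_iota /far; lia.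
have [e|ne] := eqVneq i (n - m)%N.
  exists (u ++ rev (iota (n.+1 - m.+1) m.+1)); first by apply: normal_word_succ => //; lia.
  rewrite subSS /= rev_cons -cats1 -e (_ : i.+1 = (n.+1 - m)%N); last by rewrite e; lia.
  exact: hecke_refl.
have [e|ne'] := eqVneq i (n.+1 - m)%N.
  exists (u ++ c); first exact: normal_word_succ.
  apply: hecke_catl; rewrite /c; case: m mn e {c pass ge ne} => [|m] mn e; first by lia.
  rewrite /= rev_cons -cats1 -catA -e; apply: hecke_catl.
  by apply: hecke_idem; rewrite /simple_index; lia.
apply: (pass i.-1); first by lia.
have := @braid_through_block n.+1 (n.+1 - m) i.-1.
rewrite (_ : (n.+1 - (n.+1 - m) = m)%N); last by lia.
case: i hi ge ne ne' {pass} => // i hi ge ne ne' /= hb.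
have : braid_eq n.+1 (i.+1 :: iota (n.+1 - m) m) (iota (n.+1 - m) m ++ [:: i]).
  by apply: hb; lia.
move/braid_rev; rewrite rev_cons -cats1 rev_cat /= -/c => hb'.
by apply: braid_hecke; apply: braid_widen hb'.
Qed.

Lemma word_normal_word t : all simple t -> (0 < r)%N -> exists2 u, normal_word r u & t ~~ u.
Proof.
move=> + r0; elim/last_ind: t => [|t i IH].
  by move=> _; exists [::]; [apply: normal_word_nil|apply: hecke_refl].
rewrite all_rcons => /andP[hi /IH[u hu e]].
have [u' hu' e'] := normal_word_rcons (leqnn r) hu hi.
exists u' => //; rewrite -cats1; apply: hecke_trans e'.
exact: hecke_catr.
Qed.

(** After m letters of the run, position n holds the value n-m. The value n-m-1 then lies further
    left, so the next letter creates an inversion. *)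
Lemma normal_word_reduced n u : (n <= r)%N -> normal_word n u ->
  [/\ all simple u, size u = len (word_prod r u) &
      forall p, (n <= p)%N -> nat_perm (word_prod r u) p = p].
Proof.
move=> + h; elim: h => {n u} [|n u m h IH mn] nr.
  rewrite /word_prod big_nil; split=> // [|p _]; last by rewrite nat_perm1.
  by have := @len_demazure_prod r [::] isT; rewrite /=; case: (len _).
have [|hu su fu] := IH; first by lia.
have n0 := normal_word_gt0 h.
suff [h1 h2 h3 h4] : let w := word_prod r (u ++ rev (iota (n.+1 - m) m)) in
  [/\ all simple (rev (iota (n.+1 - m) m)),
      (size u + m = len w)%N, nat_perm w n = (n - m)%N & forall p, (n < p)%N -> nat_perm w p = p].
  by split=> //; rewrite ?all_cat ?hu // size_cat size_rev size_iota.
elim: m mn => [|m IHm] mn /=.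
  by rewrite cats0 addn0 subn0 fu //; split=> // p hp; apply: fu; lia.
have [|h1 h2 h3 h4] := IHm; first by lia.
rewrite subSS (_ : (n - m).+1 = (n.+1 - m)%N); last by lia.
have hi : simple (n - m)%N by rewrite /simple_index; lia.
rewrite rev_cons -cats1 catA word_prod_cat [word_prod r [:: _]]/word_prod big_seq1.
set w := word_prod r (u ++ _) in h2 h3 h4 *; set i := (n - m)%N in hi h3 *.
split.
- by rewrite all_cat h1 /= hi.
- rewrite -lenV invMg sV // len_ascent ?lenV // ?addnS -?h2 //.
  rewrite /ascent -[in X in (_ < X)%N]h3 nat_permK.
  have e := nat_permVK w i.-1; set q := nat_perm w^-1 i.-1 in e *.
  have [//|qn|eq] := ltngtP q n; first by have := h4 q qn; case/andP: hi; lia.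
  by move: e; rewrite eq h3; case/andP: hi; lia.
- by rewrite nat_permM h3 nat_perm_s // /nat_swap; case: eqP => ?; rewrite ?eqxx; lia.
- by move=> p hp; rewrite nat_permM h4 // nat_perm_s // /nat_swap !ifF //; lia.
Qed.

Lemma hecke_reduced t : all simple t -> (0 < r)%N ->
  exists2 u, reduced_word (demazure_prod r t) u & t ~~ u.
Proof.
move=> ht r0; have [u hu e] := word_normal_word ht r0; exists u => //.
have [h1 h2 _] := normal_word_reduced (leqnn r) hu.
have ru : reduced_word (word_prod r u) u by rewrite /reduced_word h1 h2 !eqxx.
by rewrite (_ : demazure_prod r t = word_prod r u) // -(reduced_demazure_prod ru);
  apply: hecke_act_up.
Qed.

(** Normal words supply a reduced word in the class of t; the action on the identity shows that its
    permutation is unique. *)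
Lemma hecke_permE t : all simple t -> (0 < r)%N -> hecke_perm r t = demazure_prod r t.
Proof.
move=> ht r0; have [u ru e] := hecke_reduced ht r0.
rewrite /hecke_perm; case: xgetP => [w _ [u' ru' e']|/(_ (demazure_prod r t))[]].
  by rewrite -(reduced_demazure_prod ru') /demazure_prod (hecke_act_up _ e').
by exists u.
Qed.

Lemma word_prod_rev t : all simple t -> word_prod r (rev t) = (word_prod r t)^-1.
Proof.
elim: t => [|i t IH] /=; first by rewrite /word_prod big_nil invg1.
case/andP=> hi /IH {}IH; rewrite rev_cons -cats1 word_prod_cat IH [in RHS]word_prod_cons invMg.
by rewrite [word_prod r [:: i]]/word_prod big_seq1 sV.
Qed.

Lemma reduced_rev (w : 'S_r) t : reduced_word w t -> reduced_word w^-1 (rev t).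
Proof.
case/and3P=> h1 /eqP h2 /eqP h3; apply/and3P; split; first by rewrite all_rev.
  by rewrite word_prod_rev // h2.
by rewrite size_rev lenV h3.
Qed.

Lemma demazure_prod_rev t : all simple t -> (0 < r)%N ->
  demazure_prod r (rev t) = (demazure_prod r t)^-1.
Proof.
move=> ht r0; have [u ru e] := hecke_reduced ht r0.
by rewrite -(reduced_demazure_prod (reduced_rev ru)) /demazure_prod (hecke_act_up _ (hecke_rev e)).
Qed.

End Hecke.

(** * Bruhat order *)

Section Bruhat.
Local Open Scope group_scope.
Variable r : nat.
Implicit Types (w x y z : 'S_r) (a b : 'I_r).
Local Notation simple := (simple_index r).
Local Notation s := (s_ r).

Lemma mul_tperm x a b : x * tperm a b = tperm (x^-1 a) (x^-1 b) * x.
Proof.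
have -> : tperm a b = tperm (x^-1 a) (x^-1 b) ^ x by rewrite tpermJ !permKV.
by rewrite conjgE mulVKg.
Qed.

(* Inversions of x that x * tperm a b destroys are sent to new ones by swapping the two
  positions. *)
Lemma len_tperm x a b : (a < b)%N -> (x^-1 a < x^-1 b)%N -> (len x < len (x * tperm a b))%N.
Proof.
move=> ab; set p := x^-1 a; set q := x^-1 b => pq; rewrite mul_tperm -/p -/q.
have xp : x p = a by rewrite permKV.
have xq : x q = b by rewrite permKV.
clearbody p q.
set y := tperm p q * x; set t := tperm p q.
have yE u : y u = x (t u) by rewrite permM.
have tE (u : 'I_r) : t u = (if u == p :> nat then q : nat else if u == q :> nat then p : nat else
  u) :> nat.
  rewrite /t; case: tpermP => [->|->|n1 n2]; rewrite ?eqxx //; first by case: eqP.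
  by do 2!case: eqP => [/ord_inj //|_].
have tE2 (u : 'I_r) : nat_perm t u = _ := etrans (nat_perm_ord t u) (tE u).
have tt u : t (t u) = u by rewrite tpermK.
pose f (z : 'I_r * 'I_r) := if z \in inv_set y then z else (t z.1, t z.2).
rewrite /len -!/(inv_set _) -(@card_in_imset _ _ f) => [|z z' hz hz' e]; last first.
  move: e; rewrite /f; case: ifP => h; case: ifP => h' //.
  - move=> e; move: hz h'; rewrite e !inE /= !yE => /andP[_ ->].
    by move: hz'; rewrite inE => /andP[-> _].
  - move=> e; move: hz' h; rewrite -e !inE /= !yE => /andP[_ ->].
    by move: hz; rewrite inE => /andP[-> _].
  - by case: z z' {hz hz' h h'} => u v [u' v'] /= [/perm_inj -> /perm_inj ->].
have pqy : (p, q) \in inv_set y by rewrite inE /= pq !yE /t tpermL tpermR xp xq.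
rewrite (cardsD1 (p, q) (inv_set y)) pqy ltnS; apply: subset_leq_card.
apply/fintype.subsetP => _ /imsetP[[u v] huv ->]; rewrite in_setD1.
move: (huv); rewrite inE /= => /andP[uv xuv]; rewrite /f; case: ifP => h.
  rewrite h andbT xpair_eqE; apply/negP => /andP[/eqP eu /eqP ev].
  by move: xuv; rewrite eu ev xp xq; lia.
rewrite [in X in _ && X]inE /= !yE !tt xuv andbT xpair_eqE.
move: h; rewrite inE /= uv /= !yE => /negbT; rewrite -leqNgt => nxuv.
have tuv : (t u < t v)%N.
  move: nxuv uv xuv xp xq => + + + /(congr1 (@nat_of_ord r)) + /(congr1 (@nat_of_ord r));
    rewrite -!nat_perm_ord !tE2.
  by do ![case: eqP => [->|?]]; move=> *; lia.
rewrite tuv andbT; apply/negP => /andP[/eqP eu /eqP ev].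
by move: uv; rewrite -(tt u) -(tt v) eu ev /t tpermL tpermR; lia.
Qed.

Lemma bruhat_stepP x y : reflect
  (exists a b, [/\ (a < b)%N, (x^-1 a < x^-1 b)%N & y = x * tperm a b]) (bruhat_step x y).
Proof.
apply: (iffP idP) => [/existsP[a /existsP[b /andP[/eqP ->]]]|[a [b [ab pq ->]]]]; last first.
  by apply/existsP; exists a; apply/existsP; exists b; rewrite eqxx len_tperm.
wlog ab : a b / (a < b)%N => [H|] lt.
  have [ab|ba|ab] := ltngtP a b; first exact: H.
    by rewrite tpermC; apply: H => //; rewrite tpermC.
  by move: lt; rewrite (ord_inj ab) tperm1 mulg1 ltnn.
exists a, b; split=> //; rewrite ltnNge; apply/negP => le.
have ne : (x^-1 b != x^-1 a :> nat).
  by apply/negP => /eqP /ord_inj /perm_inj e; rewrite e ltnn in ab.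
have := @len_tperm (x * tperm a b) a b ab.
rewrite invMg tpermV !permM tpermL tpermR -mulgA tperm2 mulg1 => h.
have /h : (x^-1 b < x^-1 a)%N by lia.
by lia.
Qed.

Lemma bruhat_step_len x y : bruhat_step x y -> (len x < len y)%N.
Proof. by case/existsP=> a /existsP[b /andP[]]. Qed.

Lemma bruhat_le_eqVlt x y : bruhat_le x y -> x = y \/ (len x < len y)%N.
Proof.
case/connectP=> p; elim: p x => [|z p IH] x /=; first by move=> _ ->; left.
case/andP=> /bruhat_step_len l1 h e; right.
by have [<-//|] := IH z h e; lia.
Qed.

Lemma bruhat_le_anti x y : bruhat_le x y -> bruhat_le y x -> x = y.
Proof. by move=> /bruhat_le_eqVlt[//|l1] /bruhat_le_eqVlt[//|l2]; lia. Qed.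

Lemma bruhat_le_refl x : bruhat_le x x.
Proof. exact: connect0. Qed.

Lemma bruhat_le_trans y x z : bruhat_le x y -> bruhat_le y z -> bruhat_le x z.
Proof. exact: connect_trans. Qed.

Lemma bruhat_le_hom (f : 'S_r -> 'S_r) :
  (forall x y, bruhat_step x y -> bruhat_le (f x) (f y)) ->
  forall x y, bruhat_le x y -> bruhat_le (f x) (f y).
Proof.
move=> h x y /connectP[p]; elim: p x => [|z p IH] x /=.
  by move=> _ ->; apply: bruhat_le_refl.
by case/andP=> /h h1 hp e; apply: bruhat_le_trans h1 (IH _ hp e).
Qed.

Lemma bruhat_step_s i x : simple i -> ascent i x -> bruhat_step x (s i * x).
Proof.
move=> hi u; have /andP[i0 ir] := hi; have ir' : (i.-1 < r)%N by lia.
apply/existsP; exists (x (Ordinal ir')); apply/existsP; exists (x (Ordinal ir)).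
rewrite len_ascent // ltnSn andbT mul_tperm !permK; apply/eqP; congr (_ * _).
by rewrite /s_ !insubT.
Qed.

Lemma bruhat_le_s i x : simple i -> ascent i x -> bruhat_le x (s i * x).
Proof. by move=> hi u; apply: connect1; apply: bruhat_step_s. Qed.

Lemma bruhat_s_le i x : simple i -> ~~ ascent i x -> bruhat_le (s i * x) x.
Proof. by move=> hi; rewrite -ascent_s // => /(bruhat_le_s hi); rewrite sK. Qed.

Lemma bruhat_ltP i w : simple i -> bruhat_lt w (s i * w) = ascent i w.
Proof.
move=> hi; apply/idP/idP => [/andP[ne /bruhat_le_eqVlt[e|lt]]|u].
- by rewrite -e eqxx in ne.
- by apply/negPn/negP => /(len_down hi); lia.
rewrite /bruhat_lt bruhat_le_s // andbT; apply/eqP => e.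
by have := len_ascent hi u; rewrite -e; lia.
Qed.

(** Exchanging the positions i-1 and i keeps the order of the two positions involved in the step,
    unless they are i-1 and i themselves, where y = s_i x. *)
Lemma bruhat_step_mul i x y : simple i -> bruhat_step x y ->
  y = s i * x \/ bruhat_step (s i * x) (s i * y).
Proof.
move=> hi /bruhat_stepP[a [b [ab pq e]]]; have i0 : (0 < i)%N by case/andP: hi.
have [/andP[/eqP ea /eqP eb]|h1] :=
    boolP ((x^-1 a == i.-1 :> nat) && (x^-1 b == i :> nat)).
  left; rewrite e mul_tperm; congr (_ * _); rewrite /s_ -ea -eb !valK //.
right; apply/bruhat_stepP; exists a, b; split=> //; last by rewrite e mulgA.
rewrite invMg sV // !permM -!nat_perm_ord !nat_perm_s // !nat_perm_ord nat_swap_ltn //.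
apply/negP => /andP[/eqP ea /eqP eb]; move: pq; rewrite ea eb; lia.
Qed.

(** The lifting property: the larger of w and s_i w depends monotonically on w, and likewise the
    smaller one in [bruhat_le_act_down]. *)
Lemma bruhat_le_act_up i x y : simple i -> bruhat_le x y -> bruhat_le (act_up i x) (act_up i y).
Proof.
move=> hi; apply: bruhat_le_hom => {}x {}y h; rewrite /act_up.
have [e|h'] := bruhat_step_mul hi h.
  have u : ascent i x.
    by apply/negPn/negP => /(len_down hi); have := bruhat_step_len h; rewrite e; lia.
  by rewrite u e ascent_s // u; apply: bruhat_le_refl.
have [ux|ux] := boolP (ascent i x); have [uy|uy] := boolP (ascent i y).
- exact: connect1.
- by apply: bruhat_le_trans (connect1 h') (bruhat_s_le _ _).
- by apply: bruhat_le_trans (connect1 h) (bruhat_le_s _ _).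
- exact: connect1.
Qed.

Lemma bruhat_le_act_down i x y : simple i -> bruhat_le x y -> bruhat_le (act_down i x) (act_down
  i y).
Proof.
move=> hi; apply: bruhat_le_hom => {}x {}y h; rewrite /act_down.
have [e|h'] := bruhat_step_mul hi h.
  have u : ascent i x.
    by apply/negPn/negP => /(len_down hi); have := bruhat_step_len h; rewrite e; lia.
  by rewrite u e ascent_s // u sK //; apply: bruhat_le_refl.
have [ux|ux] := boolP (ascent i x); have [uy|uy] := boolP (ascent i y).
- exact: connect1.
- by apply: bruhat_le_trans (bruhat_le_s hi ux) (connect1 h').
- by apply: bruhat_le_trans (bruhat_s_le hi ux) (connect1 h).
- exact: connect1.
Qed.

Lemma bruhat_leV x y : bruhat_le x y -> bruhat_le x^-1 y^-1.
Proof.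
apply: bruhat_le_hom => {}x {}y /existsP[a /existsP[b /andP[/eqP e lt]]].
apply: connect1; apply/existsP; exists (x^-1 a); apply/existsP; exists (x^-1 b).
by rewrite !lenV lt andbT e mul_tperm invMg tpermV.
Qed.

Lemma len1 : len (1 : 'S_r) = 0%N.
Proof. by apply/eqP; rewrite -leqn0; apply: (@len_demazure_prod r [::]). Qed.

Lemma len_w0 w : (len w <= len (w0 r))%N.
Proof. by rewrite /w0; case: arg_maxnP => // i _; apply. Qed.

Lemma down_w0 i : simple i -> ~~ ascent i (w0 r).
Proof. by move=> hi; apply/negP => u; have := len_w0 (s i * w0 r); rewrite len_ascent //; lia. Qed.

Lemma down_nat_perm w : (forall i, simple i -> ~~ ascent i w) ->
  forall n, (n < r)%N -> nat_perm w n = (r.-1 - n)%N.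
Proof.
move=> h; have dec n : (n.+1 < r)%N -> (nat_perm w n.+1 < nat_perm w n)%N.
  move=> nr; have := h n.+1; rewrite /ascent /= => /(_ _); rewrite /simple_index.
  by have : nat_perm w n <> nat_perm w n.+1 by [move/nat_perm_inj; lia]; lia.
have le n : (n < r)%N -> (nat_perm w n + n <= r.-1)%N.
  elim: n => [|n IH] nr; first by have := nat_perm_lt w nr; lia.
  by have := dec n nr; have := IH _; lia.
have ge m : (m < r)%N -> (m <= nat_perm w (r.-1 - m))%N.
  elim: m => // m IH mr; have := dec (r.-1 - m.+1)%N.
  by rewrite (_ : (r.-1 - m.+1).+1 = r.-1 - m)%N; [have := IH _; lia|lia].
move=> n nr; have := le n nr; have := ge (r.-1 - n)%N.
by rewrite (_ : r.-1 - (r.-1 - n) = n)%N; lia.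
Qed.

Lemma nat_perm_w0 n : (n < r)%N -> nat_perm (w0 r) n = (r.-1 - n)%N.
Proof. by apply: down_nat_perm => i; apply: down_w0. Qed.

Lemma down_eq_w0 w : (forall i, simple i -> ~~ ascent i w) -> w = w0 r.
Proof. by move=> h; apply: nat_perm_ext => n nr; rewrite nat_perm_w0 // down_nat_perm. Qed.

Lemma w0K : w0 r * w0 r = 1.
Proof. by apply: nat_perm_ext => n nr; rewrite nat_permM nat_perm1 !nat_perm_w0 ?nat_perm_w0 //;
  lia. Qed.

Lemma mul_w0K w : w * w0 r * w0 r = w.
Proof. by rewrite -mulgA w0K mulg1. Qed.

Lemma ascent_mul_w0 i w : simple i -> ascent i (w * w0 r) = ~~ ascent i w.
Proof.
move=> hi; have /andP[i0 ir] := hi; have ir' : (i.-1 < r)%N by lia.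
rewrite /ascent !nat_permM !nat_perm_w0 ?nat_perm_lt //.
have := nat_perm_lt w ir; have := nat_perm_lt w ir'.
have : nat_perm w i.-1 <> nat_perm w i by move/nat_perm_inj; lia.
by lia.
Qed.

Lemma ascent_all_eq1 w : (forall i, simple i -> ascent i w) -> w = 1.
Proof.
move=> h; have e : w * w0 r = w0 r.
  by apply: down_eq_w0 => i hi; rewrite ascent_mul_w0 // h.
by rewrite -(mul_w0K w) e w0K.
Qed.

Lemma exists_down w : w <> 1 -> exists2 i, simple i & ~~ ascent i w.
Proof.
move=> ne; have [/existsP[k /andP[hk u]]|] := boolP [exists k : 'I_r, simple k && ~~ ascent k w].
  by exists (nat_of_ord k).
rewrite negb_exists => /forallP h; case: ne; apply: ascent_all_eq1 => i hi.
have ir : (i < r)%N by case/andP: hi.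
by have := h (Ordinal ir); rewrite /= hi negbK.
Qed.

Lemma exists_reduced w : exists t, reduced_word w t.
Proof.
have [n] := ubnP (len w); elim: n w => // n IH w hn.
have [->|/eqP ne] := eqVneq w 1.
  by exists [::]; rewrite /reduced_word /word_prod big_nil eqxx len1.
have [i hi d] := exists_down ne; have [|t ht] := IH (s i * w).
  by have := len_down hi d; lia.
exists (i :: t); rewrite -(sK w hi); apply: reduced_cons => //.
by rewrite ascent_s // d.
Qed.

End Bruhat.

(** * The word of omega_dag under e_k *)

Section DagWord.
Variable r : nat.
Local Notation simple := (simple_index r).
Local Notation "t ~~ u" := (hecke_eq r t u) (at level 70).
Implicit Type d : nat -> nat -> int.

(** This is Omega_(r-a): row a is block r-a, and a zero of c in column b gives the letter j with
    a-1+j = b. *)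
Definition row_word d a : seq nat :=
  [seq (b.+1 - a)%N | b <- iota a (r - a) & d a b == d a b.+1].

Definition tail_word d a m : seq nat := flatten [seq row_word d a' | a' <- iota a m].

Definition dag_word d : seq nat := tail_word d 1 r.-1.

Definition flag d a b : seq nat := if d a b == d a b.+1 then [:: (b.+1 - a)%N] else [::].

Lemma simple_row_word d a : (0 < a)%N -> all simple (row_word d a).
Proof.
move=> a0; apply/allP => j /mapP[b]; rewrite mem_filter mem_iota /simple_index => hb ->.
by lia.
Qed.

Lemma simple_tail_word d a m : (0 < a)%N -> all simple (tail_word d a m).
Proof.
move=> a0; apply/allP => j /flattenP[s /mapP[a' ha' ->]].
by apply: (allP (simple_row_word d _)); move: ha'; rewrite mem_iota; lia.
Qed.

Lemma simple_dag_word d : all simple (dag_word d).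
Proof. exact: simple_tail_word. Qed.

Lemma row_word_ext d d' a : (forall b, (a <= b <= r)%N -> d a b = d' a b) ->
  row_word d a = row_word d' a.
Proof.
move=> h; rewrite /row_word; congr map; apply/eq_in_filter => b; rewrite mem_iota => hb.
by rewrite !h //; lia.
Qed.

Lemma tail_word_ext d d' a m :
  (forall a' b, (a <= a' < a + m)%N -> (a' <= b <= r)%N -> d a' b = d' a' b) ->
  tail_word d a m = tail_word d' a m.
Proof.
move=> h; congr flatten; apply/eq_in_map => a'; rewrite mem_iota => ha.
by apply: row_word_ext => b; apply: h.
Qed.

Lemma tail_word_cat d a m n : tail_word d a (m + n) = tail_word d a m ++ tail_word d (a + m) n.
Proof. by rewrite /tail_word iotaD map_cat flatten_cat. Qed.

Lemma tail_wordS d a m : tail_word d a m.+1 = row_word d a ++ tail_word d a.+1 m.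
Proof. by []. Qed.

(** * Moving a letter through the columns k-1 and k *)

Section Column.
Variable k : nat.
Hypothesis hk0 : simple k.

(** The columns below k-1 and above k of row a. The letter k+1-a of column k commutes with the
    former, the letter k-a of column k-1 with the latter. *)
Definition left_word d a : seq nat :=
  [seq (b.+1 - a)%N | b <- iota a (k.-1 - a) & d a b == d a b.+1].
Definition right_word d a : seq nat :=
  [seq (b.+1 - a)%N | b <- iota k.+1 (r - k.+1) & d a b == d a b.+1].

Lemma row_word_split d a : (0 < a < k)%N ->
  row_word d a = left_word d a ++ flag d a k.-1 ++ flag d a k ++ right_word d a.
Proof.
move=> ha; case/andP: hk0 => k0 kr; have k1 : k.-1.+1 = k by lia.
rewrite /row_word (@iota_split r a k.-1) ?k1 //; last by lia.
rewrite !filter_cat !map_cat /= k1; congr (_ ++ _); rewrite /flag k1.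
by case: ifP => _; case: ifP => _ /=; rewrite ?k1.
Qed.

Lemma row_word_diag d : row_word d k = flag d k k ++ right_word d k.
Proof.
case/andP: hk0 => k0 kr; rewrite /row_word (_ : (r - k = (r - k.+1).+1)%N) /=; last by lia.
by rewrite /flag; case: ifP.
Qed.

Lemma pass_left d a : (0 < a < k)%N ->
  (k.+1 - a)%N :: left_word d a ~~ left_word d a ++ [:: (k.+1 - a)%N].
Proof.
move=> ha; have := hk0; rewrite /simple_index => hk.
apply: braid_hecke; apply: braid_far; first by rewrite /simple_index; lia.
  by apply/allP => j /mapP[b]; rewrite mem_filter mem_iota /simple_index => ? ->; lia.
by apply/allP => j /mapP[b]; rewrite mem_filter mem_iota /far => ? ->; lia.
Qed.

Lemma pass_right d a : (0 < a < k)%N ->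
  (k - a)%N :: right_word d a ~~ right_word d a ++ [:: (k - a)%N].
Proof.
move=> ha; have := hk0; rewrite /simple_index => hk.
apply: braid_hecke; apply: braid_far; first by rewrite /simple_index; lia.
  by apply/allP => j /mapP[b]; rewrite mem_filter mem_iota /simple_index => ? ->; lia.
by apply/allP => j /mapP[b]; rewrite mem_filter mem_iota /far => ? ->; lia.
Qed.

Lemma idem_letter a : (0 < a <= k)%N -> [:: (k.+1 - a)%N; (k.+1 - a)%N] ~~ [:: (k.+1 - a)%N].
Proof. by move=> ha; apply: hecke_idem; move: hk0; rewrite /simple_index; lia. Qed.

Lemma braid_letter a : (0 < a < k)%N ->
  [:: (k.+1 - a)%N; (k - a)%N; (k.+1 - a)%N] ~~ [:: (k - a)%N; (k.+1 - a)%N; (k - a)%N].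
Proof.
move=> ha; rewrite (_ : (k.+1 - a = (k - a).+1)%N); last by lia.
by apply: hecke_sym; apply: hecke_braid; move: hk0; rewrite /simple_index; lia.
Qed.

Local Open Scope ring_scope.

Variable d : nat -> nat -> int.
Hypotheses (d0 : closed_at r d) (cd : cone r d).

Local Notation H := (row_eps r d k).

Lemma flag_prev a : (0 < a < k)%N -> flag d a k.-1 =
  if d a k.-1 - d a k == 0 then [:: (k - a)%N] else [::].
Proof. by move=> ha; rewrite /flag subr_eq0 (_ : k.-1.+1 = k) //; lia. Qed.

Lemma flag_eq a : d a k = d a k.+1 -> flag d a k = [:: (k.+1 - a)%N].
Proof. by rewrite /flag => ->; rewrite eqxx. Qed.

Lemma flag_lt a : d a k.+1 < d a k -> flag d a k = [::].
Proof. by rewrite /flag => h; rewrite ifF //; lia. Qed.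

(* A letter entering from the left passes the rows where both letters of columns k-1, k
   are present and is absorbed in the first row where only the second one is. *)
Lemma absorb_tail a : (0 < a <= k)%N ->
  (forall b, (a <= b <= k)%N -> H b - H a + (d a k - d a k.+1) <= 0) ->
  (k.+1 - a)%N :: tail_word d a (r - a) ~~ tail_word d a (r - a).
Proof.
move: {2}(k - a)%N (erefl (k - a)%N) => n; elim: n a => [|n IH] a en ha cnd.
  have ak : a = k by lia.
  have kr : (k < r)%N by case/andP: hk0.
  rewrite {}ak in ha cnd *; rewrite (_ : (r - k = 1 + (r - k.+1))%N); last by lia.
  rewrite tail_word_cat {1 3}/tail_word /= cats0 row_word_diag flag_eq; last first.
    by have := cnd k; have := cd (a := k) (b := k); lia.
  rewrite -!catA /=; apply: (@hecke_catr r [:: _; _] [:: _]).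
  by apply: idem_letter; lia.
have kr : (k < r)%N by case/andP: hk0.
rewrite (_ : (r - a = 1 + (r - a.+1))%N); last by lia.
rewrite tail_word_cat addn1; set T := tail_word d a.+1 _.
rewrite /tail_word /= cats0 row_word_split; last by lia.
have ya : d a k = d a k.+1 by have := cnd a; have := cd (a := a) (b := k); lia.
rewrite flag_prev ?(flag_eq ya); last by lia.
have pl : (0 < a < k)%N by lia.
rewrite -!catA -cat_cons.
apply: hecke_trans (hecke_catr _ (pass_left d pl)) _; rewrite -catA.
apply: hecke_catl; case: ifP => [/eqP xa|_]; last first.
  by rewrite /=; apply: (@hecke_catr r [:: _; _] [:: _]); apply: idem_letter.
rewrite /=; apply: hecke_trans (@hecke_catr r [:: _; _; _] [:: _; _; _] _ (braid_letter pl)) _.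
rewrite /=; apply: (@hecke_catl r [:: _; _]).
rewrite -cat_cons; apply: hecke_trans (hecke_catr _ (pass_right d pl)) _; rewrite -catA.
apply: hecke_catl; rewrite -[(k - a)%N]subSS; apply: IH; try lia.
by move=> b hb; have := row_epsS d0 hk0 pl; have := cnd b; lia.
Qed.

(** The mirror image of [absorb_tail]: the letter moves left through rows with both letters of
    columns k-1 and k and is absorbed where only the first is present, or at last by the leading k.
    By [row_epsS] the bound on H forces the letter of column k-1 in each row it reaches. *)
Lemma absorb_head a : (0 < a <= k)%N ->
  (forall b, (0 < b < a)%N -> H b <= H a - (d a k - d a k.+1)) ->
  k :: tail_word d 1 a.-1 ++ [:: (k.+1 - a)%N] ~~ k :: tail_word d 1 a.-1.
Proof.
elim: a => // -[|a] IH ha cnd.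
  by rewrite /tail_word /= subSS subn0; apply: hecke_idem.
have pl : (0 < a.+1 < k)%N by lia.
have hS := row_epsS d0 hk0 pl.
have xa : d a.+1 k.-1 - d a.+1 k = 0.
  have := cnd a.+1; have := cd (a := a.+1) (b := k.-1).
  by rewrite (_ : k.-1.+1 = k); move: hk0; rewrite /simple_index; lia.
have E : tail_word d 1 a.+1 = tail_word d 1 a ++ row_word d a.+1.
  by rewrite -{1}(addn1 a) tail_word_cat add1n {2}/tail_word /= cats0.
rewrite [a.+2.-1]/= E (row_word_split d pl).
rewrite flag_prev // xa eqxx /= subSS -!catA.
have : d a.+1 k.+1 <= d a.+1 k by apply: cd; [lia|case/andP: hk0].
rewrite le_eqVlt => /orP[/eqP ya|ya].
- rewrite flag_eq // /=.
  have step : left_word d a.+1 ++ [:: (k - a.+1)%N, (k.+1 - a.+1)%N & right_word d a.+1] ++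
      [:: (k - a.+1)%N] ~~ (k.+1 - a.+1)%N :: left_word d a.+1 ++
      [:: (k - a.+1)%N, (k.+1 - a.+1)%N & right_word d a.+1].
    rewrite -cat_cons.
    apply: hecke_trans (hecke_sym (hecke_catr _ (pass_left d pl))).
    rewrite -catA /=; apply: hecke_catl.
    apply: hecke_trans (@hecke_catl r [:: _; _] _ _ (hecke_sym (pass_right d pl))) _ => /=.
    exact: (@hecke_catr r [:: _; _; _] [:: _; _; _] _ (hecke_sym (braid_letter pl))).
  have := hecke_catl (k :: tail_word d 1 a) step => /= e.
  apply: hecke_trans e _; set Y := left_word _ _ ++ _.
  have IH' : k :: tail_word d 1 a ++ [:: (k.+1 - a.+1)%N] ~~ k :: tail_word d 1 a.
    by apply: IH; [lia|move=> b hb; have := cnd b; lia].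
  by have := hecke_catr Y IH'; rewrite /= -catA.
rewrite flag_lt // /= -cat_cons; apply: hecke_catl; apply: hecke_catl.
apply: hecke_trans (@hecke_catl r [:: _] _ _ (hecke_sym (pass_right d pl))) _ => /=.
apply: (@hecke_catr r [:: _; _] [:: _]).
by apply: hecke_idem; move: hk0; rewrite /simple_index; lia.
Qed.

Lemma dag_word_eps0 : term_eps k (rows r d r.-1) = Some 0 -> k :: dag_word d ~~ dag_word d.
Proof.
have k0 : (0 < k)%N by case/andP: hk0.
have [a [ha -> _ lt gt]] := term_e_rows d0 hk0 => - [e0].
have le b : (0 < b <= k)%N -> H b <= 0.
  move=> hb; have [h|h|->] := ltngtP b a; last by rewrite e0.
    by have := lt b; lia.
  by have := gt b; lia.
have := @absorb_tail 1; rewrite subSS subn0 /dag_word (_ : (r - 1 = r.-1)%N); last by lia.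
apply; first by lia.
by move=> b hb; rewrite row_eps1; have := le b; lia.
Qed.

(** Lowering [d a k] can only remove the letter k-a of column k-1 and create the letter k+1-a of
    column k in row a. The former is absorbed by the rows after a, the latter by the rows before a
    together with the leading k. *)
Lemma dag_word_term_e a : (0 < a <= k)%N -> d a k.+1 < d a k ->
  (forall b, (0 < b < a)%N -> H b < H a) -> (forall b, (a < b <= k)%N -> H b <= H a) ->
  k :: dag_word d ~~ k :: dag_word (upd d a k (-1)).
Proof.
move=> ha ya lt gt; set d' := upd d a k (-1).
have kr : (k < r)%N by case/andP: hk0.
have split e : dag_word e = tail_word e 1 a.-1 ++ row_word e a ++ tail_word e a.+1 (r - a.+1).
  rewrite /dag_word (_ : (r.-1 = a.-1 + (1 + (r - a.+1)))%N); last by lia.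
  rewrite !tail_word_cat addn1 (_ : (1 + a.-1 = a)%N); last by lia.
  by congr (_ ++ (_ ++ _)); rewrite /tail_word /= cats0.
have head : tail_word d' 1 a.-1 = tail_word d 1 a.-1.
  by apply: tail_word_ext => a' b ? _; rewrite /d' upd_ne //; lia.
have tail : tail_word d' a.+1 (r - a.+1) = tail_word d a.+1 (r - a.+1).
  by apply: tail_word_ext => a' b ? _; rewrite /d' upd_ne //; lia.
rewrite !split head tail; set V := tail_word d 1 _; set T := tail_word d _ _.
have d'k b : d' a b = if b == k then d a b - 1 else d a b by rewrite /d' upd_eq.
have right : right_word d' a = right_word d a.
  rewrite /right_word; congr map; apply/eq_in_filter => b; rewrite mem_iota => hb.
  have [b1 b2] : (b == k) = false /\ (b.+1 == k) = false by split; lia.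
  by rewrite !d'k b1 b2.
(* The new letter occurs only if [d a k - d a k.+1] is 1; then H b < H a is the bound required by
   [absorb_head]. *)
have headq : k :: V ++ flag d' a k ~~ k :: V.
  have k2 : (k.+1 == k) = false by lia.
  rewrite /flag !d'k eqxx k2.
  case: eqP => [y1|_]; last by rewrite cats0; apply: hecke_refl.
  by apply: absorb_head => // b hb; have := lt b hb; lia.
have [ak|ne] := eqVneq a k.
  move: headq right; rewrite {}ak /V /T in ha ya * => headq right.
  rewrite !row_word_diag right flag_lt //= -!catA.
  by have := hecke_catr (right_word d k ++ tail_word d a.+1 (r - a.+1)) headq;
    rewrite /= -catA => /hecke_sym.
have pl : (0 < a < k)%N by lia.
rewrite !row_word_split // right flag_lt // flag_prev //.
have left : left_word d' a = left_word d a.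
  rewrite /left_word; congr map; apply/eq_in_filter => b; rewrite mem_iota => hb.
  have [b1 b2] : (b == k) = false /\ (b.+1 == k) = false by split; lia.
  by rewrite !d'k b1 b2.
have -> : flag d' a k.-1 = [::].
  have [kk k1] : k.-1.+1 = k /\ (k.-1 == k) = false by split; lia.
  rewrite /flag !d'k k1 kk eqxx ifF //.
  by have := cd (a := a) (b := k.-1); rewrite kk; lia.
rewrite left /= -!catA; set L := left_word d a; set R := right_word d a.
apply: (@hecke_trans _ _ (k :: V ++ L ++ R ++ T)).
  rewrite -!cat_cons; do 2!apply: hecke_catl; case: ifP => [/eqP xa|_]; last exact: hecke_refl.
  rewrite /= -cat_cons; apply: hecke_trans (hecke_catr _ (pass_right d pl)) _.
  rewrite -catA; apply: hecke_catl; rewrite -[(k - a)%N]subSS /=; apply: absorb_tail; first by lia.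
  (* As no segment [a..k-1] occurs, [row_epsS] turns the condition of [absorb_tail] at a+1 into H b
     <= H a. *)
  by move=> b hb; have := row_epsS d0 hk0 pl; have := gt b; lia.
have passL : L ++ flag d' a k ~~ flag d' a k ++ L.
  rewrite /flag; case: ifP => _; last by rewrite cats0; apply: hecke_refl.
  exact: hecke_sym (pass_left d pl).
apply: hecke_sym; rewrite [L ++ _ ++ _]catA.
apply: hecke_trans (@hecke_catl r (k :: V) _ _ (hecke_catr _ passL)) _.
rewrite -catA catA cat_cons.
exact: (@hecke_catr r (k :: V ++ _) (k :: V)).
Qed.

End Column.

Lemma dag_word_rows d d' : closed_at r d -> closed_at r d' ->
  rows r d r.-1 = rows r d' r.-1 -> dag_word d = dag_word d'.
Proof.
move=> d0 d0' /rows_inj h; apply: tail_word_ext => a b ha /andP[ab].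
rewrite leq_eqVlt => /orP[/eqP ->|br]; first by rewrite d0 d0'.
by apply: h; lia.
Qed.

(** * Words of maximal length *)

Fixpoint full_word n : seq nat := if n is n'.+1 then iota 1 n ++ full_word n' else [::].

Lemma normal_word_full_word n : normal_word n.+1 (rev (full_word n)).
Proof.
elim: n => [|n IH]; first exact: normal_word_one.
rewrite (_ : full_word n.+1 = iota 1 n.+1 ++ full_word n) // rev_cat.
have := normal_word_succ IH (leqnn n.+1); by rewrite subSnn.
Qed.

(** The reverse of [full_word] is the normal word whose runs all have maximal length, so it is
    reduced. *)
Lemma size_full_word : (0 < r)%N -> (size (full_word r.-1) <= len (w0 r))%N.
Proof.
move=> r0; have := normal_word_full_word r.-1; rewrite prednK // => h.
have [_ sz _] := normal_word_reduced (leqnn r) h.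
by rewrite -size_rev sz; apply: len_w0.
Qed.

Lemma size_row_word d a : (size (row_word d a) <= r - a)%N.
Proof. by rewrite size_map size_filter -[leqRHS](size_iota a); apply: count_size. Qed.

Lemma size_tail_word d n : (n < r)%N -> (size (tail_word d (r - n) n) <= size (full_word n))%N.
Proof.
elim: n => // n IH nr; rewrite tail_wordS size_cat (_ : (r - n.+1).+1 = (r - n)%N); last by lia.
rewrite (_ : full_word n.+1 = iota 1 n.+1 ++ full_word n) // size_cat size_iota.
by have := size_row_word d (r - n.+1); have := IH (ltnW nr); lia.
Qed.

(** Row a has at most r-a letters, so full length forces every c to vanish; the rows are then
    constant with last value 0. *)
Lemma dag_word_full d n : closed_at r d -> (n < r)%N ->
  (size (full_word n) <= size (tail_word d (r - n) n))%N ->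
  forall a b, (r - n <= a)%N -> (a <= b <= r)%N -> (a < r)%N -> d a b = 0%R.
Proof.
move=> d0; elim: n => [|n IH] nr; first by lia.
rewrite tail_wordS size_cat (_ : (r - n.+1).+1 = (r - n)%N); last by lia.
rewrite (_ : full_word n.+1 = iota 1 n.+1 ++ full_word n) // size_cat size_iota => h a b ha hb ar.
have h1 := size_row_word d (r - n.+1); have h2 := @size_tail_word d n (ltnW nr).
have [e|ne] := eqVneq a (r - n.+1)%N; last by apply: IH => //; lia.
have : all (fun b => d a b == d a b.+1) (iota a (r - a)).
  rewrite all_count size_iota; have : (r - a <= size (row_word d a))%N by rewrite e; lia.
  rewrite size_map size_filter => h3; rewrite eqn_leq h3 andbT.
  by rewrite -[leqRHS](size_iota a); apply: count_size.
move/allP => st; case/andP: hb => ab br.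
move: (subnKC br); move: (r - b)%N => m; elim: m => [|m IHm] in b ab br *.
  by rewrite addn0 => ->; rewrite d0.
move=> ebr; have /eqP -> : d a b == d a b.+1 by apply: st; rewrite mem_iota; lia.
by apply: IHm; lia.
Qed.

End DagWord.

(** * Demazure crystals *)

Section Kappa.
Local Open Scope group_scope.
Variable r : nat.
Hypothesis r0 : (0 < r)%N.
Implicit Types (v y : Binf r) (w : 'S_r).
Local Notation u0 := (u_zero r).
Local Notation simple := (simple_index r).
Local Notation s := (s_ r).

Definition dag v : 'S_r := demazure_prod r (dag_word r (dcoords v)).

Lemma act_up_dag_binf_f k v : simple k -> act_up k (dag (binf_f k v)) = act_up k (dag v).
Proof.
move=> hk; set v' := binf_f k v.
have e0 : (0 < binf_eps v' k)%R by rewrite binf_eps_binf_f //; have := binf_eps_ge0 r0 v k; lia.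
have := term_eps_binf_term r0 v' hk; rewrite binf_term_rows // => he.
have [a [ha w [_ ya] lt gt]] := cone_term_e (@dcoords_closed r v') hk (@cone_dcoords _ r0 v') he e0.
have := dag_word_term_e hk (@dcoords_closed r v') (@cone_dcoords _ r0 v') ha ya lt gt.
move/(hecke_act_up 1) => /=; rewrite -/(demazure_prod _ _) -/(dag v') => ->.
congr act_up; rewrite /dag; congr demazure_prod; apply: dag_word_rows.
- exact: (closed_upd (@dcoords_closed r v') hk).
- exact: dcoords_closed.
- by rewrite -w -!binf_term_rows // (cf_binf_term r0 v hk).2 term_fK.
Qed.

Lemma act_up_dag_eps0 k v : simple k -> binf_eps v k = 0%R -> act_up k (dag v) = dag v.
Proof.
move=> hk e0; have := term_eps_binf_term r0 v hk; rewrite binf_term_rows // e0 => he.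
by have := dag_word_eps0 hk (@dcoords_closed r v) (@cone_dcoords _ r0 v) he; move/(hecke_act_up 1).
Qed.

Lemma act_up_dag_iter k n v : simple k -> act_up k (dag (iter n (binf_f k) v)) = act_up k (dag v).
Proof. by move=> hk; elim: n => //= n IH; rewrite act_up_dag_binf_f. Qed.

Lemma iter_binf_f_head k v : simple k ->
  exists n y, v = iter n (binf_f k) y /\ binf_eps y k = 0%R.
Proof.
move=> hk; have [m] := ubnP `|binf_eps v k|%N; elim: m v => // m IH v hm.
have := binf_eps_ge0 r0 v k; rewrite le_eqVlt => /orP[/eqP e|e].
  by exists 0%N, v.
have ev := binf_f_binf_e r0 hk e; have eb := binf_eps_binf_f r0 (binf_e k v) hk.
have [|n [y [ey e0]]] := IH (binf_e k v).
  by have := binf_eps_ge0 r0 (binf_e k v) k; move: hm; rewrite -{1}ev eb; lia.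
by exists n.+1, y; rewrite /= -ey ev.
Qed.

Definition kappa v : 'S_r := dag v * w0 r.

Lemma act_up_id i w : simple i -> (act_up i w == w) = ~~ ascent i w.
Proof.
move=> hi; rewrite /act_up; case: ifP => u; last by rewrite eqxx.
by apply/eqP => e; have := len_ascent hi u; rewrite e; lia.
Qed.

Lemma ascent_kappa_eps0 k v : simple k -> binf_eps v k = 0%R -> ascent k (kappa v).
Proof.
move=> hk e; rewrite /kappa ascent_mul_w0 // -act_up_id //.
by apply/eqP; apply: act_up_dag_eps0.
Qed.

Lemma kappa_iter k n y : simple k -> binf_eps y k = 0%R ->
  kappa (iter n (binf_f k) y) = kappa y \/ kappa (iter n (binf_f k) y) = s k * kappa y.
Proof.
move=> hk e; rewrite /kappa; have := act_up_dag_iter n y hk.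
rewrite (act_up_dag_eps0 hk e) {1}/act_up; case: ifP => _ <-; last by left.
by right; rewrite -mulgA sK.
Qed.

Lemma kappa_head_le k n y : simple k -> binf_eps y k = 0%R ->
  bruhat_le (kappa y) (kappa (iter n (binf_f k) y)).
Proof.
move=> hk e; case: (kappa_iter n hk e) => ->; first exact: bruhat_le_refl.
by apply: bruhat_le_s => //; apply: ascent_kappa_eps0.
Qed.

Lemma kappa_le_head k n y : simple k -> binf_eps y k = 0%R ->
  bruhat_le (kappa (iter n (binf_f k) y)) (act_up k (kappa y)).
Proof.
move=> hk e; rewrite /act_up ascent_kappa_eps0 //.
case: (kappa_iter n hk e) => ->; last exact: bruhat_le_refl.
by apply: bruhat_le_s => //; apply: ascent_kappa_eps0.
Qed.

(** Every S_i is absorbed because epsilon_i(u_0) = 0, and only w_0 has no ascent. *)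
Lemma dag_u0 : dag u0 = w0 r.
Proof.
by apply: down_eq_w0 => i hi; rewrite -act_up_id // act_up_dag_eps0 // binf_eps_u0.
Qed.

Lemma dag_eq_w0 v : dag v = w0 r -> v = u0.
Proof.
move=> e; have l1 := len_demazure_prod (simple_dag_word r (dcoords v)).
rewrite -/(dag v) e in l1; have l2 := size_full_word r0.
have full : (size (full_word r.-1) <= size (tail_word r (dcoords v) (r - r.-1) r.-1))%N.
  by rewrite (_ : (r - r.-1 = 1)%N); [exact: leq_trans l2 l1|lia].
have z := dag_word_full (@dcoords_closed r v) _ full.
apply: binf_term_inj; rewrite binf_term_zero binf_term_rows // zero_term_rows //;
  first exact: dcoords_closed.
move=> a b a0 hb; have [ar|ar] := ltnP a r; first by apply: z; lia.
have -> : b = r by lia.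
exact: dcoords_closed.
Qed.

Lemma e_iter_some k n v y : simple k -> e_iter k n v = Some y -> v = iter n (binf_f k) y.
Proof.
move=> hk; elim: n y => [|n IH] y; first by case.
rewrite /e_iter iterS -/(e_iter k n v); case e: (e_iter k n v) => [x|] //.
rewrite -[obind _ _]/(ce k x) => h; rewrite (IH _ e) iterSr; congr iter.
have [p|p] := boolP (0 < binf_eps x k)%R.
  by move: h; rewrite (ce_binf_term r0 hk p).1 => -[<-]; rewrite binf_f_binf_e.
by rewrite ce_eps0 // in h; have := binf_eps_ge0 r0 x k; lia.
Qed.

Lemma e_iter_iter_binf_f k n y : simple k -> e_iter k n (iter n (binf_f k) y) = Some y.
Proof. by move=> hk; elim: n => // n IH; rewrite iterS e_iter_binf_f. Qed.

Lemma demazure_kappa w v : demazure w v -> bruhat_le (kappa v) w.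
Proof.
elim=> {w v} [|i w v y k hi]; first by rewrite /kappa dag_u0 w0K; apply: bruhat_le_refl.
rewrite bruhat_ltP // => u /(e_iter_some hi) -> _ h.
have [n [x [ex e0]]] := iter_binf_f_head y hi.
rewrite ex -iterD; apply: bruhat_le_trans (kappa_le_head _ hi e0) _.
rewrite (_ : s_ r i * w = act_up i w); last by rewrite /act_up u.
apply: bruhat_le_act_up => //; apply: bruhat_le_trans h.
by rewrite ex; apply: kappa_head_le.
Qed.

(** Strings along one fixed word. For any reduced word of w they fill B_infinity(w):
    [kappa_f_strings] and [f_strings_demazure] close a circle with [demazure_kappa]. *)
Fixpoint f_strings (t : seq nat) v : Prop :=
  if t is i :: t' then exists n y, v = iter n (binf_f i) y /\ f_strings t' y else v = u0.

Lemma reduced_behead w i t : reduced_word w (i :: t) ->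
  [/\ simple i, ascent i (word_prod r t), w = s i * word_prod r t & reduced_word (word_prod r t) t].
Proof.
case/and3P=> /= /andP[hi ht] /eqP <- /eqP; rewrite word_prod_cons => sz.
have le1 := len_word_prod ht.
have u : ascent i (word_prod r t).
  by apply/negPn/negP => d; have := len_down hi d; lia.
split=> //; rewrite /reduced_word ht eqxx /=.
by rewrite len_ascent // in sz; apply/eqP; lia.
Qed.

Lemma kappa_f_strings w t v : reduced_word w t -> bruhat_le (kappa v) w -> f_strings t v.
Proof.
elim: t w v => [|i t IH] w v.
  case/and3P=> _ /eqP <- _; rewrite /word_prod big_nil => h.
  apply: dag_eq_w0; have : kappa v = 1.
    by have [//|] := bruhat_le_eqVlt h; rewrite len1.
  by rewrite /kappa => e; rewrite -(mul_w0K (dag v)) e mul1g.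
case/reduced_behead=> hi u -> ht le; have [n [y [ey e0]]] := iter_binf_f_head v hi.
exists n, y; split=> //; apply: IH ht _.
have h : bruhat_le (kappa y) (s i * word_prod r t).
  by apply: bruhat_le_trans le; rewrite ey; apply: kappa_head_le.
(* [act_down] fixes kappa(y), which has an ascent at i, and strips s_i from the bound. *)
by have := bruhat_le_act_down hi h; rewrite /act_down ascent_kappa_eps0 // ascent_s // u sK.
Qed.

Lemma f_strings_demazure w t v : reduced_word w t -> f_strings t v -> demazure w v.
Proof.
elim: t w v => [|i t IH] w v.
  case/and3P=> _ /eqP <- _; rewrite /word_prod big_nil => ->; exact: demazure_one.
case/reduced_behead=> hi u -> ht [n [y [-> /(IH _ _ ht) h]]].
apply: (demazure_up hi _ _ h (k := n)); first by rewrite bruhat_ltP.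
exact: e_iter_iter_binf_f.
Qed.

Lemma demazureE w v : demazure w v <-> bruhat_le (kappa v) w.
Proof.
split; first exact: demazure_kappa.
have [t ht] := exists_reduced w.
by move/(kappa_f_strings ht); apply: f_strings_demazure.
Qed.

(** * Star-strings and inverse permutations *)

Fixpoint fstar_strings (t : seq nat) v : Prop :=
  if t is i :: t' then exists n y, v = iter n (fstar i) y /\ fstar_strings t' y else v = u0.

Lemma binf_f_fstar_iter1 i k n y : simple i -> simple k ->
  exists n' m', binf_f i (iter n (fstar k) y) = iter n' (fstar k) (iter m' (binf_f i) y).
Proof.
move=> hi hk; elim: n => [|n [n' [m' IH]]]; first by exists 0%N, 1%N.
rewrite iterS; have [e|ne] := eqVneq i k; last first.
  by exists n'.+1, m'; rewrite binf_f_fstar // IH.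
subst k; case: (binf_f_fstar_cases r0 (iter n (fstar i) y) hi) => ->.
  by exists n.+2, 0%N.
by exists n'.+1, m'; rewrite IH.
Qed.

Lemma binf_f_fstar_iter i k m n y : simple i -> simple k ->
  exists n' m', iter m (binf_f i) (iter n (fstar k) y) = iter n' (fstar k) (iter m' (binf_f i) y).
Proof.
move=> hi hk; elim: m => [|m [n1 [m1 IH]]]; first by exists n, 0%N.
rewrite iterS IH; have [n2 [m2 ->]] := binf_f_fstar_iter1 n1 (iter m1 (binf_f i) y) hi hk.
by exists n2, (m2 + m1)%N; rewrite iterD.
Qed.

Lemma iter_binf_f_u0 i m : simple i -> iter m (binf_f i) u0 = iter m (fstar i) u0.
Proof.
move=> hi; elim: m => // m IH; rewrite !iterS IH; apply: jump0 => //.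
rewrite jumpE //; suff -> : e_star_max i (iter m (fstar i) u0) = u0.
  by rewrite binf_phi_u0; have := eps_star_ge0 r0 (iter m (fstar i) u0) hi; lia.
by elim: m {IH} => [|m IH]; [rewrite e_star_max_u0|rewrite iterS e_star_max_fstar].
Qed.

Lemma fstar_strings_rcons t i m y : all simple t -> simple i ->
  fstar_strings t y -> fstar_strings (rcons t i) (iter m (binf_f i) y).
Proof.
move=> + hi; elim: t m y => [|j t IH] m y /=.
  by move=> _ ->; exists m, u0; rewrite iter_binf_f_u0.
move=> /andP[hj ht] [n [x [-> hx]]].
have [n' [m' ->]] := binf_f_fstar_iter m n x hi hj.
by exists n', (iter m' (binf_f i) x); split=> //; apply: IH.
Qed.

(** Each f-string moves right through the star-strings already formed, some of its steps joining
    them, until it reaches u_0, where f_i and f_i^star have the same powers. The last string applied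
    thus becomes the innermost one. *)
Lemma f_strings_fstar t v : all simple t -> f_strings t v -> fstar_strings (rev t) v.
Proof.
elim: t v => //= i t IH v /andP[hi ht] [n [y [-> h]]].
by rewrite rev_cons; apply: fstar_strings_rcons; rewrite ?all_rev //; apply: IH.
Qed.

Lemma star_fstar_strings t v : all simple t -> fstar_strings t v -> f_strings t (star v).
Proof.
elim: t v => [|i t IH] v /=; first by move=> _ ->; rewrite star_u0.
move=> /andP[hi ht] [n [y [-> h]]]; exists n, (star y); split; last exact: IH.
by elim: n => // n e; rewrite !iterS star_fstar // e.
Qed.

Lemma kappa_star_le v : bruhat_le (kappa (star v)) (kappa v)^-1.
Proof.
have [t ht] := exists_reduced (kappa v); have hs : all simple t by case/and3P: ht.
have := kappa_f_strings ht (bruhat_le_refl _) => /(f_strings_fstar hs).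
rewrite -all_rev in hs; move/(star_fstar_strings hs)/(f_strings_demazure (reduced_rev ht)).
by move/demazure_kappa.
Qed.

Lemma kappa_star v : kappa (star v) = (kappa v)^-1.
Proof.
apply: bruhat_le_anti; first exact: kappa_star_le.
by have := bruhat_leV (kappa_star_le (star v)); rewrite starK // invgK.
Qed.

End Kappa.

Lemma rev_iota1 n : rev (iota 1 n) = [seq (n.+1 - a)%N | a <- iota 1 n].
Proof.
elim: n => // n IH; rewrite -[in LHS](addn1 n) iotaD rev_cat IH /= add1n subn1 /=; congr cons.
by rewrite (iotaDl 1 1) -map_comp.
Qed.

(** * The words defining omega and omega_dag *)

Section OmegaWords.
Variable r : nat.
Hypothesis r0 : (0 < r)%N.
Implicit Types v : Binf r.
Local Notation simple := (simple_index r).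

Lemma Omega_row v a : (0 < a < r)%N -> Omega_word v (r - a) = row_word r (dcoords v) a.
Proof.
move=> ha; rewrite /row_word (_ : iota a (r - a) = map (addn a.-1) (iota 1 (r - a))); last first.
  by rewrite -iotaDl addn1 prednK //; lia.
rewrite filter_map -map_comp -[LHS]map_id /Omega_word.
have <- : [seq j <- iota 1 (r - a) | ccoord v (r - a) (r - 1 + j - (r - a)) == 0%R] =
    [seq j <- iota 1 (r - a) | preim (addn a.-1) (fun b => dcoords v a b == dcoords v a b.+1) j].
  apply/eq_in_filter => j; rewrite mem_iota => hj /=.
  rewrite /ccoord /dcoords subr_eq0 (_ : (r - 1 + j - (r - a) = a.-1 + j)%N) //; lia.
by apply/eq_in_map => j; rewrite mem_filter mem_iota => /= hj; lia.
Qed.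

Lemma Omega_words v :
  flatten [seq Omega_word v i | i <- rev (iota 1 r.-1)] = dag_word r (dcoords v).
Proof.
rewrite rev_iota1 prednK // -map_comp /dag_word /tail_word; congr flatten.
by apply/eq_in_map => a; rewrite mem_iota => ha; apply: Omega_row; lia.
Qed.

Lemma omega_dagE v : omega_dag v = dag v.
Proof. by rewrite /omega_dag Omega_words hecke_permE // simple_dag_word. Qed.

Lemma dcoord_star v m p : (0 < p <= m)%N -> (m < r)%N ->
  dcoord v m (r - 1 + p - m) = (beta (star v) m p)%:Z%R.
Proof.
move=> hp mr; rewrite /dcoord ifF; last by lia.
rewrite /beta string_data_star // ?all_simple_Jword // coords_star_string //.
rewrite (_ : (r - 1 + p - m - (r - m) = p.-1)%N); last by lia.
set n := (_ + p.-1)%N; set t := star_string _ _.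
have [h|h] := ltnP n (size t); first by rewrite (nth_map 0%N) // opprK.
by rewrite !nth_default ?size_map ?oppr0.
Qed.

(** For p = m the column is r-1 and the next coordinate is the boundary value d_(m,r) = 0, which is
    why circling then tests beta = 0. *)
Lemma circled_star v m p : (0 < p <= m)%N -> (m < r)%N ->
  circled (star v) m p = (ccoord v m (r - 1 + p - m) == 0%R).
Proof.
move=> hp mr; rewrite /circled /ccoord dcoord_star //.
case: eqP => [->|ne].
  rewrite (_ : (r - 1 + m - m).+1 = r); last by lia.
  by rewrite /dcoord eqxx subr0.
rewrite (_ : (r - 1 + p - m).+1 = (r - 1 + p.+1 - m)%N); last by lia.
by rewrite dcoord_star ?subr_eq0 //; lia.
Qed.

(** omega reads the blocks upwards and each block backwards, omega_dag the blocks downwards and each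
    block forwards. *)
Lemma omega_word_star v : omega_word (star v) = rev (dag_word r (dcoords v)).
Proof.
rewrite -Omega_words /omega_word rev_flatten -map_comp map_rev revK; congr flatten.
apply/eq_in_map => m; rewrite mem_iota => hm /=.
rewrite filter_rev; congr rev; apply/eq_in_filter => p; rewrite mem_iota => hp.
by apply: circled_star; lia.
Qed.

Lemma omega_star v : omega (star v) = ((dag v)^-1)%g.
Proof.
by rewrite /omega omega_word_star hecke_permE ?all_rev ?demazure_prod_rev // simple_dag_word.
Qed.

End OmegaWords.

Theorem theorem8p1 (r : nat) (hr : (2 <= r)%N) :
  (forall w : 'S_r,
     [set v : Binf r | demazure w v]%classic
       = [set v : Binf r | bruhat_le (omega_dag v * w0 r)%g w]%classic
     /\ [set v : Binf r | demazure w v]%classic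
       = [set v : Binf r | bruhat_le (w0 r * omega v)%g w]%classic)
  /\ (forall v : Binf r,
        (w0 r * omega v * w0 r)%g = omega_dag v
        /\ omega_dag v = ((omega (star v))^-1)%g).
Proof.
have r0 : (0 < r)%N by exact: ltnW.
(* Invert dag(star v) w_0 = (dag(v) w_0)^-1 and substitute omega(v) = dag(star v)^-1, using w_0^2 =
   1. *)
have e (v : Binf r) : (w0 r * omega v = omega_dag v * w0 r)%g.
  have := kappa_star r0 v; have := omega_star r0 (star v).
  rewrite starK // omega_dagE // /kappa => -> h.
  rewrite -[in RHS](invgK (dag v * _)%g) -h invMg; congr (_ * _)%g.
  by apply/(mulgI (w0 r)); rewrite mulgV w0K.
split=> [w|v].
  split; apply/predeqP => v /=; rewrite ?e omega_dagE //; exact: demazureE.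
by rewrite e mul_w0K omega_star // omega_dagE // invgK.
Qed.
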